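(* If $0<d<\tfrac12$, then for every integer $\tilde t$, as $\tilde H\to\infty$ (with $m$ fixed), $$\mathrm{corr}\left(R_{\tilde t,\tilde t+\tilde H},\,RV_{\tilde t-\tilde H,\tilde t}\right)\longrightarrow 2^{2d}-1.$$
   Context: Standing model. Fix $d\in[0,\tfrac12)$, $H=\tfrac12+d$, $c>0$, $\lambda>0$, $\mu>0$. Let $B_H$ be fractional Brownian motion with Hurst index $H$ and $Z_H(t)=B_H(ct)-B_H(ct-1)$ (stationary Gaussian, mean $0$, variance $1$, autocovariance $\gamma_Z(r)=\tfrac12[|cr+1|^{2H}-2|cr|^{2H}+|cr-1|^{2H}]$). $N$ is a Cox process on $\mathbb R$ directed by $\Lambda(A)=\int_A\lambda e^{Z_H(t)}dt$, $\Delta N(t)=N((t-1,t])$. $(e_k)$ are i.i.d. with mean $0$, variance $\sigma_e^2$, finite moments of all orders, independent of $N$, attached to the successive points of $N$. Daily returns: $r_t=\mu\Delta N(t)+\sum e_k$ (sum over shocks attached to points in $(t-1,t]$), $t\in\mathbb Z$; $(r_t)$ is strictly stationary. Aggregation: fix an integer $m\ge1$; $R_{\tilde t,\tilde t+\tilde H}=\sum_{t=\tilde tm+1}^{(\tilde t+\tilde H)m}r_t$ and $RV_{\tilde t-\tilde H,\tilde t}=\sum_{t=(\tilde t-\tilde H)m+1}^{\tilde tm}r_t^2$. *)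

(* Defs.v *)
From HB Require Import structures.
From mathcomp Require Import all_boot all_order all_algebra.
From mathcomp Require Import all_classical all_reals all_analysis.
Set Implicit Arguments. Unset Strict Implicit. Unset Printing Implicit Defensive.
Import Order.TTheory GRing.Theory Num.Theory.
Import numFieldNormedType.Exports.
Local Open Scope classical_set_scope.
Local Open Scope ring_scope.

Section Model.
Context {dT : measure_display} {T : measurableType dT} {R : realType}.
Variable P : probability T R.

Definition fbm_cov (H s t : R) : R :=
  (`|s| `^ (2 * H) + `|t| `^ (2 * H) - `|t - s| `^ (2 * H)) / 2.

Definition centered_gaussian (X : T -> R) (v : R) : Prop :=
  if v == 0 then P [set w | X w = 0] = 1%E
  else forall A : set R, measurable A ->
         P (X @^-1` A) = normal_prob 0 (Num.sqrt v) A.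

Definition is_fBm (H : R) (B : R -> T -> R) : Prop :=
  (forall t, measurable_fun setT (B t)) /\
  (forall w, continuous (fun t => B t w)) /\
  (forall (n : nat) (ts : 'I_n -> R) (a : 'I_n -> R),
     centered_gaussian (fun w => \sum_(i < n) a i * B (ts i) w)
       (\sum_(i < n) \sum_(j < n) a i * a j * fbm_cov H (ts i) (ts j))).

Definition Zproc (c : R) (B : R -> T -> R) (t : R) (w : T) : R :=
  B (c * t) w - B (c * t - 1) w.

Definition Lam (lam : R) (Z : R -> T -> R) (a b : R) (w : T) : R :=
  lam * fine (\int[lebesgue_measure]_(t in `]a, b]) (expR (Z t w))%:E)%E.

(** The point process N is encoded by its integer-valued counting function
    C with C(0)=0: N((a,b]) = C b - C a.  Points are enumerated by k : int
    in increasing order, so that the points in (a,b] carry the indices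
    C a + 1, ..., C b. *)
Definition is_counting (C : R -> T -> int) : Prop :=
  (forall t, measurable_fun setT (fun w => (C t w)%:~R : R)) /\
  (forall w, C 0 w = 0).

(** N is a Cox process directed by Lambda: conditionally on (the sigma-field
    of) Z, the counts on finitely many disjoint intervals are independent
    Poisson with means Lambda(a_i,b_i].  Conditioning is expressed against
    the generating pi-system of cylinder events of Z. *)
Definition is_Cox (lam : R) (Z : R -> T -> R) (C : R -> T -> int) : Prop :=
  forall (n : nat) (a b : 'I_n -> R) (k : 'I_n -> nat),
    (forall i, a i < b i) ->
    (forall i j, i != j -> b i <= a j \/ b j <= a i) ->
    forall (p : nat) (s : 'I_p -> R) (A : 'I_p -> set R),
      (forall j, measurable (A j)) ->
      P ([set w | forall j, A j (Z (s j) w)] `&`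
         [set w | forall i, C (b i) w - C (a i) w = (k i)%:Z]) =
      (\int[P]_(w in [set w | forall j, A j (Z (s j) w)])
          (\prod_(i < n) poisson_pmf (Lam lam Z (a i) (b i) w) (k i))%:E)%E.

Definition iid_shocks (e : int -> T -> R) : Prop :=
  (forall k, measurable_fun setT (e k)) /\
  (forall k (A : set R), measurable A -> P (e k @^-1` A) = P (e 0 @^-1` A)) /\
  (forall (p : nat) (ks : 'I_p -> int) (A : 'I_p -> set R),
     injective ks -> (forall j, measurable (A j)) ->
     P [set w | forall j, A j (e (ks j) w)] =
     (\prod_(j < p) P (e (ks j) @^-1` A j))%E) /\
  (forall n : nat, P.-integrable setT (fun w => ((e 0 w) ^+ n)%:E)) /\
  (\int[P]_w (e 0 w)%:E = 0)%E.

Definition indep_shocks_counts (e : int -> T -> R) (C : R -> T -> int) : Prop :=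
  forall (p : nat) (ks : 'I_p -> int) (A : 'I_p -> set R),
    (forall j, measurable (A j)) ->
    forall (q : nat) (ts : 'I_q -> R) (js : 'I_q -> int),
      let E1 := [set w | forall j, A j (e (ks j) w)] in
      let E2 := [set w | forall i, C (ts i) w = js i] in
      P (E1 `&` E2) = (P E1 * P E2)%E.

(** daily return r_t = mu * Delta N(t) + sum of the shocks attached to the
    points in (t-1, t] *)
Definition ret (mu : R) (C : R -> T -> int) (e : int -> T -> R)
    (t : int) (w : T) : R :=
  let lo := C (t%:~R - 1) w in
  let hi := C t%:~R w in
  mu * (hi - lo)%:~R + \sum_(i < `|hi - lo|%N) e (lo + 1 + i%:Z) w.

Definition Ragg (r : int -> T -> R) (m : nat) (tt : int) (HH : nat) (w : T) : R :=
  \sum_(i < HH * m) r (tt * m%:Z + 1 + i%:Z) w.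

Definition RVagg (r : int -> T -> R) (m : nat) (tt : int) (HH : nat) (w : T) : R :=
  \sum_(i < HH * m) (r ((tt - HH%:Z) * m%:Z + 1 + i%:Z) w) ^+ 2.

Definition corr (X Y : T -> R) : R :=
  fine (covariance P X Y) / Num.sqrt (fine (variance P X) * fine (variance P Y)).

End Model.

(* Main.v *)
Require Import Defs.
From HB Require Import structures.
From mathcomp Require Import all_boot all_order all_algebra.
From mathcomp Require Import all_classical all_reals all_analysis.
From mathcomp Require Import measurable_realfun.
From mathcomp Require Import ring lra zify.
Import Order.TTheory GRing.Theory Num.Theory.
Import numFieldNormedType.Exports.
Local Open Scope classical_set_scope.
Local Open Scope ring_scope.

Set Implicit Arguments.
Unset Strict Implicit.

(** The covariance of [r_t^i] and [r_s^j] (i, j = 1, 2) is a combination of the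
    numbers E[L_t^p L_s^q] - E[L^p] E[L^q], where [L_t] is the intensity mass of
    day t: the shocks are independent of the counts, and the joint factorial
    moments of Cox counts are the moments of the intensities.  Since Z is
    Gaussian, E[L_t^p L_s^q] lies between E[L^p] E[L^q] exp(p q g) for g the
    extreme values of the autocovariance of Z over the lags between the two
    days.  With a = 2H and h(x) = |x+1|^a - 2|x|^a + |x-1|^a this gives
    cov(r_t^i, r_s^j) ~ k A_i A_j h(t - s) for constants k, A_i > 0.  Double
    sums of h telescope, so over n days the variances of the aggregates are
    ~ 2 k A_i^2 n^a, and their covariance, taken over adjacent blocks of days,
    is ~ k A_1 A_2 (2^a - 2) n^a.  The quotient tends to
    (2^a - 2) / 2 = 2^(2d) - 1. *)

(** * The second difference of the power function: size, summation and scaling *)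

Section second_difference.
Context {R : realType}.
Implicit Types a x y c eps : R.

(** Covariances of nearby days are never computed, only bounded: there are [O(n)] such pairs,
    negligible against [n^a] because [d > 0] means [a > 1]. For distant days a small relative error
    is enough, so two-sided comparisons under the time integrals replace any formula for
    E[L_t^p L_s^q]. The paths of [C] are not assumed monotone, and the number of shocks of a day is
    random. Expectations of returns are therefore split over the countably many values of [C] at the
    end points of the days involved. On each such event the shock indices form fixed sets, disjoint
    for distinct days up to null events, and the event is independent of the shocks. Fourth moments
    of the counts dominate all products r_t^p r_s^q with p, q <= 2. The constants arise as follows.
    E[r^p | n points] is a combination of falling factorials (n)_j with coefficients b_j, and the
    (j,k) factorial moments have covariance ~ j k l_j l_k [kap] h, where l_j = E[L^j]; hence A_p is
    the sum of the j b_j l_j. In [kap] = c^(a-2) / 2 the power comes from rescaling h by c and the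
    half from the autocovariance of Z. All of them cancel in the correlation, so the limit depends
    on d alone. *)

Definition sdiff a x : R := `|x + 1| `^ a - 2 * `|x| `^ a + `|x - 1| `^ a.

Lemma sdiffN a x : sdiff a (- x) = sdiff a x.
Proof.
rewrite /sdiff normrN -(normrN (- x + 1)) -(normrN (- x - 1)).
rewrite !opprD !opprK; ring.
Qed.

Lemma sdiff_norm a x : sdiff a `|x| = sdiff a x.
Proof. by have [//|_] := ger0P x; rewrite sdiffN. Qed.

Lemma MVT_closed (f df : R -> R) (u v : R) : u < v ->
  (forall x : R, u <= x <= v -> is_derive x 1 f (df x)) ->
  exists2 z : R, u < z < v & f v - f u = df z * (v - u).
Proof.
move=> uv D; have [||z zuv E] := @MVT R f df u v uv.
- by move=> x; rewrite in_itv/= => /andP[ux xv]; apply: D; rewrite !ltW.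
- have H : {in `[u, v], forall x, derivable f x 1}.
    by move=> x; rewrite in_itv/= => xuv; have [] := D x xuv.
  exact: derivable_within_continuous H.
- by exists z => //; move: zuv; rewrite in_itv.
Qed.

Lemma powR_MVT (a u v : R) : 0 < u -> u < v ->
  exists2 z, u < z < v & v `^ a - u `^ a = a * z `^ (a - 1) * (v - u).
Proof.
move=> u0 uv.
apply: (@MVT_closed (fun t => t `^ a) (fun t => a * t `^ (a - 1)) u v uv).
by move=> x /andP[ux _]; apply: is_derive1_powR; lra.
Qed.

(** The mean value theorem is used twice: for [f u = (u + 1)^a - u^a] on [[x - 1, x]], then for the
    power [a - 1] on [[z, z + 1]]. The condition [1 < x] keeps all points positive. *)
Lemma sdiff_MVT a x : 1 < x ->
  exists2 z, x - 1 < z < x + 1 & sdiff a x = a * (a - 1) * z `^ (a - 2).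
Proof.
move=> x1.
pose f (u : R) : R := (u + 1) `^ a - u `^ a.
pose df (u : R) : R := a * (u + 1) `^ (a - 1) - a * u `^ (a - 1).
have D (u : R) : x - 1 <= u <= x -> is_derive u 1 f (df u).
  move=> /andP[u0 _].
  have u1 : 0 < u by lra.
  have u2 : 0 < u + 1 by lra.
  have H1 := @is_derive1_powR _ a u u1.
  have H2 := @is_derive1_powR _ a (u + 1) u2.
  have H3 : is_derive u 1 (fun t : R => t + 1) 1.
    by apply: is_derive_eq; rewrite addr0.
  have H4 : is_derive u 1 ((fun t : R => t `^ a) \o (fun t : R => t + 1)) (a * (u + 1) `^ (a - 1)).
    rewrite -[X in is_derive _ _ _ X]mulr1.
    exact: (@is_derive1_comp _ (fun t : R => t `^ a) (fun t : R => t + 1)).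
  exact: (is_deriveB H4 H1).
have lt : x - 1 < x by lra.
have [z /andP[z1 z2] E] := MVT_closed lt D.
have z0 : 0 < z by lra.
have zz : z < z + 1 by lra.
have [w /andP[w1 w2] W] := powR_MVT (a - 1) z0 zz.
exists w; first by apply/andP; split; lra.
have -> : sdiff a x = f x - f (x - 1).
  rewrite /sdiff /f !ger0_norm; [|lra..].
  by rewrite subrK; ring.
rewrite E /df -mulrBr W (_ : a - 1 - 1 = a - 2); ring.
Qed.

Lemma powR_npos_le a x y : a <= 0 -> 0 < x -> x <= y -> y `^ a <= x `^ a.
Proof.
move=> a0 x0 xy.
rewrite -(opprK a) (powRN y) (powRN x) lef_pV2 ?posrE ?powR_gt0//; last lra.
by apply: ge0_ler_powR; rewrite ?nnegrE; lra.
Qed.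

Lemma sdiff_bounds a x : 1 < a < 2 -> 1 < x ->
  a * (a - 1) * (x + 1) `^ (a - 2) <= sdiff a x <= a * (a - 1) * (x - 1) `^ (a - 2).
Proof.
move=> /andP[a1 a2] x1; have [z /andP[z1 z2] ->] := sdiff_MVT a x1.
have C : 0 < a * (a - 1) by nra.
by rewrite !ler_pM2l// !powR_npos_le//; lra.
Qed.

Lemma sdiff_gt0 a x : 1 < a < 2 -> 1 < x -> 0 < sdiff a x.
Proof.
move=> a12 x1; have /andP[H _] := sdiff_bounds a12 x1.
apply: lt_le_trans H; case/andP: a12 => a1 a2.
by rewrite mulr_gt0 ?powR_gt0//; nra.
Qed.

Lemma sdiff0 a : 0 < a -> sdiff a 0 = 2.
Proof.
move=> a0; rewrite /sdiff add0r sub0r normr0 normrN normr1 powR1 powR0; last by rewrite gt_eqF.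
lra.
Qed.

(** The values at 0 and 1 are 2 and [2^a - 2]; beyond, [a * (a - 1) <= 2] and a negative exponent
    give the bound. Nonnegativity allows multiples of [sdiff] to serve as error terms, and the bound
    2 controls the lags near 0. *)
Lemma sdiff_nat_bounds a k : 1 < a < 2 -> 0 <= sdiff a k%:R <= 2.
Proof.
move=> a12; have /andP[a1 a2] := a12; case: k => [|[|k]].
- by rewrite sdiff0; lra.
- rewrite /sdiff subrr normr0 normr1 powR1 powR0; last by rewrite gt_eqF; lra.
  rewrite (_ : `|_| = 2); last by rewrite ger0_norm; lra.
  have := @le1r_powR _ 2 a _ _; have := @ler_powR _ 2 _ a 2 _.
  rewrite (_ : 2 `^ 2 = 4); last by rewrite (@powR_mulrn _ 2 2)//; ring.
  move=> H1 H2; have := H1 ltac:(lra) ltac:(lra); have := H2 ltac:(lra) ltac:(lra); lra.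
- have k1 : (1 : R) < k.+2%:R by rewrite ltr1n.
  have /andP[_ H] := sdiff_bounds a12 k1; rewrite ltW ?sdiff_gt0//=.
  apply: le_trans H _.
  have : (k.+2%:R - 1 : R) `^ (a - 2) <= 1.
    apply: le_trans (powR_npos_le (x := 1) _ _ _) _; rewrite ?powR1//; try lra.
    by rewrite -[in leRHS]addn1 natrD addrK ler1n.
  have := powR_ge0 (k.+2%:R - 1) (a - 2).
  set p := _ `^ _ => p0 p1; have : a * (a - 1) <= 2 by nra.
  nra.
Qed.

Lemma sdiff_int_bounds a (z : int) : 1 < a < 2 -> 0 <= sdiff a z%:~R <= 2.
Proof. by move=> ?; rewrite -sdiff_norm -intr_norm -natr_absz; exact: sdiff_nat_bounds. Qed.

(** The sum over [j] telescopes to a difference of two first differences, which telescopes again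
    over [i]. What is left is the second difference with step [n] in place of 1. *)
Lemma sdiff_sum a (n : nat) y :
  \sum_(i < n) \sum_(j < n) sdiff a (y + i%:R - j%:R) =
  `|y + n%:R| `^ a - 2 * `|y| `^ a + `|y - n%:R| `^ a.
Proof.
pose g x := `|x| `^ a.
have inner x : \sum_(j < n) sdiff a (x - j%:R) = (g (x + 1) - g x) - (g (x - n%:R + 1) - g (x - n%:R)).
  elim: n => [|n IHn]; first by rewrite big_ord0 !subr0 subrr.
  rewrite big_ord_recr/= IHn /sdiff -/(g _) -/(g _) -/(g _) -(natr1 n) (_ : x - (n%:R + 1) + 1 = x - n%:R); last ring.
  rewrite (_ : x - (n%:R + 1) = x - n%:R - 1); ring.
under eq_bigr do rewrite inner.
rewrite -/(g _) -/(g _) -/(g _).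
have outer (y' : R) (m : nat) : \sum_(i < m) (g (y' + i%:R + 1) - g (y' + i%:R)) = g (y' + m%:R) - g y'.
  elim: m => [|m IHm]; first by rewrite big_ord0 addr0 subrr.
  by rewrite big_ord_recr/= IHm -(natr1 m) (addrA y'); ring.
rewrite big_split/= outer sumrN.
under [X in _ - X]eq_bigr => i _ do rewrite (addrAC y).
by rewrite outer subrK; ring.
Qed.

Lemma powR_npos_small a eps : a < 0 -> 0 < eps ->
  exists K : nat, forall k : nat, (K <= k)%N -> (0 < k)%N && (k%:R `^ a <= eps).
Proof.
move=> a0 e0; have [K HK] : exists K : nat, eps `^ (a^-1) <= K%:R.
  by exists (Num.truncn (eps `^ (a^-1))).+1; apply/ltW/truncnS_gt.
exists K.+1 => k Kk; have k0 : (0 < k)%N by lia.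
rewrite k0/=; have ea : 0 < eps `^ a^-1 by exact: powR_gt0.
have -> : eps = (eps `^ a^-1) `^ a by rewrite -powRrM mulVf ?powRr1 ?lt_eqF//; lra.
apply: powR_npos_le => //; first lra.
by apply: le_trans HK _; rewrite ler_nat; lia.
Qed.

Lemma sdiff_small a eps : 1 < a < 2 -> 0 < eps ->
  exists K : nat, forall k : nat, (K <= k)%N -> (1 < k)%N && (sdiff a k%:R <= eps).
Proof.
move=> a12 e0; have /andP[a1 a2] := a12.
(* Half of [eps] suffices because the bound carries the factor [a * (a - 1) <= 2]. *)
have e2 : 0 < eps / 2 by lra.
have [|K HK] := powR_npos_small (a := a - 2) _ e2; first lra.
exists K.+2 => k Kk; have k1 : (1 < k)%N by lia.
rewrite k1/=; have k1' : (1 : R) < k%:R by rewrite ltr1n.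
have /andP[_ H] := sdiff_bounds a12 k1'; apply: le_trans H _.
have /HK/andP[_] : (K <= k.-1)%N by lia.
have -> : (k.-1%:R : R) = k%:R - 1 by rewrite -subn1 natrB//; lia.
have := powR_ge0 (k%:R - 1) (a - 2).
set p := _ `^ _ => p0 p1; have : a * (a - 1) <= 2 by nra.
nra.
Qed.

(** The quotient of the two powers is [(v / u)^(-b)] with [v / u >= 1] and [-b <= 1], hence at most
    [v / u]. Comparing powers is thereby reduced to comparing the points linearly. *)
Lemma powR_ratio_bounds (b u v : R) : -1 <= b <= 0 -> 0 < u -> u <= v ->
  v `^ b <= u `^ b <= v / u * v `^ b.
Proof.
move=> /andP[b1 b0] u0 uv; rewrite powR_npos_le//=.
have v0 : 0 < v by lra.
have vu : 1 <= v / u by rewrite ler_pdivlMr// mul1r.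
have -> : u = v / (v / u) by rewrite invf_div mulrCA divff ?gt_eqF// mulr1.
have q0 : 0 < v / u by lra.
rewrite powRM ?invr_ge0; [|lra..].
rewrite [leRHS]mulrC !(invf_div v u) !(mulrCA v) !divff ?gt_eqF// !mulr1.
rewrite ler_wpM2l ?powR_ge0// -(invf_div u v) -[(u / v)^-1]powR_inv1; last by rewrite divr_ge0// ltW.
have [w0 w1] : 0 < u / v /\ u / v <= 1.
  by rewrite divr_gt0// ler_pdivrMr// mul1r.
by apply: ger_powR; lra.
Qed.

(** Both second differences lie between multiples of [(a-2)]-th powers at points a bounded distance
    apart, whose ratio tends to 1. The offset [y] stands for the difference of two instants within
    their days, so the threshold must be uniform in it. *)
Lemma sdiff_ratio a c eps : 1 < a < 2 -> 0 < c -> 0 < eps ->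
  exists K : nat, forall (k : nat) y, (K <= k)%N -> `|y| <= 1 ->
   (1 - eps) * (c `^ (a - 2) * sdiff a k%:R) <= sdiff a (c * (k%:R + y))
     <= (1 + eps) * (c `^ (a - 2) * sdiff a k%:R).
Proof.
move=> a12 c0 e0; have /andP[a1 a2] := a12.
(* The points compared differ by at most [2 + 1 / c <= D], and [k > N] gives
   [D <= eps * (k - 4 - 1 / c)]: the gap is at most [eps] times the smaller point. It also makes
   [c * (k + y)] exceed 1. *)
pose D := 4 + 2 / c; pose N := D + D / eps + 4 + 1 / c.
have ic : 0 < 1 / c by rewrite divr_gt0.
have D0 : 0 < D by rewrite /D (_ : 2 / c = 2 * (1 / c)); [lra|ring].
have De : 0 < D / eps by rewrite divr_gt0.
exists (Num.truncn N).+1 => k y kN; rewrite ler_norml => /andP[y1 y2].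
have : N < k%:R by apply: lt_le_trans (truncnS_gt _) _; rewrite ler_nat.
move: (k%:R : R) => {kN} {}k kN.
have k4 : 4 + 1 / c < k by rewrite /N in kN; lra.
have k1 : 1 < k by lra.
have ck : 1 < c * (k + y).
  have : 1 / c * c = 1 by rewrite divfK ?gt_eqF.
  nra.
have /andP[L1 U1] := sdiff_bounds a12 k1.
have /andP[L2 U2] := sdiff_bounds a12 ck.
have C0 : 0 < a * (a - 1) by nra.
have ccE : c * (1 / c) = 1 by rewrite mulrC divfK ?gt_eqF.
have cp : 0 < c `^ (a - 2) by exact: powR_gt0.
have b01 : -1 <= a - 2 <= 0 by lra.
have De' : D <= eps * (k - 4 - 1 / c).
  have : D = eps * (D / eps) by rewrite mulrC divfK ?gt_eqF.
  have : D / eps <= k - 4 - 1 / c by rewrite /N in kN; lra.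
  nra.
have D4 : D = 4 + 2 * (1 / c) by rewrite /D; ring.
apply/andP; split.
- apply: le_trans L2.
  have -> : c * (k + y) + 1 = c * (k + y + 1 / c) by rewrite [in RHS]mulrDr ccE.
  have u0 : 0 < k - 1 by lra.
  have uv : k - 1 <= k + y + 1 / c by lra.
  have /andP[_] := powR_ratio_bounds b01 u0 uv.
  have uv1 : (1 - eps) * ((k + y + 1 / c) / (k - 1)) <= 1.
    rewrite mulrA ler_pdivrMr// mul1r; nra.
  have := powR_ge0 (k + y + 1 / c) (a - 2).
  rewrite powRM; [|lra..].
  have q0 : 0 < (k + y + 1 / c) / (k - 1) by rewrite divr_gt0//; lra.
  move: uv1 q0; set q := _ / (k - 1); set P := _ `^ _; set Q := (k - 1) `^ _ => uv1 q0 P0 QP.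
  have Q0 : 0 <= Q := powR_ge0 _ _.
  have X : (1 - eps) * sdiff a k <= a * (a - 1) * P.
    (* The upper bound of [sdiff a k] can be multiplied by [1 - eps] only if that is nonnegative;
       otherwise the left side is at most 0. *)
    have [e1|e1] := lerP eps 1.
      apply: le_trans (_ : (1 - eps) * (a * (a - 1) * (q * P)) <= _).
        rewrite ler_wpM2l//; first lra.
        by apply: le_trans U1 _; rewrite ler_pM2l.
      have -> : (1 - eps) * (a * (a - 1) * (q * P)) = a * (a - 1) * P * ((1 - eps) * q) by ring.
      rewrite -[leRHS]mulr1 ler_wpM2l// mulr_ge0// ltW//.
    apply: (@le_trans _ _ 0); last by rewrite mulr_ge0// ltW.
    by rewrite nmulr_rle0; [exact/ltW/sdiff_gt0|lra].
  rewrite (_ : a * (a - 1) * (_ * P) = c `^ (a - 2) * (a * (a - 1) * P)); last ring.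
  by rewrite mulrCA ler_pM2l.
- apply: le_trans U2 _.
  have -> : c * (k + y) - 1 = c * (k + y - 1 / c) by rewrite [in RHS]mulrBr ccE.
  have u0 : 0 < k + y - 1 / c by lra.
  have uv : k + y - 1 / c <= k + 1 by lra.
  have /andP[_] := powR_ratio_bounds b01 u0 uv.
  have uv1 : (k + 1) / (k + y - 1 / c) <= 1 + eps.
    rewrite ler_pdivrMr//; nra.
  have P0 := powR_ge0 (k + 1) (a - 2).
  rewrite powRM; [|lra..].
  move: uv1; set q := _ / _; set P := (k + 1) `^ _; set Q := (k + y - 1 / c) `^ _ => uv1 QP.
  rewrite (_ : a * (a - 1) * (_ * Q) = c `^ (a - 2) * (a * (a - 1) * Q)); last ring.
  rewrite [leRHS]mulrCA ler_pM2l//.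
  apply: le_trans (_ : a * (a - 1) * ((1 + eps) * P) <= _).
    rewrite ler_pM2l//; apply: le_trans QP _; rewrite ler_wpM2r//.
  by rewrite mulrCA ler_pM2l//; lra.
Qed.

End second_difference.

(** * Double sums of kernels asymptotic to a second difference *)

Section double_sums.
Context {R : realType}.
Implicit Types a eps M : R.

Lemma sum_close_indices_le (K n z : nat) :
  (\sum_(j < n) (`|(z%:Z - j%:Z)%R|%N < K) <= 2 * K)%N.
Proof.
rewrite -(big_mkord xpredT (fun j => nat_of_bool (`|(z%:Z - j%:Z)%R|%N < K)%N)).
rewrite -big_mkcond/= sum1_count -size_filter.
(* If [z < K], the truncated subtraction starts the window at 0, and [2 * K] indices still cover all
   [j < z + K]. *)
rewrite -(size_iota (z - K) (2 * K)); apply: uniq_leq_size.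
  by rewrite filter_uniq// iota_uniq.
move=> j; rewrite mem_filter !mem_iota => /andP[]; lia.
Qed.

(* A kernel asymptotic to [A] times the second difference: the finitely many
   diagonals near 0 contribute only [O(n)] to the double sum. *)
Lemma kernel_sum_estimate (rho : nat -> nat -> R) (A M eps a S : R) (K y n : nat) :
  1 < a < 2 -> 0 <= M -> 0 <= eps ->
  (forall i j, `|rho i j| <= M) ->
  (forall i j, (K <= `|((y + i)%:Z - j%:Z)%R|)%N ->
    `|rho i j - A * sdiff a (y%:R + i%:R - j%:R)| <= eps * sdiff a (y%:R + i%:R - j%:R)) ->
  S = \sum_(i < n) \sum_(j < n) sdiff a (y%:R + i%:R - j%:R) ->
  `|\sum_(i < n) \sum_(j < n) rho i j - A * S| <=
  eps * S + n%:R * ((M + 2 * `|A|) * (2 * K)%:R).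
Proof.
move=> a12 M0 e0 rhoM rhoA ->.
pose near i j : bool := (`|((y + i)%:Z - j%:Z)%R|%N < K)%N.
have sI i j : y%:R + i%:R - j%:R = (((y + i)%:Z - j%:Z)%:~R : R).
  by rewrite rmorphB/= -!pmulrn natrD.
have M1 : 0 <= M + 2 * `|A| by rewrite addr_ge0// mulr_ge0.
(* Near the diagonal nothing is known but [|rho| <= M] and [sdiff <= 2], whence the constant
   [M + 2 * |A|]. *)
have term i j : `|rho i j - A * sdiff a (y%:R + i%:R - j%:R)| <=
    eps * sdiff a (y%:R + i%:R - j%:R) + (M + 2 * `|A|) * (near i j)%:R.
  have /andP[s0 s2] : 0 <= sdiff a (y%:R + i%:R - j%:R) <= 2.
    by rewrite sI; exact: sdiff_int_bounds.
  rewrite /near; case: ltnP => K1.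
    rewrite mulr1 ler_wpDl ?mulr_ge0//.
    apply: le_trans (ler_normB _ _) _; rewrite lerD// normrM.
    by rewrite mulrC ler_wpM2r// ger0_norm.
  by rewrite mulr0 addr0; exact: rhoA.
rewrite mulr_sumr -sumrB.
apply: le_trans (ler_norm_sum _ _ _) _.
apply: (@le_trans _ _ (\sum_(i < n) (eps * \sum_(j < n) sdiff a (y%:R + i%:R - j%:R)
   + (M + 2 * `|A|) * (2 * K)%:R))).
  apply: ler_sum => i _.
  rewrite mulr_sumr -sumrB; apply: le_trans (ler_norm_sum _ _ _) _.
  apply: le_trans (ler_sum _ (fun (j : 'I_n) _ => term i j)) _.
  rewrite big_split/= -!mulr_sumr lerD2l ler_wpM2l//.
  by rewrite -natr_sum ler_nat; exact: sum_close_indices_le.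
by rewrite big_split/= -mulr_sumr lerD2l sumr_const card_ord (mulr_natl _ n).
Qed.

(** Division by [n^a] leaves [n^(1 - a)] times a constant from the near-diagonal terms, which
    vanishes since [a > 1]. The kernel and the offset [y n] depend on [n] because one block of days
    moves with its length; the threshold [K] does not. Here [H] is the constant of the telescoped
    sum, not the Hurst index. *)
Lemma kernel_sum_cvg (rho : nat -> nat -> nat -> R) (y : nat -> nat) (A M a H : R) :
  1 < a < 2 ->
  (forall n i j, `|rho n i j| <= M) ->
  (forall eps, 0 < eps -> exists K : nat, forall n i j,
    (K <= `|((y n + i)%:Z - j%:Z)%R|)%N ->
    `|rho n i j - A * sdiff a ((y n)%:R + i%:R - j%:R)| <=
      eps * sdiff a ((y n)%:R + i%:R - j%:R)) ->
  (forall n : nat, \sum_(i < n) \sum_(j < n) sdiff a ((y n)%:R + i%:R - j%:R) = H * n%:R `^ a) ->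
  (fun n : nat => (\sum_(i < n) \sum_(j < n) rho n i j) / n%:R `^ a) @ \oo --> A * H.
Proof.
move=> a12 rM rA SH; have /andP[a1 a2] := a12.
have M0 : 0 <= M := le_trans (normr_ge0 _) (rM 0%N 0%N 0%N).
(* For [n = 1] the hypothesis on the sums identifies [H] with a value of [sdiff]. *)
have H0 : 0 <= H.
  have := SH 1%N; rewrite !big_ord1 powR1 mulr1 => <-.
  rewrite (_ : (y 1)%:R + _ - _ = ((y 1)%:Z)%:~R); last by rewrite addr0 subr0.
  by have /andP[] := @sdiff_int_bounds R a (y 1) a12.
apply/cvgrPdist_le => /= e e0.
(* Half of the error is for the distant lags and half for the near ones; adding 1 guards against
   [H = 0], and likewise [D = 0] below. *)
pose e1 := e / 2 / (H + 1).
have e10 : 0 < e1 by rewrite !divr_gt0//; lra.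
have [K HK] := rA _ e10.
pose D := (M + 2 * `|A|) * (2 * K)%:R.
have D0 : 0 <= D by rewrite mulr_ge0// addr_ge0// mulr_ge0.
have e20 : 0 < e / 2 / (D + 1) by rewrite !divr_gt0//; lra.
have [|K2 HK2] := @powR_npos_small R (1 - a) _ _ e20; first lra.
near=> n.
have /HK2/andP[n0 nK2] : (K2 <= n)%N by near: n; exact: nbhs_infty_ge.
have N0 : (0 : R) < n%:R by rewrite ltr0n.
have P0 : 0 < n%:R `^ a :> R by exact: powR_gt0.
have := @kernel_sum_estimate (rho n) A M e1 a _ K (y n) n a12 M0 (ltW e10) (rM n) (HK n) (esym (SH n)).
rewrite -/D => E.
rewrite distrC -[X in _ - X](@mulfK _ (n%:R `^ a)) ?gt_eqF// -mulrBl normrM.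
rewrite (ger0_norm (x := _^-1)); last by rewrite invr_ge0 ltW.
rewrite ler_pdivrMr// -mulrA; apply: le_trans E _.
have X1 : e1 * (H * n%:R `^ a) <= e / 2 * n%:R `^ a.
  rewrite mulrA ler_pM2r// /e1.
  by rewrite mulrAC ler_pdivrMr//; nra.
have X2 : n%:R * D <= e / 2 * n%:R `^ a.
  have E1 : (n%:R : R) `^ (1 - a) * n%:R `^ a = n%:R.
    by rewrite -powRD ?subrK ?powRr1// gt_eqF// implybT.
  rewrite -{1}E1 mulrAC ler_pM2r//.
  apply: (@le_trans _ _ (e / 2 / (D + 1) * D)); first by rewrite ler_wpM2r.
  by rewrite mulrAC ler_pdivrMr//; nra.
lra.
Unshelve. all: by end_near.
Qed.

End double_sums.

(** * Real-valued expectations and independence *)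

Section expectation_calculus.
Context {dT : measure_display} {T : measurableType dT} {R : realType}.
Variable P : probability T R.
Implicit Types (f g X Y : T -> R).

Definition rintegrable f := P.-integrable setT (EFin \o f).
Definition Ex f : R := \int[P]_w f w.

Lemma Ex_EFin f : rintegrable f -> (\int[P]_w (f w)%:E)%E = (Ex f)%:E.
Proof. by move=> fi; rewrite /Ex /Rintegral fineK//; exact: integrable_fin_num fi. Qed.

Lemma rintegrable_measurable f : rintegrable f -> measurable_fun setT f.
Proof. by move=> /measurable_int/measurable_EFinP. Qed.

Lemma rintegrable_cst (k : R) : rintegrable (fun=> k).
Proof.
have := @finite_measure_integrable_cst _ T R P setT k measurableT; exact.
Qed.

Lemma Ex_cst (k : R) : Ex (fun=> k) = k.
Proof. by rewrite /Ex Rintegral_cst//= probability_setT mulr1. Qed.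

Lemma rintegrableD f g : rintegrable f -> rintegrable g -> rintegrable (fun w => f w + g w).
Proof. by move=> fi gi; exact: (integrableD measurableT fi gi). Qed.

Lemma ExD f g : rintegrable f -> rintegrable g -> Ex (fun w => f w + g w) = Ex f + Ex g.
Proof. by move=> fi gi; exact: RintegralD. Qed.

Lemma rintegrableZ (k : R) f : rintegrable f -> rintegrable (fun w => k * f w).
Proof. by move=> fi; exact: (integrableZl measurableT k fi). Qed.

Lemma ExZ (k : R) f : rintegrable f -> Ex (fun w => k * f w) = k * Ex f.
Proof. by move=> fi; exact: RintegralZl. Qed.

Lemma rintegrable_sum I (s : seq I) (F : I -> T -> R) :
  (forall i, rintegrable (F i)) -> rintegrable (fun w => \sum_(i <- s) F i w).
Proof.
move=> Fi; elim: s => [|i s IHs].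
  by apply: eq_integrable (rintegrable_cst 0) => // w _; rewrite /= big_nil.
by apply: eq_integrable (rintegrableD (Fi i) IHs) => // w _; rewrite /= big_cons.
Qed.

Lemma Ex_sum I (s : seq I) (F : I -> T -> R) :
  (forall i, rintegrable (F i)) -> Ex (fun w => \sum_(i <- s) F i w) = \sum_(i <- s) Ex (F i).
Proof.
move=> Fi; elim: s => [|i s IHs].
  rewrite big_nil -[RHS]Ex_cst; congr Ex.
  by apply/funext => w; rewrite big_nil.
rewrite big_cons -IHs -ExD//; last exact: rintegrable_sum.
by congr Ex; apply/funext => w; rewrite big_cons.
Qed.

Lemma rintegrable_le f g : measurable_fun setT f -> (forall w, `|f w| <= g w) ->
  rintegrable g -> rintegrable f.
Proof.
move=> mf fg gi; apply: le_integrable gi => //; first exact/measurable_EFinP.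
move=> w _ /=; rewrite lee_fin; apply: le_trans (fg w) _; exact: ler_norm.
Qed.

Lemma Ex_le f g : rintegrable f -> rintegrable g -> (forall w, f w <= g w) -> Ex f <= Ex g.
Proof. by move=> fi gi fg; apply: le_Rintegral. Qed.

Lemma Ex_ge0 f : (forall w, 0 <= f w) -> 0 <= Ex f.
Proof. by move=> f0; apply: Rintegral_ge0. Qed.

Lemma normr_Ex_le f g : rintegrable f -> rintegrable g -> (forall w, `|f w| <= g w) ->
  `|Ex f| <= Ex g.
Proof.
move=> fi gi fg; have H w := fg w; rewrite ler_norml -mulN1r -ExZ//.
apply/andP; split; apply: Ex_le => //; do ?exact: rintegrableZ.
- by move=> w; have := fg w; rewrite mulN1r ler_norml => /andP[].
- by move=> w; have := fg w; rewrite ler_norml => /andP[].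
Qed.

Lemma Ex_indic A : measurable A -> Ex \1_A = fine (P A).
Proof. by move=> mA; rewrite /Ex /Rintegral integral_indic// setIT. Qed.

Lemma rintegrable_indic A : measurable A -> rintegrable \1_A.
Proof.
move=> mA; apply: (@rintegrable_le _ (fun=> 1)); last exact: rintegrable_cst.
  exact: measurable_indic.
by move=> w; rewrite indicE; case: (_ \in _); rewrite ?normr1 ?normr0.
Qed.

Lemma integral_distribution_norm (V : {mfun T >-> R}) :
  (\int[distribution P V]_y `|y|%:E = \int[P]_w `|V w|%:E)%E.
Proof.
apply: (@ge0_integral_distribution _ _ _ _ _ P V (fun y : R => `|y|%:E)) => //.
by apply/measurable_EFinP; exact: normr_measurable.
Qed.

Lemma integral_distribution_id (V : {mfun T >-> R}) : rintegrable V ->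
  (\int[distribution P V]_y y%:E = \int[P]_w (V w)%:E)%E.
Proof. by move=> iV; apply: (@integral_distribution _ _ _ _ _ P V EFin). Qed.

(** The joint law agrees with the product of the marginal laws on rectangles, hence everywhere.
    Tonelli then makes the product integrable, and Fubini evaluates its integral. *)
Lemma indep_Ex X Y :
  (forall A B, measurable A -> measurable B ->
    P (X @^-1` A `&` Y @^-1` B) = (P (X @^-1` A) * P (Y @^-1` B))%E) ->
  rintegrable X -> rintegrable Y ->
  rintegrable (fun w => X w * Y w) /\ Ex (fun w => X w * Y w) = Ex X * Ex Y.
Proof.
move=> XY Xi Yi.
have mX := rintegrable_measurable Xi; have mY := rintegrable_measurable Yi.
have mXY : measurable_fun setT (fun w => (X w, Y w)) by exact: measurable_fun_pair.
pose X' : {mfun T >-> R} := HB.pack X (isMeasurableFun.Build _ _ _ _ _ mX).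
pose Y' : {mfun T >-> R} := HB.pack Y (isMeasurableFun.Build _ _ _ _ _ mY).
pose Z' : {mfun T >-> (R * R)%type} :=
  HB.pack (fun w => (X w, Y w)) (isMeasurableFun.Build _ _ _ _ _ mXY).
pose m1 := distribution P X'; pose m2 := distribution P Y'; pose m := distribution P Z'.
have mE : forall S, measurable S -> (m1 \x m2)%E S = m S.
  apply: product_measure_unique => A B mA mB; exact: XY.
pose f (z : R * R) : \bar R := (z.1 * z.2)%:E.
have mf : measurable_fun setT f.
  by apply/measurable_EFinP; apply: measurable_funM; [exact: measurable_fst|exact: measurable_snd].
have XYm : measurable_fun setT (fun w => X w * Y w) by exact: measurable_funM.
have fin_abs g : rintegrable g -> (\int[P]_w `|g w|%:E)%E \is a fin_num.
  move=> gi; rewrite (Ex_EFin (f := fun w => `|g w|))//.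
  by apply: integrable_norm.
have absE : (\int[m1]_x \int[m2]_y `|f (x, y)| =
   (\int[P]_w `|X w|%:E) * (\int[P]_w `|Y w|%:E))%E.
  have inner x : (\int[m2]_y `|f (x, y)| = `|x|%:E * \int[P]_w `|Y w|%:E)%E.
    rewrite -(integral_distribution_norm Y') -ge0_integralZl//.
    - by apply: eq_integral => y _; rewrite /f/= normrM EFinM.
    - by apply/measurable_EFinP; exact: normr_measurable.
  rewrite (eq_integral (fun x : R => `|x|%:E * \int[P]_w `|Y w|%:E)%E); last by move=> x _; exact: inner.
  rewrite ge0_integralZr//.
  - by congr (_ * _)%E; exact: (integral_distribution_norm X').
  - by apply/measurable_EFinP; exact: normr_measurable.
  - by apply: integral_ge0 => w _; rewrite lee_fin.
have fi : (m1 \x m2)%E.-integrable setT f.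
  by apply/integrable12ltyP => //; rewrite absE ltey_eq fin_numM ?fin_abs.
have fim : m.-integrable setT f.
  apply/integrableP; split => //; have /integrableP[_] := fi.
  by rewrite (eq_measure_integral m)// => A mA _; exact: mE.
have fXY : rintegrable (fun w => X w * Y w).
  apply/integrableP; split; first exact/measurable_EFinP.
  have /integrableP[_] := fim; rewrite /m ge0_integral_distribution//.
  exact: measurableT_comp.
split=> //; apply: EFin_inj; rewrite -Ex_EFin// EFinM -!Ex_EFin//.
transitivity (\int[m]_z f z)%E; first by rewrite /m integral_distribution.
transitivity (\int[(m1 \x m2)%E]_z f z)%E.
  by apply: eq_measure_integral => A mA _; exact/esym/mE.
rewrite -integral12_prod_meas1// /fubini_F.
have iYd : m2.-integrable setT (EFin : R -> \bar R) by exact: integrable_pushforward.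
have iXd : m1.-integrable setT (EFin : R -> \bar R) by exact: integrable_pushforward.
have inner x : (\int[m2]_y f (x, y) = x%:E * \int[P]_w (Y w)%:E)%E.
  by rewrite -(integral_distribution_id (V := Y'))// -integralZl.
rewrite (eq_integral (fun x : R => x%:E * (Ex Y)%:E)%E); last first.
  by move=> x _; rewrite inner Ex_EFin.
by rewrite integralZr// (integral_distribution_id (V := X'))// !Ex_EFin.
Qed.

(** Uniqueness of measures on a pi-system, used twice: for fixed [B], the measures [P (A & B)] and
    [P B * P A] of [A] agree on the generators, hence on the generated sigma-algebra; then the roles
    are exchanged. *)
Lemma indep_sigma (G1 G2 : set (set T)) :
  G1 `<=` measurable -> G2 `<=` measurable -> setI_closed G1 -> setI_closed G2 ->
  G1 setT -> G2 setT ->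
  (forall A B, G1 A -> G2 B -> P (A `&` B) = (P A * P B)%E) ->
  forall A B, <<s G1 >> A -> <<s G2 >> B -> P (A `&` B) = (P A * P B)%E.
Proof.
move=> G1m G2m G1I G2I G1T G2T G12.
have s1 := smallest_sub (@sigma_algebra_measurable _ T) G1m.
have s2 := smallest_sub (@sigma_algebra_measurable _ T) G2m.
have PE A : measurable A -> P A = (fine (P A))%:E.
  by move=> mA; rewrite fineK// fin_num_measure.
have nn A : measurable A -> 0 <= fine (P A) by move=> mA; exact/fine_ge0/measure_ge0.
have key (G : set (set T)) (B : set T) : G `<=` measurable -> setI_closed G -> G setT ->
    measurable B -> (forall A, G A -> P (A `&` B) = (P A * P B)%E) ->
    forall A, <<s G >> A -> P (A `&` B) = (P A * P B)%E.
  move=> Gm GI GT mB H A sA.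
  have := @g_sigma_algebra_measure_unique _ R T G Gm (fun=> setT) _ _
    (mrestr P mB) (mscale (NngNum (nn B mB)) P) GI _ _ A sA.
  rewrite /mrestr/= /mscale/= -PE// muleC; apply => //.
  - by rewrite bigcup_const//; exists 0%N.
  - by move=> C GC; rewrite /mrestr H// muleC.
  - by move=> _; rewrite /mrestr setTI (le_lt_trans (probability_le1 _ _)) ?ltry.
move=> A B sA sB; have mA := s1 _ sA; have mB := s2 _ sB.
apply: (key G1) => // C GC; rewrite setIC muleC.
by apply: (key G2) => // [|D GD]; [exact: G1m|rewrite setIC muleC G12].
Qed.

Definition gmeas (G : set (set T)) (X : T -> R) :=
  measurable_fun setT (X : g_sigma_algebraType G -> R).

Lemma indep_sigma_Ex (G1 G2 : set (set T)) X Y :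
  G1 `<=` measurable -> G2 `<=` measurable -> setI_closed G1 -> setI_closed G2 ->
  G1 setT -> G2 setT ->
  (forall A B, G1 A -> G2 B -> P (A `&` B) = (P A * P B)%E) ->
  gmeas G1 X -> gmeas G2 Y -> rintegrable X -> rintegrable Y ->
  rintegrable (fun w => X w * Y w) /\ Ex (fun w => X w * Y w) = Ex X * Ex Y.
Proof.
move=> G1m G2m G1I G2I G1T G2T G12 X1 Y2 Xi Yi; apply: indep_Ex => // A B mA mB.
apply: (indep_sigma G1m G2m) => //.
- by have := X1 measurableT A mA; rewrite setTI.
- by have := Y2 measurableT B mB; rewrite setTI.
Qed.

End expectation_calculus.

(** * Moments of sums of shocks on an event independent of them *)

Section shock_blocks.
Context {dT : measure_display} {T : measurableType dT} {R : realType}.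
Variables (P : probability T R) (e : int -> T -> R).
Hypothesis eiid : iid_shocks P e.

Let me k : measurable_fun setT (e k) := eiid.1 k.

Definition shock_event (S : seq int) (A : int -> set R) : set T :=
  [set w | forall k, k \in S -> A k (e k w)].

Lemma measurable_shock_event S A : (forall k, measurable (A k)) ->
  measurable (shock_event S A).
Proof.
move=> mA; have -> : shock_event S A = \big[setI/setT]_(k <- S) (e k @^-1` A k).
  apply/seteqP; split => w.
    rewrite /shock_event/= => H; rewrite -bigcap_seq => k/= kS; exact: H.
  by rewrite -bigcap_seq => H k kS; exact: H.
apply: bigsetI_measurable => k _; rewrite -[X in measurable X]setTI.
exact: me.
Qed.

Lemma shock_event_prob S A : uniq S -> (forall k, measurable (A k)) ->
  P (shock_event S A) = (\prod_(k <- S) P (e 0 @^-1` A k))%E.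
Proof.
move=> uS mA; have [_ [ident [mut _]]] := eiid.
have inj : injective (tnth (in_tuple S)) by apply/tuple_uniqP.
have := mut (size S) (tnth (in_tuple S)) (fun j => A (tnth (in_tuple S) j)) inj (fun=> mA _).
under [X in _ = X -> _]eq_bigr do rewrite ident//.
move=> H'; rewrite [RHS]big_tnth -H'; congr (P _); apply/seteqP; split => w H.
  by move=> j; apply: H; rewrite mem_tnth.
by move=> k /(tnthP (in_tuple S))[j ->]; exact: H.
Qed.

(** Events that fix finitely many counts have this property, and it is all that this section knows
    about the counting process. *)
Definition indep_of_shocks (D : set T) := measurable D /\
  forall S A, uniq S -> (forall k, measurable (A k)) ->
  P (shock_event S A `&` D) = (P (shock_event S A) * P D)%E.

Lemma indep_of_shocksT : indep_of_shocks setT.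
Proof. by split => // S A _ _; rewrite setIT probability_setT mule1. Qed.

(** A pi-system whose sigma-algebra contains the event [D] and makes the shocks with index in [S]
    measurable. *)
Definition shock_block (S : seq int) (D : set T) : set (set T) :=
  [set E | exists2 A, (forall k, measurable (A k)) &
    E = shock_event S A \/ E = shock_event S A `&` D].

Lemma shock_block_measurable S D : measurable D -> shock_block S D `<=` measurable.
Proof.
move=> mD E [A mA [->|->]]; first exact: measurable_shock_event.
by apply: measurableI => //; exact: measurable_shock_event.
Qed.

Lemma shock_eventI S A B :
  shock_event S A `&` shock_event S B = shock_event S (fun k => A k `&` B k).
Proof.
apply/seteqP; split => w; first by move=> [H1 H2] k kS; split; [exact: H1|exact: H2].
by move=> H; split => k kS; have [] := H k kS.
Qed.

Lemma shock_block_setI S D : setI_closed (shock_block S D).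
Proof.
move=> E F [A mA EA] [B mB FB]; exists (fun k => A k `&` B k).
  by move=> k; exact: measurableI.
case: EA FB => -> [] ->.
- by left; rewrite shock_eventI.
- by right; rewrite setIA shock_eventI.
- by right; rewrite setIAC shock_eventI.
- by right; rewrite setIACA shock_eventI setIid.
Qed.

Lemma shock_eventT S : shock_event S (fun=> setT) = setT.
Proof. by apply/seteqP; split. Qed.

Lemma shock_block_setT S D : shock_block S D setT.
Proof. by exists (fun=> setT) => //; left; rewrite shock_eventT. Qed.

Lemma shock_event_cat S1 S2 A1 A2 : uniq (S1 ++ S2) ->
  shock_event S1 A1 `&` shock_event S2 A2 =
  shock_event (S1 ++ S2) (fun k => if k \in S1 then A1 k else A2 k).
Proof.
rewrite cat_uniq => /and3P[_ /hasPn S12 _]; apply/seteqP; split => w.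
  move=> [H1 H2] k; rewrite mem_cat; case: ifPn => [kS _|kS /= kS2]; first exact: H1.
  exact: H2.
move=> H; split => k kS; have := H k; rewrite mem_cat kS ?orbT => /(_ isT)//.
by have := S12 _ kS; rewrite /= => /negbTE ->.
Qed.

Lemma shock_block_indep S1 S2 D : uniq (S1 ++ S2) -> indep_of_shocks D ->
  forall E F, shock_block S1 D E -> shock_block S2 setT F ->
  P (E `&` F) = (P E * P F)%E.
Proof.
move=> uS [mD iD] E F [A1 mA1 EE] [A2 mA2 FF].
have -> : F = shock_event S2 A2 by case: FF => ->; rewrite ?setIT.
have [uS1 _ uS2] := and3P (eqbLR (cat_uniq S1 S2) uS).
pose A k := if k \in S1 then A1 k else A2 k.
have mA k : measurable (A k) by rewrite /A; case: ifP.
have S12 : P (shock_event S1 A1 `&` shock_event S2 A2) =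
    (P (shock_event S1 A1) * P (shock_event S2 A2))%E.
  rewrite shock_event_cat// !shock_event_prob// big_cat/=; congr (_ * _)%E.
    by apply: eq_big_seq => k ->.
  apply: eq_big_seq => k kS.
  have /hasPn/(_ _ kS)/= : ~~ has (mem S1) S2 by move: uS; rewrite cat_uniq => /and3P[].
  by move/negbTE => ->.
case: EE => -> //.
(* Both groups of shocks are first merged into one event, from which [D] splits off; only then are
   the groups separated. *)
rewrite setIAC shock_event_cat// iD// -shock_event_cat// S12 iD//.
by rewrite muleAC.
Qed.

(** With [S1] empty it separates the indicator of [D] from the shocks; with [D = setT] it separates
    two groups of shocks. *)
Lemma shock_block_Ex S1 S2 D X Y : uniq (S1 ++ S2) -> indep_of_shocks D ->
  gmeas (shock_block S1 D) X -> gmeas (shock_block S2 setT) Y ->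
  rintegrable P X -> rintegrable P Y ->
  rintegrable P (fun w => X w * Y w) /\ Ex P (fun w => X w * Y w) = Ex P X * Ex P Y.
Proof.
move=> uS iD; have [mD _] := iD; apply: indep_sigma_Ex.
- exact: shock_block_measurable.
- exact: shock_block_measurable.
- exact: shock_block_setI.
- exact: shock_block_setI.
- exact: shock_block_setT.
- exact: shock_block_setT.
- exact: shock_block_indep.
Qed.

Lemma gmeas_shock S D k : k \in S -> gmeas (shock_block S D) (e k).
Proof.
move=> kS _ A mA; rewrite setTI; apply: sub_sigma_algebra.
exists (fun j => if j == k then A else setT); first by move=> j; case: ifP.
left; apply/seteqP; split => w /=.
  by move=> H j jS; case: eqP => // ->.
by move=> /(_ k kS); rewrite eqxx.
Qed.

Lemma gmeas_indic S D : gmeas (shock_block S D) (\1_D : T -> R).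
Proof.
apply: (@measurable_indic _ (g_sigma_algebraType (shock_block S D)) R setT D).
apply: sub_sigma_algebra; exists (fun=> setT) => //.
by right; rewrite shock_eventT setTI.
Qed.

Definition shock_sum (S : seq int) (w : T) : R := \sum_(k <- S) e k w.

Lemma gmeas_sum_comp S' S D (f : R -> R) : measurable_fun setT f -> {subset S <= S'} ->
  gmeas (shock_block S' D) (fun w => \sum_(k <- S) f (e k w)).
Proof.
move=> mf; elim: S => [|k S IHS] kS.
  rewrite /gmeas (_ : (fun _ => _) = (fun=> 0)); first exact: measurable_cst.
  by apply/funext => w; rewrite big_nil.
rewrite /gmeas (_ : (fun _ => _) = (fun w => f (e k w) + \sum_(k <- S) f (e k w))); last first.
  by apply/funext => w; rewrite big_cons.
apply: measurable_funD; last by apply: IHS => j jS; apply: kS; rewrite in_cons jS orbT.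
apply: measurableT_comp => //.
by apply: gmeas_shock; rewrite kS// mem_head.
Qed.

Lemma gmeas_shock_sum S' S D : {subset S <= S'} -> gmeas (shock_block S' D) (shock_sum S).
Proof. by move=> SS; apply: (@gmeas_sum_comp S' S D id) => //; exact: measurable_id. Qed.

Lemma shock_pow_law k n : rintegrable P (fun w => e k w ^+ n) /\
  Ex P (fun w => e k w ^+ n) = Ex P (fun w => e 0 w ^+ n).
Proof.
have [_ [ident [_ [int0 _]]]] := eiid.
pose E j : {mfun T >-> R} := HB.pack (e j) (isMeasurableFun.Build _ _ _ _ _ (me j)).
have law A : measurable A -> distribution P (E k) A = distribution P (E 0) A.
  by move=> mA; exact: ident.
have mX : measurable_fun setT (fun x : R => (x ^+ n)%:E).
  by apply/measurable_EFinP; exact: exprn_measurable.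
have i0 : (distribution P (E 0)).-integrable setT (fun x : R => (x ^+ n)%:E).
  exact: (@integrable_pushforward _ _ _ _ _ (e 0) (me 0) P setT _ mX (int0 n)).
have ik : rintegrable P (fun w => e k w ^+ n).
  apply/integrableP; split.
    by apply/measurable_EFinP; apply: measurable_funX.
  have /integrableP[_] := i0.
  rewrite -(@eq_measure_integral _ _ _ setT (distribution P (E 0)) (distribution P (E k))).
    by rewrite ge0_integral_distribution//; exact: measurableT_comp.
  by move=> A mA _; exact: law.
split=> //; rewrite /Ex /Rintegral; congr fine.
rewrite -(integral_distribution (X := E k) mX)//.
rewrite -(integral_distribution (X := E 0) mX)//; last exact: int0.
by apply: eq_measure_integral => A mA _; exact: law.
Qed.

Let sigma2 := Ex P (fun w => e 0 w ^+ 2).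

Lemma rintegrable_shock k : rintegrable P (e k).
Proof.
by have [+ _] := shock_pow_law k 1; apply: eq_integrable => // w _; rewrite /= expr1.
Qed.

Lemma Ex_shock k : Ex P (e k) = 0.
Proof.
have [_] := shock_pow_law k 1.
have [_ [_ [_ [_ c0]]]] := eiid.
under [X in Ex P X = _ -> _]eq_fun do rewrite expr1.
by under [X in _ = Ex P X -> _]eq_fun do rewrite expr1; move=> ->; rewrite /Ex /Rintegral c0.
Qed.

Lemma shock_sum_moments S : uniq S ->
  [/\ rintegrable P (shock_sum S), Ex P (shock_sum S) = 0,
      rintegrable P (fun w => shock_sum S w ^+ 2) &
      Ex P (fun w => shock_sum S w ^+ 2) = (size S)%:R * sigma2].
Proof.
elim: S => [_|k S IHS /= /andP[kS uS]].
  have -> : shock_sum [::] = fun=> 0 by apply/funext => w; rewrite /shock_sum big_nil.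
  rewrite mul0r expr0n/= !Ex_cst; split => //; exact: rintegrable_cst.
have [i1 E1 i2 E2] := IHS uS.
have -> : shock_sum (k :: S) = fun w => e k w + shock_sum S w.
  by apply/funext => w; rewrite /shock_sum big_cons.
have [|ixy Exy] := @shock_block_Ex [:: k] S setT (e k) (shock_sum S) _ indep_of_shocksT
  (@gmeas_shock [:: k] setT k (mem_head _ _)) (@gmeas_shock_sum S S setT (fun _ => id))
  (rintegrable_shock k) i1; first by rewrite /= kS.
have [ik Ek] := shock_pow_law k 2.
have sq : (fun w => (e k w + shock_sum S w) ^+ 2) =
   (fun w => (e k w ^+ 2 + 2 * (e k w * shock_sum S w)) + shock_sum S w ^+ 2).
  by apply/funext => w; ring.
have ii := rintegrableD ik (rintegrableZ 2 ixy).
split.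
- by apply: rintegrableD => //; exact: rintegrable_shock.
- by rewrite ExD//; [rewrite Ex_shock E1 addr0|exact: rintegrable_shock].
- by rewrite sq; exact: rintegrableD.
- rewrite sq ExD// ExD//; last exact: rintegrableZ.
  by rewrite ExZ// Exy Ex_shock mul0r mulr0 addr0 Ek E2 -/sigma2 -(natr1 (size S)); ring.
Qed.

(** For [p = 1, 2] this is the [p]-th moment of [x] plus [n] independent shocks, as the next lemma
    shows. *)
Definition shock_moment (p : nat) (x : R) (n : nat) : R :=
  x ^+ p + (p == 2)%:R * (n%:R * sigma2).

Lemma shifted_shock_moment S p x : uniq S -> (0 < p <= 2)%N ->
  rintegrable P (fun w => (x + shock_sum S w) ^+ p) /\
  Ex P (fun w => (x + shock_sum S w) ^+ p) = shock_moment p x (size S).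
Proof.
move=> uS; have [i1 E1 i2 E2] := shock_sum_moments uS.
have ix := rintegrable_cst P x.
case: p => [//|[_|[_|//]]]; rewrite /shock_moment/=.
  under eq_fun do rewrite expr1; rewrite expr1 mul0r addr0; split; first exact: rintegrableD.
  by rewrite ExD// Ex_cst E1 addr0.
have -> : (fun w => (x + shock_sum S w) ^+ 2) =
   (fun w => (x ^+ 2 + 2 * x * shock_sum S w) + shock_sum S w ^+ 2).
  by apply/funext => w; ring.
have ii := rintegrableD (rintegrable_cst P (x ^+ 2)) (rintegrableZ (2 * x) i1).
split; first exact: rintegrableD.
by rewrite ExD// ExD//; [rewrite ExZ// Ex_cst E1 E2; ring|exact: rintegrable_cst|exact: rintegrableZ].
Qed.

Lemma gmeas_shifted S D x p : gmeas (shock_block S D) (fun w => (x + shock_sum S w) ^+ p).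
Proof.
apply: measurable_funX; apply: measurable_funD; first exact: measurable_cst.
exact: (@gmeas_shock_sum S S D (fun _ => id)).
Qed.

(** In the application [D] fixes the counts of two days, [x] and [y] are the resulting drift parts
    of the returns, and [S1], [S2] the indices of their shocks. The indicator travels with the first
    block. *)
Lemma block_moment D S1 S2 x y p q : uniq (S1 ++ S2) -> indep_of_shocks D ->
  (0 < p <= 2)%N -> (0 < q <= 2)%N ->
  let F w := \1_D w * (x + shock_sum S1 w) ^+ p * (y + shock_sum S2 w) ^+ q in
  rintegrable P F /\
  Ex P F = fine (P D) * shock_moment p x (size S1) * shock_moment q y (size S2).
Proof.
move=> uS iD pp qq F; have [mD _] := iD.
have [uS1 _ uS2] := and3P (eqbLR (cat_uniq S1 S2) uS).
have [i1 E1] := shifted_shock_moment x uS1 pp.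
have [i2 E2] := shifted_shock_moment y uS2 qq.
have [|iX EX] := @shock_block_Ex [::] S1 D \1_D (fun w => (x + shock_sum S1 w) ^+ p) _ iD
  (@gmeas_indic [::] D) (@gmeas_shifted S1 setT x p) (rintegrable_indic P mD) i1; first by [].
have [iF EF] := @shock_block_Ex S1 S2 D
  (fun w => \1_D w * (x + shock_sum S1 w) ^+ p) (fun w => (y + shock_sum S2 w) ^+ q) uS iD
  (measurable_funM (@gmeas_indic S1 D) (@gmeas_shifted S1 D x p)) (@gmeas_shifted S2 setT y q) iX i2.
by split=> //; rewrite /F EF EX E1 E2 Ex_indic.
Qed.

Lemma sqr_sum_le (S : seq int) (f : int -> R) :
  (\sum_(k <- S) f k) ^+ 2 <= (size S)%:R * \sum_(k <- S) f k ^+ 2.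
Proof.
elim: S => [|k S IHS]; first by rewrite !big_nil expr0n/= mulr0.
rewrite !big_cons/= -natr1.
have [->|S0] := eqVneq S [::]; first by rewrite !big_nil !addr0 add0r mul1r.
have : (0 : R) < (size S)%:R by rewrite ltr0n lt0n size_eq0.
move: IHS; move: (size S)%:R (\sum_(j <- S) f j) (\sum_(j <- S) f j ^+ 2) (f k) => n Y Q x H n0.
rewrite -subr_ge0 -(pmulr_rge0 _ n0).
(* After multiplication by [n > 0] the claim is a square plus a multiple of the induction
   hypothesis. *)
have -> : n * ((n + 1) * (x ^+ 2 + Q) - (x + Y) ^+ 2) = (n * x - Y) ^+ 2 + (n + 1) * (n * Q - Y ^+ 2) by ring.
by rewrite addr_ge0 ?sqr_ge0// mulr_ge0; lra.
Qed.

(** The pointwise bounds [(x + s)^4 <= 8 x^4 + 8 s^4] and, by Cauchy-Schwarz twice, [s^4 <= n^3]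
    times the sum of the fourth powers. For [x] proportional to [n] everything is of order [n^4], so
    the fourth moment of the counts will suffice for integrability. *)
Lemma block_fourth_moment D S x : uniq S -> indep_of_shocks D ->
  let F w := \1_D w * (x + shock_sum S w) ^+ 4 in
  rintegrable P F /\
  Ex P F <= fine (P D) * (8 * (x ^+ 4 + (size S)%:R ^+ 4 * Ex P (fun w => e 0 w ^+ 4))).
Proof.
move=> uS iD F; have [mD _] := iD.
pose Q w := \sum_(k <- S) e k w ^+ 4.
pose n : R := (size S)%:R.
have n0 : 0 <= n by rewrite ler0n.
have ptw w : (x + shock_sum S w) ^+ 4 <= 8 * x ^+ 4 + 8 * n ^+ 3 * Q w.
  have H1 := sqr_sum_le S (fun k => e k w); have H2 := sqr_sum_le S (fun k => e k w ^+ 2).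
  have QE : \sum_(k <- S) (e k w ^+ 2) ^+ 2 = Q w by apply: eq_bigr => k _; rewrite -exprM.
  rewrite QE -/n in H2; rewrite -/(shock_sum S w) -/n in H1.
  set s := shock_sum S w in H1 *; set q := \sum_(k <- S) e k w ^+ 2 in H1 H2.
  have s2 : 0 <= s ^+ 2 by exact: sqr_ge0.
  have q0 : 0 <= q by apply: sumr_ge0 => k _; exact: sqr_ge0.
  have s4 : (s ^+ 2) ^+ 2 <= n ^+ 3 * Q w.
    apply: (@le_trans _ _ ((n * q) ^+ 2)); first by rewrite lerXn2r ?nnegrE// mulr_ge0.
    have -> : n ^+ 3 * Q w = n ^+ 2 * (n * Q w) by ring.
    by rewrite exprMn ler_wpM2l// sqr_ge0.
  have : (x + s) ^+ 4 <= 8 * x ^+ 4 + 8 * (s ^+ 2) ^+ 2.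
    have -> : (x + s) ^+ 4 = ((x + s) ^+ 2) ^+ 2 by ring.
    have h1 : (x + s) ^+ 2 <= 2 * x ^+ 2 + 2 * s ^+ 2 by have := sqr_ge0 (x - s); lra.
    have h2 : ((x + s) ^+ 2) ^+ 2 <= (2 * x ^+ 2 + 2 * s ^+ 2) ^+ 2.
      have A1 := sqr_ge0 x; have A2 := sqr_ge0 (x + s).
      by apply: lerXn2r => //; rewrite nnegrE; lra.
    apply: le_trans h2 _; have := sqr_ge0 (x ^+ 2 - s ^+ 2); lra.
  lra.
have iQ : rintegrable P Q by apply: rintegrable_sum => k; have [] := shock_pow_law k 4.
have EQ : Ex P Q = n * Ex P (fun w => e 0 w ^+ 4).
  rewrite /Q Ex_sum; last by move=> k; have [] := shock_pow_law k 4.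
  under eq_bigr do rewrite (shock_pow_law _ 4).2.
  by rewrite big_const_seq count_predT iter_addr_0 mulr_natl.
have gQ : gmeas (shock_block S setT) Q.
  apply: (@gmeas_sum_comp S S setT (fun y => y ^+ 4)) => //; exact: exprn_measurable.
pose G w := 8 * x ^+ 4 + 8 * n ^+ 3 * Q w.
have iG : rintegrable P G by apply: rintegrableD; [exact: rintegrable_cst|exact: rintegrableZ].
have EG : Ex P G = 8 * (x ^+ 4 + n ^+ 4 * Ex P (fun w => e 0 w ^+ 4)).
  by rewrite ExD ?Ex_cst ?ExZ ?EQ//; [ring|exact: rintegrable_cst|exact: rintegrableZ].
have gG : gmeas (shock_block S setT) G.
  by apply: measurable_funD; [exact: measurable_cst|apply: measurable_funM; [exact: measurable_cst|exact: gQ]].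
have [|iDG EDG] := @shock_block_Ex [::] S D \1_D G _ iD (@gmeas_indic [::] D) gG (rintegrable_indic P mD) iG.
  by [].
have mS : measurable_fun setT (shock_sum S).
  by have [/rintegrable_measurable] := shock_sum_moments uS.
have le w : `|F w| <= \1_D w * G w.
  rewrite /F normrM ger0_norm// ger0_norm; last by rewrite exprn_even_ge0.
  by rewrite ler_wpM2l// ptw.
have iF : rintegrable P F.
  apply: rintegrable_le le iDG; apply: measurable_funM; first exact: measurable_indic.
  by apply: measurable_funX; apply: measurable_funD.
split=> //; rewrite -EG -(Ex_indic P mD) -EDG; apply: Ex_le => // w.
by apply: le_trans (le w); exact: ler_norm.
Qed.

End shock_blocks.

(** * Splitting expectations over the fibers of a countably valued map *)

Section countable_partition.
Context {dT : measure_display} {T : measurableType dT} {R : realType}.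
Variables (P : probability T R) (I : countType) (K : T -> I).
Hypothesis mK : forall k, measurable [set w | K w = k].

Definition fiber (k : I) : set T := [set w | K w = k].

Let Gn n : set T := if @pickle_inv I n is Some k then fiber k else set0.

Let tFn : trivIset setT Gn.
Proof.
apply/trivIsetP => i j _ _ ij; rewrite -subset0 => w []; rewrite /Gn.
case Ei : pickle_inv => [ki|//]; case Ej : pickle_inv => [kj|//].
move=> Ki Kj; case/eqP: ij.
have E : ki = kj by rewrite -(Ki : K w = ki) -(Kj : K w = kj).
move: (@pickle_invK I i) (@pickle_invK I j); rewrite /oapp Ei Ej => <- <-.
by rewrite E.
Qed.

Let mGn n : measurable (Gn n).
Proof. by rewrite /Gn; case: pickle_inv => [k|]; [exact: mK|exact: measurable0]. Qed.

Let cover : \bigcup_n Gn n = setT.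
Proof.
apply/seteqP; split => // w _; exists (pickle (K w)) => //.
by rewrite /Gn pickleK_inv.
Qed.

(** Meant for functions such as a return, a sum whose length is random but constant on each
    fiber. *)
Lemma measurable_fun_partition d' (U : measurableType d') (f : T -> U) :
  (forall k, exists2 g : T -> U, measurable_fun setT g & forall w, K w = k -> f w = g w) ->
  measurable_fun setT f.
Proof.
move=> fg _ A mA; rewrite setTI.
have -> : f @^-1` A = \bigcup_n (Gn n `&` f @^-1` A).
  by rewrite -setI_bigcupl cover setTI.
apply: bigcupT_measurable => n; rewrite /Gn; case: pickle_inv => [k|]; last first.
  by rewrite set0I; exact: measurable0.
have [g mg E] := fg k; have -> : fiber k `&` f @^-1` A = fiber k `&` g @^-1` A.
  by apply/seteqP; split => w [Kw]; rewrite /preimage/= ?E// => Aw; split => //; rewrite /preimage/= E.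
by apply: measurableI; [exact: mK|rewrite -[X in measurable X]setTI; exact: mg].
Qed.

Lemma Ex_fiber (f : T -> R) (D : set T) : measurable D ->
  Ex P (fun w => \1_D w * f w) = fine (\int[P]_(w in D) (f w)%:E).
Proof.
move=> mD; rewrite /Ex /Rintegral [in RHS]integral_mkcond; congr fine.
apply: eq_integral => w _; rewrite patchE indicE; case: ifPn => _.
  by rewrite mul1r.
by rewrite mul0r.
Qed.

(** This takes the place of conditioning on [K]: both integrals are the sums of their integrals over
    the fibers. *)
Lemma eq_Ex_partition (f g : T -> R) : rintegrable P f -> rintegrable P g ->
  (forall k, Ex P (fun w => \1_(fiber k) w * f w) = Ex P (fun w => \1_(fiber k) w * g w)) ->
  Ex P f = Ex P g.
Proof.
move=> fi gi fg; rewrite /Ex /Rintegral; congr fine.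
have B (h : T -> R) : rintegrable P h ->
    (\int[P]_w (h w)%:E = \sum_(i <oo) \int[P]_(w in Gn i) (h w)%:E)%E.
  by move=> hi; rewrite -[in LHS]cover integral_bigcup// cover.
have sub (h : T -> R) n : rintegrable P h -> P.-integrable (Gn n) (EFin \o h).
  by move=> hi; apply: integrableS hi.
rewrite !B//; apply: eq_eseriesr => n _.
have := sub f n fi; have := sub g n gi; rewrite /Gn.
case: pickle_inv => [k|_ _]; last by rewrite !integral_set0.
move=> gk fk; rewrite -[LHS]fineK; last exact: (integrable_fin_num (mK k) fk).
rewrite -[RHS]fineK; last exact: (integrable_fin_num (mK k) gk).
by rewrite -!Ex_fiber ?fg//; exact: mK.
Qed.

(** Nonnegativity permits the summation over the fibers before [f] is known to be integrable. *)
Lemma le_Ex_partition (f g : T -> R) : measurable_fun setT f ->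
  (forall w, 0 <= f w) -> (forall w, 0 <= g w) -> rintegrable P g ->
  (forall k, rintegrable P (fun w => \1_(fiber k) w * f w) /\
    Ex P (fun w => \1_(fiber k) w * f w) <= Ex P (fun w => \1_(fiber k) w * g w)) ->
  rintegrable P f /\ Ex P f <= Ex P g.
Proof.
move=> mf f0 g0 gi fg.
have le : (\int[P]_w (f w)%:E <= \int[P]_w (g w)%:E)%E.
  have mg := rintegrable_measurable gi.
  have B (h : T -> R) : measurable_fun setT h -> (forall w, 0 <= h w) ->
      (\int[P]_w (h w)%:E = \sum_(i <oo) \int[P]_(w in Gn i) (h w)%:E)%E.
    move=> mh h0; rewrite -[in LHS]cover ge0_integral_bigcup//.
    - by rewrite cover; exact/measurable_EFinP.
    - by move=> w _; rewrite lee_fin.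
  rewrite !B//.
  apply: lee_nneseries => [n _ _|n _].
    by apply: integral_ge0 => w _; rewrite lee_fin.
  rewrite /Gn; case E: pickle_inv => [k|]; last by rewrite !integral_set0.
  have [fki fkle] := fg k.
  have restr (h : T -> R) : (\int[P]_(w in fiber k) (h w)%:E)%E =
      (\int[P]_w (\1_(fiber k) w * h w)%:E)%E.
    rewrite [LHS]integral_mkcond; apply: eq_integral => w _; rewrite patchE indicE.
    by case: ifPn => _; rewrite ?mul1r// mul0r.
  have gki : rintegrable P (fun w => \1_(fiber k) w * g w).
    apply: rintegrable_le gi; first by apply: measurable_funM => //; apply: measurable_indic; exact: mK.
    move=> w; rewrite normrM indicE; case: (_ \in _); rewrite ?normr1 ?mul1r ?ger0_norm//.
    by rewrite mul0r.
  by rewrite !restr !Ex_EFin.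
have fi : rintegrable P f.
  apply/integrableP; split; first exact/measurable_EFinP.
  under eq_integral => w _ do rewrite /= ger0_norm//.
  by apply: le_lt_trans le _; rewrite Ex_EFin// ltry.
by split=> //; rewrite -lee_fin -!Ex_EFin.
Qed.

Lemma Ex_null (D : set T) (f : T -> R) : measurable D -> P D = 0%E -> measurable_fun setT f ->
  Ex P (fun w => \1_D w * f w) = 0.
Proof.
move=> mD PD mf; rewrite Ex_fiber// null_set_integral//.
by apply/measurable_EFinP; exact: measurable_funS mf.
Qed.

End countable_partition.

(** * Moments of returns in terms of the daily counts *)

Section returns.
Context {dT : measure_display} {T : measurableType dT} {R : realType}.
Variables (P : probability T R) (e : int -> T -> R) (C : R -> T -> int) (mu : R).
Hypotheses (eiid : iid_shocks P e) (Ccount : is_counting C).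
Hypothesis eC : indep_shocks_counts P e C.

Let me k : measurable_fun setT (e k) := eiid.1 k.

Lemma measurable_count_eq t j : measurable [set w | C t w = j].
Proof.
have [mC _] := Ccount.
have -> : [set w | C t w = j] = (fun w => (C t w)%:~R : R) @^-1` [set j%:~R].
  by apply/seteqP; split => w /=; [move=> ->|move/intr_inj].
by rewrite -[X in measurable X]setTI; exact: mC.
Qed.

Lemma measurable_count_event q (ts : 'I_q -> R) (js : 'I_q -> int) :
  measurable [set w | forall i, C (ts i) w = js i].
Proof.
have -> : [set w | forall i, C (ts i) w = js i] =
    \big[setI/setT]_(i < q) [set w | C (ts i) w = js i].
  apply/seteqP; split => w.
    by move=> H; rewrite -bigcap_seq => i _; exact: H.
  by rewrite -bigcap_seq => H i; apply: H; rewrite /= mem_index_enum.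
by apply: bigsetI_measurable => i _; exact: measurable_count_eq.
Qed.

Lemma count_event_indep q (ts : 'I_q -> R) (js : 'I_q -> int) :
  indep_of_shocks P e [set w | forall i, C (ts i) w = js i].
Proof.
split=> [|S A uS mA]; first exact: measurable_count_event.
have -> : shock_event e S A =
    [set w | forall j, A (tnth (in_tuple S) j) (e (tnth (in_tuple S) j) w)].
  apply/seteqP; split => w H; first by move=> j; apply: H; rewrite mem_tnth.
  by move=> k /(tnthP (in_tuple S))[j ->]; exact: H.
exact: (@eC (size S) (tnth (in_tuple S)) (fun j => A (tnth (in_tuple S) j)) (fun=> mA _) q ts js).
Qed.

(** Increments of [C] are nonnegative only almost surely; the absolute value, also present in [ret],
    gives a natural number everywhere. *)
Definition day_count (t : int) (w : T) : nat := `|C t%:~R w - C (t%:~R - 1) w|%N.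

Definition shock_idx (lo : int) (n : nat) : seq int := [seq lo + 1 + i%:Z | i <- iota 0 n].

Lemma size_shock_idx lo n : size (shock_idx lo n) = n.
Proof. by rewrite size_map size_iota. Qed.

Lemma mem_shock_idx lo n k : (k \in shock_idx lo n) = (lo < k <= lo + n%:Z).
Proof.
apply/mapP/idP => [[i]|/andP[k1 k2]]; first by rewrite mem_iota => /andP[_ i_n] ->; lia.
by exists (absz (k - lo - 1)%R); [rewrite mem_iota; lia|lia].
Qed.

Lemma shock_idx_uniq lo n : uniq (shock_idx lo n).
Proof. by rewrite map_inj_uniq ?iota_uniq// => i j; lia. Qed.

Lemma retE t w : ret mu C e t w =
  mu * (C t%:~R w - C (t%:~R - 1) w)%:~R +
  shock_sum e (shock_idx (C (t%:~R - 1) w) (day_count t w)) w.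
Proof.
rewrite /ret /shock_sum /shock_idx big_map; congr (_ + _).
by rewrite -/(index_iota 0 _) (_ : iota 0 _ = index_iota 0 (day_count t w)) ?big_mkord// /index_iota subn0.
Qed.

(** Both end values are recorded, not just their difference: together they determine which shocks
    belong to the day. *)
Definition day_key (t : int) (w : T) : int * int := (C (t%:~R - 1) w, C t%:~R w).

Lemma day_key_event t k : fiber (day_key t) k =
  [set w | forall i : 'I_2, C ((tnth [tuple t%:~R - 1; t%:~R]) i) w = tnth [tuple k.1; k.2] i].
Proof.
case: k => a b; apply/seteqP; split => w.
  by move=> [<- <-] i; case: i => -[|[|//]] i; rewrite !(tnth_nth 0).
move=> H; have := H ord0; have := H (Ordinal (isT : (1 < 2)%N)).
by rewrite !(tnth_nth 0)/= /fiber/= /day_key => -> ->.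
Qed.

Lemma day_key_indep t k : indep_of_shocks P e (fiber (day_key t) k).
Proof. by rewrite day_key_event; exact: count_event_indep. Qed.

Lemma days_key_event t s k : fiber (fun w => (day_key t w, day_key s w)) k =
  [set w | forall i : 'I_4, C ((tnth [tuple t%:~R - 1; t%:~R; s%:~R - 1; s%:~R]) i) w =
    tnth [tuple k.1.1; k.1.2; k.2.1; k.2.2] i].
Proof.
case: k => [[a b] [a' b']]; apply/seteqP; split => w.
  by move=> [<- <- <- <-] i; case: i => -[|[|[|[|//]]]] i; rewrite !(tnth_nth 0).
move=> H; have := H (Ordinal (isT : (0 < 4)%N)); have := H (Ordinal (isT : (1 < 4)%N)).
have := H (Ordinal (isT : (2 < 4)%N)); have := H (Ordinal (isT : (3 < 4)%N)).
by rewrite !(tnth_nth 0)/= /fiber/= /day_key => -> -> -> ->.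
Qed.

Lemma days_key_indep t s k : indep_of_shocks P e (fiber (fun w => (day_key t w, day_key s w)) k).
Proof. by rewrite days_key_event; exact: count_event_indep. Qed.

Let mday t k : measurable (fiber (day_key t) k).
Proof. by have [] := day_key_indep t k. Qed.

Let mdays t s k : measurable (fiber (fun w => (day_key t w, day_key s w)) k).
Proof. by have [] := days_key_indep t s k. Qed.

Lemma ret_on_fiber t w a b : day_key t w = (a, b) ->
  ret mu C e t w = mu * (b - a)%:~R + shock_sum e (shock_idx a `|b - a|%N) w.
Proof. by case=> Ea Eb; rewrite retE /day_count Ea Eb. Qed.

Lemma measurable_ret t : measurable_fun setT (ret mu C e t).
Proof.
apply: (measurable_fun_partition (mday t)) => -[a b].
exists (fun w => mu * (b - a)%:~R + shock_sum e (shock_idx a `|b - a|%N) w).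
  apply: measurable_funD; first exact: measurable_cst.
  have [/rintegrable_measurable//] := shock_sum_moments eiid (shock_idx_uniq a `|b - a|).
by move=> w /ret_on_fiber.
Qed.

(** On a fiber with [n] points the drift is [mu * n] up to sign, which the even power removes, and
    [block_fourth_moment] yields a constant times [n^4]. *)
Lemma ret_fourth_moment t : rintegrable P (fun w => (day_count t w)%:R ^+ 4) ->
  rintegrable P (fun w => ret mu C e t w ^+ 4) /\
  Ex P (fun w => ret mu C e t w ^+ 4) <=
    8 * (mu ^+ 4 + Ex P (fun w => e 0 w ^+ 4)) * Ex P (fun w => (day_count t w)%:R ^+ 4).
Proof.
move=> iN; set c := 8 * _.
have m40 : 0 <= Ex P (fun w => e 0 w ^+ 4) by apply: Ex_ge0 => w; rewrite exprn_even_ge0.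
have c0 : 0 <= c by rewrite mulr_ge0// addr_ge0// exprn_even_ge0.
rewrite -ExZ//; apply: (le_Ex_partition (mday t)).
- by apply: measurable_funX; exact: measurable_ret.
- by move=> w; rewrite exprn_even_ge0.
- by move=> w; rewrite mulr_ge0// exprn_even_ge0.
- exact: rintegrableZ.
move=> [a b]; set D := fiber _ _.
have iD : indep_of_shocks P e D by exact: day_key_indep.
have [] := block_fourth_moment eiid (mu * (b - a)%:~R) (shock_idx_uniq a `|b - a|) iD.
set F := fun w => _; have FE : F = fun w => \1_D w * ret mu C e t w ^+ 4.
  apply/funext => w; rewrite /F indicE; have [/set_mem Dw|_] := boolP (w \in D).
    by rewrite (ret_on_fiber Dw).
  by rewrite !mul0r.
rewrite FE size_shock_idx => iF EF; split=> //; apply: le_trans EF _.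
rewrite le_eqVlt; apply/orP; left; apply/eqP.
have -> : (fun w => \1_D w * (c * (day_count t w)%:R ^+ 4)) =
    fun w => (c * (`|b - a|%N)%:R ^+ 4) * \1_D w.
  apply/funext => w; rewrite mulrC indicE; have [/set_mem [E1 E2]|_] := boolP (w \in D).
    by rewrite /day_count E1 E2.
  by rewrite !mulr0.
rewrite ExZ; last by apply: rintegrable_indic; exact: mday.
rewrite Ex_indic; last exact: mday.
rewrite exprMn; have -> : (b - a)%:~R ^+ 4 = (`|b - a|%N)%:R ^+ 4 :> R.
  by rewrite natr_absz intr_norm -[LHS]ger0_norm ?exprn_even_ge0// normrX.
by rewrite /c; ring.
Qed.

(** For [p = 1, 2] this is the [p]-th moment of a daily return given [n] points on that day. *)
Definition cond_moment (p n : nat) : R := shock_moment P e p (mu * n%:R) n.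

(* Reversed intervals are null, so that the index sets of the shocks of two
   distinct days may be taken disjoint. *)
Hypothesis Cmono : forall s t : R, s < t -> P [set w | C t w < C s w] = 0%E.

Lemma measurable_count_lt s t : measurable [set w | C t w < C s w].
Proof.
have [mC _] := Ccount.
have -> : [set w | C t w < C s w] =
    [set w | (C t w)%:~R < (C s w)%:~R :> R].
  by apply/seteqP; split => w /=; rewrite ltr_int.
by rewrite -[X in measurable X]setTI; apply: measurable_fun_ltr => //; exact: mC.
Qed.

Lemma null_fiber (D : set T) s t : measurable D -> s < t ->
  (forall w, D w -> C t w < C s w) -> P D = 0%E.
Proof.
move=> mD st H; apply/eqP; rewrite eq_le measure_ge0 andbT.
rewrite -(Cmono st) le_measure ?inE//; exact: measurable_count_lt.
Qed.

Lemma ret_pair_moment (t s : int) p q : (s < t) -> (0 < p <= 2)%N -> (0 < q <= 2)%N ->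
  let f w := ret mu C e t w ^+ p * ret mu C e s w ^+ q in
  let g w := cond_moment p (day_count t w) * cond_moment q (day_count s w) in
  rintegrable P f -> rintegrable P g -> Ex P f = Ex P g.
Proof.
move=> st pp qq f g fi gi; apply: (eq_Ex_partition (mdays t s)) => // -[[a b] [a' b']].
set D := fiber _ _; have mD : measurable D by exact: mdays.
have DE w : D w -> [/\ C (t%:~R - 1) w = a, C t%:~R w = b, C (s%:~R - 1) w = a' & C s%:~R w = b'].
  by case.
have null : P D = 0%E -> Ex P (fun w => \1_D w * f w) = Ex P (fun w => \1_D w * g w).
  by move=> D0; rewrite !Ex_null//; [exact: rintegrable_measurable gi|exact: rintegrable_measurable fi].
have ltB (x : R) : x - 1 < x by rewrite ltrBlDr ltrDl.
have [ba|ab] := ltP b a.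
  by apply/null/(null_fiber mD (ltB t%:~R)) => w /DE[-> -> _ _].
have [ba'|ab'] := ltP b' a'.
  by apply/null/(null_fiber mD (ltB s%:~R)) => w /DE[_ _ -> ->].
(* Day [s] precedes day [t], so [b' > a] is a reversal between the end of [s] and the start of [t]:
   impossible when these instants coincide, null otherwise. *)
have [ab2|ba2] := ltP a b'.
  have [E|ne] := eqVneq s (t - 1).
    apply: null; suff -> : D = set0 by rewrite measure0.
    apply/seteqP; split => // w /DE[E1 _ _ E2].
    by move: ab2; rewrite -E1 -E2 E rmorphB ltxx.
  apply/null/(@null_fiber D s%:~R (t%:~R - 1)) => //.
    by rewrite -(rmorphB _ t 1) ltr_int; lia.
  by move=> w /DE[-> _ _ ->].
(* Now [a' <= b' <= a <= b], so the index ranges []a', b']] and []a, b]] are disjoint. *)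
have uS : uniq (shock_idx a `|b - a| ++ shock_idx a' `|b' - a'|).
  rewrite cat_uniq !shock_idx_uniq andbT/=; apply/hasPn => k; rewrite /= !mem_shock_idx.
  lia.
have [] := @block_moment _ _ _ P e eiid D _ _ (mu * (b - a)%:~R) (mu * (b' - a')%:~R) p q uS
  (days_key_indep t s _) pp qq.
rewrite !size_shock_idx; set F := fun w => _.
have FE : F = fun w => \1_D w * f w.
  apply/funext => w; rewrite /F indicE; have [/set_mem Dw|_] := boolP (w \in D).
    have [E1 E2 E3 E4] := DE _ Dw.
    have Et : day_key t w = (a, b) by rewrite /day_key E1 E2.
    have Es : day_key s w = (a', b') by rewrite /day_key E3 E4.
    by rewrite /f (ret_on_fiber Et) (ret_on_fiber Es) mulrA.
  by rewrite !mul0r.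
rewrite FE => _ ->.
have -> : (fun w => \1_D w * g w) =
    fun w => cond_moment p `|b - a|%N * cond_moment q `|b' - a'|%N * \1_D w.
  apply/funext => w; rewrite mulrC indicE; have [/set_mem/DE[E1 E2 E3 E4]|_] := boolP (w \in D).
    by rewrite /g /day_count E1 E2 E3 E4.
  by rewrite !mulr0.
rewrite ExZ; last exact: rintegrable_indic.
rewrite Ex_indic// /cond_moment !natr_absz !ger0_norm ?subr_ge0//.
by rewrite [RHS]mulrC mulrA.
Qed.

Lemma ret_moment (t : int) p : (0 < p <= 2)%N ->
  rintegrable P (fun w => ret mu C e t w ^+ p) ->
  rintegrable P (fun w => cond_moment p (day_count t w)) ->
  Ex P (fun w => ret mu C e t w ^+ p) = Ex P (fun w => cond_moment p (day_count t w)).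
Proof.
move=> pp fi gi; apply: (eq_Ex_partition (mday t)) => // -[a b].
set D := fiber _ _; have mD : measurable D by exact: mday.
have [ba|ab] := ltP b a.
  have D0 : P D = 0%E.
    apply: (@null_fiber D (t%:~R - 1) t%:~R) => //; first by rewrite ltrBlDr ltrDl.
    by move=> w [-> ->].
  by rewrite !Ex_null//; [exact: rintegrable_measurable gi|exact: rintegrable_measurable fi].
have uS : uniq (shock_idx a `|b - a| ++ [::]) by rewrite cats0 shock_idx_uniq.
(* The second block is empty and contributes the factor [(1 + 0)^1 = 1]. *)
have [] := @block_moment _ _ _ P e eiid D _ _ (mu * (b - a)%:~R) 1 p 1 uS
  (day_key_indep t _) pp isT.
rewrite !size_shock_idx; set F := fun w => _.
have FE : F = fun w => \1_D w * ret mu C e t w ^+ p.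
  apply/funext => w; rewrite /F indicE /shock_sum big_nil addr0 expr1n mulr1.
  have [/set_mem Dw|_] := boolP (w \in D); last by rewrite !mul0r.
  by rewrite (ret_on_fiber Dw).
rewrite FE => _ ->.
have -> : (fun w => \1_D w * cond_moment p (day_count t w)) =
    fun w => cond_moment p `|b - a|%N * \1_D w.
  apply/funext => w; rewrite mulrC indicE; have [/set_mem[E1 E2]|_] := boolP (w \in D).
    by rewrite /day_count E1 E2.
  by rewrite !mulr0.
rewrite ExZ; last exact: rintegrable_indic.
rewrite Ex_indic// /cond_moment !natr_absz !ger0_norm ?subr_ge0//.
by rewrite {2}/shock_moment expr1n/= mul0r addr0 mulr1 mulrC.
Qed.

End returns.

(** * Factorial moments of Cox counts *)

Section cox_counts.
Context {dT : measure_display} {T : measurableType dT} {R : realType}.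
Variable P : probability T R.

(** The terms with [k < p] vanish; after the shift by [p], the quotient of the falling factorial by
    [(k + p)!] is [1 / k!], leaving [L^p] times the total mass. *)
Lemma poisson_ffact (L : R) (p : nat) : 0 < L ->
  (\sum_(k <oo) ((k ^_ p)%:R * poisson_pmf L k)%:E = (L ^+ p)%:E)%E.
Proof.
move=> L0.
have t0 k : (0 <= ((k ^_ p)%:R * poisson_pmf L k)%:E)%E.
  by rewrite lee_fin mulr_ge0 ?poisson_pmf_ge0.
have total : (\sum_(k <oo) (poisson_pmf L k)%:E = 1)%E.
  have H : poisson_prob L 0 [set: nat] = 1%E := probability_setT (poisson_prob L 0).
  rewrite -H /poisson_prob L0; apply: nneseries_esumT => k.
  by rewrite lee_fin poisson_pmf_ge0.
rewrite (nneseries_split 0 p); last by move=> k _; exact: t0.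
rewrite add0n big_nat_cond big1 ?add0e; last first.
  by move=> k /andP[/andP[_ kp] _]; rewrite ffact_small// mul0r.
rewrite -(@nneseries_addn _ (fun k => ((k ^_ p)%:R * poisson_pmf L k)%:E) p)//.
rewrite -[RHS]mule1 -total -nneseriesZl; last by move=> k _; rewrite lee_fin poisson_pmf_ge0.
apply: eq_eseriesr => k _; rewrite -EFinM; congr (_%:E).
rewrite /poisson_pmf L0 exprD -(@ffact_fact (k + p) p) ?leq_addl// addnK natrM.
have f1 : ((k + p) ^_ p)%:R != 0 :> R by rewrite pnatr_eq0 -lt0n ffact_gt0 leq_addl.
have f2 : (k`!)%:R != 0 :> R by rewrite pnatr_eq0 -lt0n fact_gt0.
by field; rewrite f1 f2.
Qed.

Variables (L : R -> R -> T -> R) (C : R -> T -> int).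
Hypotheses (Ccount : @is_counting _ T R C).
Hypothesis L0 : forall a b w, a < b -> 0 < L a b w.
Hypothesis mL : forall a b, measurable_fun setT (L a b).
Hypothesis cox : forall (n : nat) (a b : 'I_n -> R) (k : 'I_n -> nat),
  (forall i, a i < b i) ->
  (forall i j, i != j -> b i <= a j \/ b j <= a i) ->
  P [set w | forall i, C (b i) w - C (a i) w = (k i)%:Z] =
  (\int[P]_w (\prod_(i < n) poisson_pmf (L (a i) (b i) w) (k i))%:E)%E.

Definition incr_fiber a b (k : int) : set T := [set w | C b w - C a w = k].

Lemma measurable_incr_fiber a b k : measurable (incr_fiber a b k).
Proof.
have [mC _] := Ccount.
have -> : incr_fiber a b k =
    (fun w => (C b w)%:~R - (C a w)%:~R : R) @^-1` [set k%:~R].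
  apply/seteqP; split => w; rewrite /incr_fiber/=; first by move=> <-; rewrite rmorphB.
  by rewrite -rmorphB => /intr_inj.
rewrite -[X in measurable X]setTI.
by apply: measurable_funB => //; exact: mC.
Qed.

Let mpois a b k : measurable_fun setT (fun w => poisson_pmf (L a b w) k).
Proof. exact: (measurableT_comp (measurable_poisson_pmf _ measurableT)). Qed.

Lemma cox1 a b k : a < b ->
  P (incr_fiber a b k%:Z) = (\int[P]_w (poisson_pmf (L a b w) k)%:E)%E.
Proof.
move=> ab; have := @cox 1 (fun=> a) (fun=> b) (fun=> k) (fun=> ab).
have H : forall i j : 'I_1, i != j -> b <= a \/ b <= a by move=> i j; rewrite !ord1.
move=> /(_ H); under eq_integral do rewrite big_ord1.
move=> <-; congr (P _); apply/seteqP; split => w /=; first by move=> H1 _.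
by move/(_ ord0).
Qed.

Lemma cox2 a b a' b' j k : a < b -> a' < b' -> b <= a' \/ b' <= a ->
  P (incr_fiber a b j%:Z `&` incr_fiber a' b' k%:Z) =
  (\int[P]_w (poisson_pmf (L a b w) j * poisson_pmf (L a' b' w) k)%:E)%E.
Proof.
move=> ab ab' dis.
pose sel (T : Type) (x y : T) (i : 'I_2) := if i == ord0 then x else y.
have := @cox 2 (sel _ a a') (sel _ b b') (sel _ j k).
have H1 i : sel _ a a' i < sel _ b b' i by rewrite /sel; case: ifP.
have H2 : forall i j : 'I_2, i != j -> sel _ b b' i <= sel _ a a' j \/ sel _ b b' j <= sel _ a a' i.
  move=> i0 j0; rewrite /sel.
  case: i0 j0 => -[|[|//]] i1 [[|[|//]] j1] //= _; rewrite /eq_op/=.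
  by case: dis; [right|left].
move=> /(_ H1 H2); under eq_integral do rewrite big_ord_recl big_ord1 /sel/=.
move=> <-; congr (P _); apply/seteqP; split => w.
  by move=> [e1 e2] i; rewrite /sel; case: ifP.
by move=> H; split; [have := H ord0|have := H (Ordinal (isT : (1 < 2)%N))].
Qed.

Let covT a b : \bigcup_k incr_fiber a b k%:Z = [set w | 0 <= C b w - C a w].
Proof.
apply/seteqP; split => w; first by case=> k _; rewrite /incr_fiber/= => ->.
by rewrite /=; case E : (C b w - C a w) => [k|//] _; exists k.
Qed.

Let tfib a b : trivIset setT (fun k : nat => incr_fiber a b k%:Z).
Proof. 
apply/trivIsetP => i j _ _ ij; rewrite -subset0 => w [Ei Ej].
have : i%:Z = j%:Z by rewrite -(Ei : _ = i%:Z) -(Ej : _ = j%:Z).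
by case=> /eqP; rewrite (negbTE ij).
 Qed.

(** The Cox law prescribes the probabilities of the values 0, 1, 2, ... of the increment. They add
    up to the expected total mass of a Poisson law, which is 1, so no mass is left for negative
    values. *)
Lemma incr_negative_null a b : a < b -> P [set w | C b w < C a w] = 0%E.
Proof.
move=> ab; have -> : [set w | C b w < C a w] = ~` (\bigcup_k incr_fiber a b k%:Z).
  rewrite covT; apply/seteqP; split => w /=; first by move=> H; apply/negP; lia.
  by move/negP; lia.
rewrite probability_setC; last by apply: bigcupT_measurable => k; exact: measurable_incr_fiber.
have -> : P (\bigcup_k incr_fiber a b k%:Z) = (\sum_(k <oo) P (incr_fiber a b k%:Z))%E.
  apply: measure_semi_bigcup => [k||]; [exact: measurable_incr_fiber|exact: tfib|].
  by apply: bigcupT_measurable => k; exact: measurable_incr_fiber.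
under eq_eseriesr do rewrite cox1//.
rewrite -integral_nneseries//; last 2 first.
  by move=> k; apply/measurable_EFinP; exact: mpois.
  by move=> k w _; rewrite lee_fin poisson_pmf_ge0.
rewrite (eq_integral (cst 1%E)); last first.
  move=> w _ /=; rewrite -(expr0 (L a b w)) -(poisson_ffact 0 (L0 w ab)).
  by apply: eq_eseriesr => k _; rewrite ffactn0 mul1r.
have -> : (\int[P]_x cst 1%E x = 1)%E by rewrite integral_cst// mul1e; exact: probability_setT.
by rewrite subee.
Qed.

Lemma integral_incr_split a b (D : set T) (F : T -> \bar R) : a < b -> measurable D ->
  measurable_fun setT F -> (forall w, (0 <= F w)%E) ->
  (\int[P]_(w in D) F w = \sum_(j <oo) \int[P]_(w in incr_fiber a b j%:Z `&` D) F w)%E.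
Proof.
move=> ab mD mF F0.
pose N := [set w | C b w < C a w].
have mA k : measurable (incr_fiber a b k%:Z) by exact: measurable_incr_fiber.
have NE : N = ~` (\bigcup_k incr_fiber a b k%:Z).
  rewrite covT; apply/seteqP; split => w; rewrite /N/=; first by move=> H; apply/negP; lia.
  by move/negP; lia.
have mN : measurable N by rewrite NE; apply: measurableC; exact: bigcupT_measurable.
rewrite (@ge0_negligible_integral _ _ _ _ _ N)//; last 2 first.
- exact: measurable_funS mF.
- exact: incr_negative_null.
have -> : D `\` N = \bigcup_k (incr_fiber a b k%:Z `&` D).
  by rewrite -setI_bigcupl NE setDE setCK setIC.
rewrite ge0_integral_bigcup//.
- by move=> k; exact: measurableI.
- exact: measurable_funS mF.
- apply/trivIsetP => i j _ _ ij; rewrite setIACA.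
  by have /trivIsetP H := @tfib a b; rewrite (H i j)// set0I.
Qed.

Definition incr_abs a b w : nat := `|C b w - C a w|%N.

Lemma measurable_incr_abs (f : nat -> R) a b : measurable_fun setT (fun w => f (incr_abs a b w)).
Proof.
apply: (measurable_fun_partition (K := fun w => C b w - C a w)) => k.
  exact: measurable_incr_fiber.
by exists (fun=> f `|k|%N); [exact: measurable_cst|move=> w; rewrite /incr_abs => ->].
Qed.

(** Summation over the values of both increments is exchanged with the expectation, and
    [poisson_ffact] is applied to each series. As an identity of extended reals it presupposes no
    integrability; finiteness is later transferred from the right side to the left. *)
Lemma cox_factorial_moments a b a' b' p q : a < b -> a' < b' -> b <= a' \/ b' <= a ->
  (\int[P]_w ((incr_abs a b w ^_ p)%:R * (incr_abs a' b' w ^_ q)%:R)%:E =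
   \int[P]_w (L a b w ^+ p * L a' b' w ^+ q)%:E)%E.
Proof.
move=> ab ab' dis.
pose F w : R := (incr_abs a b w ^_ p)%:R * (incr_abs a' b' w ^_ q)%:R.
have mF : measurable_fun setT (fun w => (F w)%:E).
  apply/measurable_EFinP; apply: measurable_funM.
    exact: (measurable_incr_abs (fun n => (n ^_ p)%:R)).
  exact: (measurable_incr_abs (fun n => (n ^_ q)%:R)).
have F0 w : (0 <= (F w)%:E)%E by rewrite lee_fin mulr_ge0.
have inner (j k : nat) : (\int[P]_(w in incr_fiber a' b' k%:Z `&` incr_fiber a b j%:Z) (F w)%:E =
    \int[P]_w ((j ^_ p)%:R * (k ^_ q)%:R * (poisson_pmf (L a b w) j * poisson_pmf (L a' b' w) k))%:E)%E.
  rewrite (eq_integral (cst ((j ^_ p)%:R * (k ^_ q)%:R)%:E)); last first.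
    by move=> w /set_mem[Ek Ej]; rewrite /F /incr_abs Ek Ej.
  rewrite integral_cst; last by apply: measurableI; exact: measurable_incr_fiber.
  transitivity (((j ^_ p)%:R * (k ^_ q)%:R)%:E * P (incr_fiber a b j%:Z `&` incr_fiber a' b' k%:Z))%E.
    by rewrite setIC.
  rewrite cox2// -ge0_integralZl//.
  - by apply/measurable_EFinP; apply: measurable_funM; exact: mpois.
  - by move=> w _; rewrite lee_fin mulr_ge0 ?poisson_pmf_ge0.
rewrite (@integral_incr_split a b setT _ ab measurableT mF F0).
under eq_eseriesr => j _.
  rewrite setIT (@integral_incr_split a' b' _ _ ab' (measurable_incr_fiber a b j%:Z) mF F0).
  under eq_eseriesr => k _.
    rewrite inner; over.
  rewrite -integral_nneseries//; last 2 first.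
  - move=> k; apply/measurable_EFinP; apply: measurable_funM => //.
    by apply: measurable_funM; exact: mpois.
  - by move=> k w _; rewrite lee_fin !mulr_ge0 ?poisson_pmf_ge0.
  over.
rewrite -integral_nneseries//; last 2 first.
- move=> j; apply: ge0_emeasurable_sum.
    by move=> k w _ _; rewrite lee_fin !mulr_ge0 ?poisson_pmf_ge0.
  move=> k _; apply/measurable_EFinP; apply: measurable_funM => //.
  by apply: measurable_funM; exact: mpois.
- move=> j w _; apply: nneseries_ge0 => k _ _.
  by rewrite lee_fin !mulr_ge0 ?poisson_pmf_ge0.
apply: eq_integral => w _.
under eq_eseriesr => j _.
  under eq_eseriesr => k _.
    rewrite mulrACA EFinM; over.
  rewrite nneseriesZl; last by move=> k _; rewrite lee_fin mulr_ge0 ?poisson_pmf_ge0.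
  rewrite poisson_ffact ?L0// muleC; over.
rewrite nneseriesZl; last by move=> k _; rewrite lee_fin mulr_ge0 ?poisson_pmf_ge0.
by rewrite poisson_ffact ?L0// -EFinM mulrC.
Qed.

End cox_counts.

(** * Integration against a measure with a density *)

Section density.
Context d {X : measurableType d} {R : realType}.
Local Open Scope ereal_scope.
Variables (mu nu : {measure set X -> \bar R}) (g : X -> R).
Hypothesis mg : measurable_fun setT g.
Hypothesis g0 : forall x, (0 <= g x)%R.
Hypothesis nuE : forall V, measurable V -> nu V = \int[mu]_(x in V) (g x)%:E.

Import HBNNSimple.

Let density_nnsfun (h : {nnsfun X >-> R}) :
  \int[nu]_x (h x)%:E = \int[mu]_x ((h x)%:E * (g x)%:E).
Proof.
have mh r : measurable (h @^-1` [set r]) by rewrite -[X in measurable X]setTI; exact: measurable_funPT.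
have mi r : measurable_fun setT (fun x => (\1_(h @^-1` [set r]) x : R)%:E).
  exact/measurable_EFinP/measurable_indic.
transitivity (\sum_(r \in range h) (r%:E * nu (h @^-1` [set r]))).
  under eq_integral do rewrite fimfunE -fsumEFin//.
  rewrite ge0_integral_fsum//; last 2 first.
  - by move=> r; apply/measurable_EFinP/measurable_funM => //; exact: measurable_indic.
  - by move=> r x _; rewrite EFinM nnfun_muleindic_ge0.
  apply: eq_fsbigr => r _; rewrite integralZl_indic_nnsfun//.
  by rewrite integral_indic// setIT.
under [RHS]eq_integral.
  move=> x _; rewrite fimfunE -fsumEFin// ge0_mule_fsuml; last first.
    by move=> r; rewrite EFinM nnfun_muleindic_ge0.
  over.
rewrite [RHS]ge0_integral_fsum//; last 2 first.
- move=> r; apply: emeasurable_funM; last exact/measurable_EFinP.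
  by apply/measurable_EFinP/measurable_funM => //; exact: measurable_indic.
- move=> r x _; apply: mule_ge0; last by rewrite lee_fin.
  by rewrite EFinM nnfun_muleindic_ge0.
apply: eq_fsbigr => r _.
have [r0|r0] := ltP r 0%R.
  rewrite preimage_nnfun0// measure0 mule0 integral0_eq// => x _.
  by rewrite indic0 mulr0 mul0e.
under eq_integral do rewrite EFinM -muleA.
rewrite ge0_integralZl//; last 2 first.
- by apply: emeasurable_funM => //; exact/measurable_EFinP.
- by move=> x _; rewrite mule_ge0// lee_fin.
congr (_ * _); rewrite nuE// integral_mkcond; apply: eq_integral => x _.
by rewrite patchE indicE; case: ifPn => _; rewrite ?mul1e ?mul0e.
Qed.

(** Simple functions first, then monotone convergence on both sides. *)
Lemma ge0_integral_density (f : X -> \bar R) : measurable_fun setT f ->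
  (forall x, 0 <= f x) -> \int[nu]_x f x = \int[mu]_x (f x * (g x)%:E).
Proof.
move=> mf f0; pose f_ := nnsfun_approx measurableT mf.
transitivity (limn (fun n => \int[nu]_x (f_ n x)%:E)).
  rewrite -monotone_convergence//=.
  - apply: eq_integral => x _; apply/esym/cvg_lim => //=.
    exact: cvg_nnsfun_approx.
  - by move=> n; apply/measurable_EFinP.
  - by move=> n x _; rewrite lee_fin.
  - by move=> x _ a b ab; rewrite lee_fin//; exact/lefP/nd_nnsfun_approx.
have -> : \int[mu]_x (f x * (g x)%:E) = limn (fun n => \int[mu]_x ((f_ n x)%:E * (g x)%:E)).
  rewrite -monotone_convergence//=.
  - apply: eq_integral => x _; apply/esym/cvg_lim => //.
    apply: cvgeZr => //; exact: cvg_nnsfun_approx.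
  - by move=> n; apply: emeasurable_funM; exact/measurable_EFinP.
  - by move=> n x _; rewrite mule_ge0// lee_fin.
  - move=> x _ a b ab; rewrite lee_wpmul2r ?lee_fin//.
    exact/lefP/nd_nnsfun_approx.
by apply/congr_lim/funext => n; exact: density_nnsfun.
Qed.

End density.

(** * Exponential moments of centered Gaussian variables *)

Section gaussian_mgf.
Context {dT : measure_display} {T : measurableType dT} {R : realType}.
Variable P : probability T R.

(** For [v < 0] the square root defaults to 0, and the normal law of deviation 0 is by convention
    the uniform law on [[0, 1]]. If [X] and [- X] both followed it, neither [X <= 0] nor [X >= 0]
    would have positive probability. *)
Lemma gaussian_variance_ge0 (X : T -> R) (v : R) : measurable_fun setT X ->
  centered_gaussian P X v -> centered_gaussian P (fun w => - X w) v -> 0 <= v.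
Proof.
move=> mX; rewrite /centered_gaussian; have [->//|v0] := eqVneq v 0.
move=> H1 H2; have [//|vn] := leP 0 v; exfalso.
have sv : Num.sqrt v = 0 by apply: ler0_sqrtr; exact: ltW.
have U (A : set R) : measurable A -> (forall x, A x -> 0 <= x <= 1 -> x = 0) ->
    normal_prob 0 (Num.sqrt v) A = 0%E.
  move=> mA A01; rewrite /normal_prob sv.
  transitivity (\int[lebesgue_measure]_(x in A) (\1_(`[0, 1]%classic : set R) x)%:E)%E.
    by apply: eq_integral => x _; rewrite /normal_pdf eqxx.
  rewrite integral_indic//; apply/eqP; rewrite eq_le measure_ge0 andbT.
  apply: (@le_trans _ _ (lebesgue_measure [set (0 : R)])).
    apply: le_measure; rewrite ?inE//; first exact: measurableI.
    by move=> x [+ Ax]; rewrite /= in_itv/= => x01; exact: A01.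
  by rewrite lebesgue_measure_set1.
have n1 : P (X @^-1` `]-oo, 0]) = 0%E.
  rewrite H1//; apply: U => // x; rewrite /= in_itv/= => x0 /andP[x1 _].
  by apply/eqP; rewrite eq_le x0 x1.
have n2 : P (X @^-1` `[0, +oo[) = 0%E.
  have := H2 `]-oo, 0]%classic (measurable_itv _).
  rewrite U//; last first.
    by move=> x; rewrite /= in_itv/= => x0 /andP[x1 _]; apply/eqP; rewrite eq_le x0 x1.
  move=> <-; congr (P _); apply/seteqP; split => w; rewrite /= !in_itv/= ?andbT; lra.
have m1 : measurable (X @^-1` `]-oo, 0]) by rewrite -[X in measurable X]setTI; exact: mX.
have m2 : measurable (X @^-1` `[0, +oo[) by rewrite -[X in measurable X]setTI; exact: mX.
pose A1 := X @^-1` `]-oo, 0]; pose A2 := X @^-1` `[0, +oo[.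
have : (1 <= P A1 + P A2)%E.
  rewrite -(probability_setT P); apply: le_trans (measureU2 _ m1 m2).
  apply: le_measure; rewrite ?inE//; first exact: measurableU.
  by move=> w _; rewrite /A1 /A2 /= !in_itv/= andbT; case: (leP (X w) 0) => [?|/ltW ?]; [left|right].
by rewrite /A1 /A2 n1 n2 adde0 lee_fin ler10.
Qed.

(** Completing the square: [expR x] times the density of mean 0 is [expR (v / 2)] times the density
    of mean [v], with the same variance [v]. *)
Lemma normal_mgf (v : R) : 0 < v ->
  (\int[normal_prob 0 (Num.sqrt v)]_x (expR x)%:E = (expR (v / 2))%:E)%E.
Proof.
move=> v0; have s0 : Num.sqrt v != 0 by rewrite gt_eqF// sqrtr_gt0.
rewrite (@ge0_integral_density _ _ _ lebesgue_measure _ (normal_pdf 0 (Num.sqrt v)))//; first last.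
- by apply/measurable_EFinP; exact: measurable_expR.
- by move=> x; exact: normal_pdf_ge0.
- exact: measurable_normal_pdf.
transitivity (\int[lebesgue_measure]_x ((expR (v / 2))%:E * (normal_pdf v (Num.sqrt v) x)%:E))%E.
  apply: eq_integral => x _; rewrite -!EFinM !normal_pdfE// !(mulrCA _ (normal_peak _)) /normal_fun.
  congr (_ * _)%:E; rewrite -!expRD; congr expR.
  rewrite sqr_sqrtr; last exact: ltW.
  by field; rewrite gt_eqF.
rewrite ge0_integralZl//.
- by rewrite integral_normal_pdf mule1.
- by apply/measurable_EFinP; exact: measurable_normal_pdf.
- by move=> x _; rewrite lee_fin normal_pdf_ge0.
Qed.

Lemma gaussian_mgf (X : T -> R) (v : R) : measurable_fun setT X ->
  centered_gaussian P X v -> centered_gaussian P (fun w => - X w) v ->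
  (\int[P]_w (expR (X w))%:E = (expR (v / 2))%:E)%E.
Proof.
move=> mX H1 H2; have vge0 := gaussian_variance_ge0 mX H1 H2.
have meX : measurable_fun setT (fun w => (expR (X w))%:E).
  by apply/measurable_EFinP; exact: measurableT_comp.
move: H1; rewrite /centered_gaussian; have [v0|v0] := eqVneq v 0 => H1.
  have mN : measurable [set w | X w = 0].
    by rewrite -[X in measurable X]setTI; exact: mX (measurable_set1 _).
  rewrite (@ge0_negligible_integral _ _ _ _ setT (~` [set w | X w = 0]))//.
  - rewrite setTD setCK (eq_integral (cst 1%E)); last first.
      by move=> w /set_mem/= ->; rewrite expR0.
    by rewrite integral_cst// mul1e v0 mul0r expR0; exact: H1.
  - exact: measurableC.
  - have : P (~` [set w | X w = 0]) = (1 - P [set w | X w = 0%R])%E by exact: probability_setC.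
    by rewrite H1 subee.
have mX' : @measurable_fun _ _ T (measurableTypeR R) setT X := mX.
pose X' : {mfun T >-> measurableTypeR R} := HB.pack X (isMeasurableFun.Build _ _ _ _ _ mX').
rewrite -normal_mgf; last by rewrite lt_def v0.
transitivity (\int[distribution P X']_x (expR x)%:E)%E.
  rewrite (@ge0_integral_distribution _ _ _ _ _ P X' (fun x : R => (expR x)%:E))//.
  have : measurable_fun setT (fun x : R => (expR x)%:E).
    by apply/measurable_EFinP; exact: measurable_expR.
  exact.
by apply: eq_measure_integral => A mA _; exact: H1.
Qed.

End gaussian_mgf.

(** * Joint measurability of processes with continuous paths *)

Section joint_measurability.
Context {dT : measure_display} {T : measurableType dT} {R : realType}.

(** Rounding the time down to a grid of mesh [1 / (n + 1)] gives functions that are measurable piece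
    by piece, and continuity of the paths makes them converge. Tonelli for the intensity rests on
    this. *)
Lemma measurable_fun_caratheodory (F : R -> T -> R) :
  (forall u, measurable_fun setT (F u)) -> (forall w, continuous (F ^~ w)) ->
  measurable_fun setT (fun z : R * T => F z.1 z.2).
Proof.
move=> mF cF.
pose a (n : nat) (u : R) : R := (Num.floor (u * n.+1%:R))%:~R / n.+1%:R.
apply: (@measurable_fun_cvg _ _ _ _ (fun n (z : R * T) => F (a n z.1) z.2)).
  move=> n; apply: (measurable_fun_partition (K := fun z : R * T => Num.floor (z.1 * n.+1%:R))).
    move=> k; have -> : [set w : R * T | Num.floor (w.1 * n.+1%:R) = k] =
        (fun z : R * T => z.1 * n.+1%:R) @^-1` `[k%:~R, (k + 1)%:~R[.
      apply/seteqP; split => z /=; rewrite in_itv/= -floor_eq; [by move=> ->|exact: eqP].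
    rewrite -[X in measurable X]setTI.
    have : measurable_fun setT (fun z : R * T => z.1 * n.+1%:R).
      by apply: measurable_funM => //; exact: measurable_fst.
    by apply.
  move=> k; exists (fun z : R * T => F (k%:~R / n.+1%:R) z.2).
    by apply: measurableT_comp (mF _) measurable_snd.
  by move=> z; rewrite /a => ->.
move=> [u w] _ /=.
have : a n u @[n --> \oo] --> u.
  apply/cvgrPdist_le => /= eps eps0; near=> n.
  have n0 : (0 : R) < n.+1%:R by rewrite ltr0n.
  have en : eps^-1 <= n.+1%:R.
    near: n; exists (Num.truncn (eps^-1)) => // n /= kn.
    by apply: le_trans (ltW (truncnS_gt _)) _; rewrite ler_nat.
  have /andP[f1 f2] := floor_itv (u * n.+1%:R).
  rewrite rmorphD/= in f2.
  have e1 : 1 <= eps * n.+1%:R by rewrite -ler_pdivrMl// mulr1.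
  rewrite /a -(ler_pM2r n0) -[X in _ * X <= _](ger0_norm (ltW n0)) -normrM mulrBl divfK ?gt_eqF//.
  rewrite ler_norml; apply/andP; split; lra.
by move=> au; apply: (cvg_comp (fun n => a n u) (F ^~ w) au); exact: cF.
Unshelve. all: by end_near. Qed.

End joint_measurability.

(** * Translation invariance of the integral *)

Section translation.
Context {R : realType}.

Lemma lebesgue_measure_shift (t : R) (A : set R) : measurable A ->
  lebesgue_measure A = pushforward lebesgue_measure (fun x : R => x + t : measurableTypeR R) A.
Proof.
move=> mA; have ms : @measurable_fun _ _ (measurableTypeR R) (measurableTypeR R) setT (fun x : R => x + t).
  have : measurable_fun setT (fun x : R => x + t : R) by exact: measurable_funD.
  exact.
pose S : {mfun measurableTypeR R >-> measurableTypeR R} :=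
  HB.pack (fun x : R => x + t) (isMeasurableFun.Build _ _ _ _ _ ms).
apply: (@lebesgue_measure_unique R (pushforward lebesgue_measure S)) => // _ [[a b]] _ <-.
transitivity (lebesgue_measure (`]a - t, b - t]%classic : set R)); last first.
  congr (lebesgue_measure _).
  by apply/seteqP; split => x; rewrite /= !in_itv/=; lra.
rewrite !lebesgue_measure_itv/= !lte_fin ltrD2r -!EFinB.
by case: ifP => // _; congr (_%:E); ring.
Qed.

Lemma ge0_integral_shift (t a b : R) (f : R -> \bar R) : measurable_fun setT f ->
  (forall x, (0 <= f x)%E) ->
  (\int[lebesgue_measure]_(x in `](a + t)%R, (b + t)%R]) f x =
   \int[lebesgue_measure]_(x in `]a, b]) f (x + t)%R)%E.
Proof.
move=> mf f0.
have ms : @measurable_fun _ _ (measurableTypeR R) (measurableTypeR R) setT (fun x : R => x + t).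
  have : measurable_fun setT (fun x : R => x + t : R) by exact: measurable_funD.
  exact.
have -> : `]a, b]%classic = (fun x : R => x + t) @^-1` `]a + t, b + t].
  by apply/seteqP; split => x; rewrite /= !in_itv/= !(lerD2r, ltrD2r).
rewrite -(@ge0_integral_pushforward _ _ (measurableTypeR R) (measurableTypeR R) R _ ms lebesgue_measure `]a + t, b + t]%classic f)//.
  by apply: eq_measure_integral => A mA _; exact: lebesgue_measure_shift.
exact: measurable_funS mf.
Qed.

End translation.

(** * Moments of the intensity as iterated time integrals *)

Section intensity.
Context {dT : measure_display} {T : measurableType dT} {R : realType}.
Variables (P : probability T R) (lam : R) (Z : R -> T -> R).
Hypotheses (lam0 : 0 < lam) (mZ : forall u, measurable_fun setT (Z u)).
Hypothesis cZ : forall w, continuous (Z ^~ w).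

Let F (u : R) (w : T) : R := expR (Z u w).

Let mF u : measurable_fun setT (F u).
Proof. exact: measurableT_comp. Qed.

Let cF w : continuous (F ^~ w).
Proof. by move=> u; apply: continuous_comp; [exact: cZ|exact: continuous_expR]. Qed.

Let mFu w : measurable_fun setT (F ^~ w).
Proof. exact: continuous_measurable_fun. Qed.

Let jF : measurable_fun setT (fun z : measurableTypeR R * T => F z.1 z.2).
Proof. exact: (measurable_fun_caratheodory mF cF). Qed.

Lemma Lam_integrable a b w :
  lebesgue_measure.-integrable (`]a, b]%classic : set R) (EFin \o (F ^~ w)).
Proof.
have H : lebesgue_measure.-integrable (`[a, b]%classic : set R) (EFin \o (F ^~ w)).
  apply: continuous_compact_integrable; first exact: segment_compact.
  by apply: continuous_subspaceT => u; exact: cF.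
apply: integrableS H => //.
by move=> x /=; rewrite !in_itv/= => /andP[/ltW -> ->].
Qed.

(** The [fine] in [Lam] loses nothing, since a continuous path has a finite integral over a bounded
    interval. *)
Lemma LamE a b w : (Lam lam Z a b w)%:E =
  (lam%:E * \int[lebesgue_measure]_(u in `]a, b]) (F u w)%:E)%E.
Proof.
rewrite /Lam EFinM fineK//; exact: integrable_fin_num (Lam_integrable a b w).
Qed.

Lemma Lam_gt0 a b w : a < b -> 0 < Lam lam Z a b w.
Proof.
move=> ab; rewrite -lte_fin LamE mule_gt0//.
have [c _ cmin] := @EVT_min R (F ^~ w) a b (ltW ab) (continuous_subspaceT (@cF w)).
have Fc : 0 < F c w by exact: expR_gt0.
apply: (@lt_le_trans _ _ ((F c w)%:E * (b - a)%:E)%E).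
  by rewrite -EFinM lte_fin mulr_gt0// subr_gt0.
have -> : ((b - a)%:E = lebesgue_measure (`]a, b]%classic : set R))%E.
  by rewrite lebesgue_measure_itv/= lte_fin ab.
rewrite -integral_cst//; apply: ge0_le_integral => //.
- by move=> u _; rewrite lee_fin ltW.
- by apply/measurable_EFinP; exact: measurable_funS (mFu w).
- move=> u /=; rewrite in_itv/= => /andP[au ub]; rewrite lee_fin; apply: cmin.
  by rewrite in_itv/= ub ltW.
Qed.

(** Tonelli extracts one factor [Lam] from an expectation as a time integral. The measurability
    claims come from the same joint measurability. *)
Lemma Lam_step a b (Y : T -> R) : measurable_fun setT Y -> (forall w, 0 <= Y w) ->
  (\int[P]_w (Lam lam Z a b w * Y w)%:E =
   lam%:E * \int[lebesgue_measure]_(u in `]a, b]) \int[P]_w (F u w * Y w)%:E)%E /\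
  measurable_fun setT (Lam lam Z a b) /\
  measurable_fun setT (fun u : R => \int[P]_w (F u w * Y w)%:E)%E.
Proof.
move=> mY Y0; pose D : set (measurableTypeR R) := `]a, b]%classic.
have mD : measurable D by exact: measurable_itv.
have m1D : measurable_fun setT (\1_D : measurableTypeR R -> R) by exact: measurable_indic.
pose f (V : T -> R) (z : measurableTypeR R * T) : \bar R := (F z.1 z.2 * V z.2)%:E.
pose fD (V : T -> R) (z : measurableTypeR R * T) : \bar R := (\1_D z.1 * (F z.1 z.2 * V z.2))%:E.
have mf V : measurable_fun setT V -> measurable_fun setT (f V).
  move=> mV; apply/measurable_EFinP; apply: measurable_funM; first exact: jF.
  exact: (measurableT_comp mV measurable_snd).
have mfD V : measurable_fun setT V -> measurable_fun setT (fD V).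
  move=> mV; apply/measurable_EFinP; apply: measurable_funM.
    exact: (measurableT_comp m1D measurable_fst).
  apply: measurable_funM; first exact: jF.
  exact: (measurableT_comp mV measurable_snd).
have fD0 V : (forall w, 0 <= V w) -> forall z, (0 <= fD V z)%E.
  by move=> V0 z; rewrite lee_fin !mulr_ge0// expR_ge0.
have f0 V : (forall w, 0 <= V w) -> forall z, (0 <= f V z)%E.
  by move=> V0 z; rewrite lee_fin !mulr_ge0// expR_ge0.
have inner V w : (forall w, 0 <= V w) -> (Lam lam Z a b w * V w)%:E =
    (lam%:E * \int[lebesgue_measure]_u fD V (u, w))%E.
  move=> V0; rewrite mulrC EFinM LamE muleCA; congr (_ * _)%E.
  rewrite -ge0_integralZl//.
  - rewrite integral_mkcond; apply: eq_integral => u _; rewrite patchE /fD/= indicE.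
    by case: ifPn => _; rewrite ?mul1r ?mul0r// -EFinM mulrC.
  - by apply/measurable_EFinP; exact: measurable_funS (mFu w).
  - by move=> u _; rewrite lee_fin expR_ge0.
  - by rewrite lee_fin.
split.
  under eq_integral do rewrite inner//.
  rewrite ge0_integralZl//; last 3 first.
  - exact: (@measurable_fun_fubini_tonelli_G _ _ _ _ _ lebesgue_measure _ (mfD Y mY) (fD0 Y Y0)).
  - by move=> w _; apply: integral_ge0 => u _; exact: fD0.
  - by rewrite lee_fin ltW.
  congr (_ * _)%E.
  rewrite -(@fubini_tonelli _ _ _ _ _ lebesgue_measure P _ (mfD Y mY) (fD0 Y Y0)).
  rewrite [RHS]integral_mkcond; apply: eq_integral => u _; rewrite patchE /fD/= indicE.
  case: ifPn => _; first by apply: eq_integral => w _; rewrite mul1r.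
  by rewrite integral0_eq// => w _; rewrite mul0r.
split; last first.
  exact: (@measurable_fun_fubini_tonelli_F _ _ _ _ _ P _ (mf Y mY) (f0 Y Y0)).
apply/measurable_EFinP.
have -> : (EFin \o Lam lam Z a b) = fun w => (lam%:E * \int[lebesgue_measure]_u fD (cst 1%R) (u, w))%E.
  by apply/funext => w; rewrite /= -inner ?mulr1.
apply: emeasurable_funM; first exact: measurable_cst.
apply: (@measurable_fun_fubini_tonelli_G _ _ _ _ _ lebesgue_measure).
  by apply: mfD; exact: measurable_cst.
by apply: fD0 => w.
Qed.

Lemma measurable_Lam a b : measurable_fun setT (Lam lam Z a b).
Proof.
have m1 : measurable_fun setT (fun _ : T => 1 : R) by exact: measurable_cst.
by have [_ []] := @Lam_step a b (fun=> 1) m1 (fun=> ler01).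
Qed.

Definition dayL (t : R) (w : T) : R := Lam lam Z (t - 1) t w.

Lemma dayL_gt0 t w : 0 < dayL t w.
Proof. by apply: Lam_gt0; rewrite ltrBlDr ltrDl. Qed.

(** Translation to []-1, 0]] gives all days the same domain of integration, so that different days
    can be compared under the integral. *)
Lemma dayL_step t (Y : T -> R) : measurable_fun setT Y -> (forall w, 0 <= Y w) ->
  (\int[P]_w (dayL t w * Y w)%:E =
   lam%:E * \int[lebesgue_measure]_(v in `](-1)%R, 0%R]) \int[P]_w (F (v + t) w * Y w)%:E)%E.
Proof.
move=> mY Y0; have [E [_ mG]] := @Lam_step (t - 1) t Y mY Y0.
have H (u : R) : (0 <= \int[P]_w (F u w * Y w)%:E)%E.
  by apply: integral_ge0 => w _; rewrite lee_fin mulr_ge0// expR_ge0.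
have Hs := ge0_integral_shift t (-1) 0 mG H.
rewrite add0r (addrC (-1)) in Hs.
by move: E; rewrite Hs /dayL.
Qed.

(** The random factor that remains when each factor of a power of [dayL t] is written as an integral
    over an instant [v + t] of the day. *)
Definition expZ (vs : seq R) (t : R) (w : T) : R := expR (\sum_(v <- vs) Z (v + t) w).

Lemma measurable_expZ vs t : measurable_fun setT (expZ vs t).
Proof.
apply: measurableT_comp => //; elim: vs => [|v vs IHvs].
  by under eq_fun do rewrite big_nil; exact: measurable_cst.
by under eq_fun do rewrite big_cons; exact: measurable_funD.
Qed.

Lemma expZ_ge0 vs t w : 0 <= expZ vs t w. Proof. exact: expR_ge0. Qed.

Lemma expZ_nil t : expZ [::] t = fun=> 1.
Proof. by apply/funext => w; rewrite /expZ big_nil expR0. Qed.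

Lemma expZ_cons v vs t w : expZ (v :: vs) t w = F (v + t) w * expZ vs t w.
Proof. by rewrite /expZ big_cons expRD. Qed.

Definition in_day (v : R) := (-1 < v) && (v <= 0).

Let mFY (t : R) (Y : T -> R) : measurable_fun setT Y -> (forall w, 0 <= Y w) ->
  measurable_fun setT (fun v : R => \int[P]_w (F (v + t) w * Y w)%:E)%E.
Proof.
move=> mY Y0; have [_ [_ mG]] := @Lam_step 0 0 Y mY Y0.
have ms : measurable_fun setT (fun x : R => x + t : R) by exact: measurable_funD.
exact: (measurableT_comp mG ms).
Qed.

(** Each induction step turns one factor of the intensity into a time integral and absorbs its
    integrand into the weight [Y]. A [p]-fold integral never has to be written: an inequality of the
    integrands for all choices of instants is enough. *)
Lemma dayL_pow_le (p : nat) (al be t t' : R) (Y Y' : T -> R) : 0 <= al -> 0 <= be ->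
  measurable_fun setT Y -> (forall w, 0 <= Y w) ->
  measurable_fun setT Y' -> (forall w, 0 <= Y' w) ->
  (forall vs, size vs = p -> all in_day vs ->
    al%:E * \int[P]_w (expZ vs t w * Y w)%:E <= be%:E * \int[P]_w (expZ vs t' w * Y' w)%:E)%E ->
  (al%:E * \int[P]_w (dayL t w ^+ p * Y w)%:E <= be%:E * \int[P]_w (dayL t' w ^+ p * Y' w)%:E)%E.
Proof.
move=> al0 be0; elim: p Y Y' => [|p IHp] Y Y' mY Y0 mY' Y'0 H.
  have := H [::] erefl isT; rewrite !expZ_nil.
  have E s (V : T -> R) : (\int[P]_w (dayL s w ^+ 0 * V w)%:E = \int[P]_w (1 * V w)%:E)%E.
    by apply: eq_integral => w _; rewrite expr0.
  by rewrite !E.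
have mL s (V : T -> R) : measurable_fun setT V -> measurable_fun setT (fun w => dayL s w ^+ p * V w).
  by move=> mV; apply: measurable_funM => //; apply: measurable_funX; exact: measurable_Lam.
have L0 s (V : T -> R) : (forall w, 0 <= V w) -> forall w, 0 <= dayL s w ^+ p * V w.
  by move=> V0 w; rewrite mulr_ge0// exprn_ge0// ltW// dayL_gt0.
have step s (V : T -> R) : measurable_fun setT V -> (forall w, 0 <= V w) ->
    (\int[P]_w (dayL s w ^+ p.+1 * V w)%:E =
     lam%:E * \int[lebesgue_measure]_(v in `](-1)%R, 0%R]) \int[P]_w (dayL s w ^+ p * (F (v + s) w * V w))%:E)%E.
  move=> mV V0; under eq_integral do rewrite exprS -mulrA.
  rewrite dayL_step; [|exact: mL|exact: L0].
  by congr (_ * _)%E; apply: eq_integral => v _; under eq_integral do rewrite mulrCA.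
rewrite !step// muleCA [leRHS]muleCA; apply: lee_wpmul2l; first by rewrite lee_fin ltW.
have mI s (V : T -> R) : measurable_fun setT V -> (forall w, 0 <= V w) ->
    measurable_fun setT (fun v : R => \int[P]_w (dayL s w ^+ p * (F (v + s) w * V w))%:E)%E.
  move=> mV V0; under eq_fun do under eq_integral do rewrite mulrCA.
  by apply: (mFY s (mL s V mV)); exact: L0.
have I0 s (V : T -> R) : (forall w, 0 <= V w) -> forall v : R,
    (0 <= \int[P]_w (dayL s w ^+ p * (F (v + s) w * V w))%:E)%E.
  move=> V0 v; apply: integral_ge0 => w _; rewrite lee_fin !mulr_ge0 ?expR_ge0//.
  by rewrite exprn_ge0// ltW// dayL_gt0.
rewrite -!ge0_integralZl//; last 4 first.
- exact: measurable_funS (mI t' Y' mY' Y'0).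
- by move=> v _; exact: I0.
- exact: measurable_funS (mI t Y mY Y0).
- by move=> v _; exact: I0.
apply: ge0_le_integral => //.
- by move=> v _; rewrite mule_ge0 ?lee_fin ?I0.
- by apply: emeasurable_funM; [exact: measurable_cst|exact: measurable_funS (mI t Y mY Y0)].
- by apply: emeasurable_funM; [exact: measurable_cst|exact: measurable_funS (mI t' Y' mY' Y'0)].
move=> v /=; rewrite in_itv/= => vday; apply: IHp.
- exact: measurable_funM.
- by move=> w; rewrite mulr_ge0// expR_ge0.
- exact: measurable_funM.
- by move=> w; rewrite mulr_ge0// expR_ge0.
move=> vs szvs dvs; have := H (v :: vs).
rewrite /= szvs dvs andbT => /(_ erefl vday).
under eq_integral do rewrite expZ_cons mulrAC mulrC.
by under [X in (_ <= _ * X)%E -> _]eq_integral do rewrite expZ_cons mulrAC mulrC.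
Qed.

(** The same induction against a constant; each step costs a factor [lam] times the length 1 of a
    day. It supplies the finiteness of the moments. *)
Lemma dayL_pow_bound (p : nat) (K t : R) (Y : T -> R) : 0 <= K ->
  measurable_fun setT Y -> (forall w, 0 <= Y w) ->
  (forall vs, size vs = p -> all in_day vs -> \int[P]_w (expZ vs t w * Y w)%:E <= K%:E)%E ->
  (\int[P]_w (dayL t w ^+ p * Y w)%:E <= (lam ^+ p * K)%:E)%E.
Proof.
move=> K0; elim: p Y => [|p IHp] Y mY Y0 H.
  have := H [::] erefl isT; rewrite !expZ_nil mul1r.
  have -> : (\int[P]_w (dayL t w ^+ 0 * Y w)%:E = \int[P]_w (1 * Y w)%:E)%E.
    by apply: eq_integral => w _; rewrite expr0.
  by [].
have mL : measurable_fun setT (fun w => dayL t w ^+ p * Y w).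
  by apply: measurable_funM => //; apply: measurable_funX; exact: measurable_Lam.
have L0 w : 0 <= dayL t w ^+ p * Y w by rewrite mulr_ge0// exprn_ge0// ltW// dayL_gt0.
under eq_integral do rewrite exprS -mulrA.
rewrite dayL_step// exprS -mulrA EFinM; apply: lee_wpmul2l; first by rewrite lee_fin ltW.
have one : (lebesgue_measure (`](-1)%R, 0%R]%classic : set R) = 1)%E.
  by rewrite lebesgue_measure_itv/= lte_fin ltrN10 -EFinD sub0r opprK.
rewrite -[leRHS]mule1 -one -integral_cst//; apply: ge0_le_integral => //.
- move=> v _; apply: integral_ge0 => w _; rewrite lee_fin mulr_ge0 ?expR_ge0//.
- by apply: measurable_funS (mFY t mL L0).
move=> v /=; rewrite in_itv/= => vday.
under eq_integral do rewrite mulrCA.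
apply: IHp; first exact: measurable_funM.
  by move=> w; rewrite mulr_ge0// expR_ge0.
move=> vs szvs dvs; have := H (v :: vs).
rewrite /= szvs dvs andbT => /(_ erefl vday).
by under eq_integral do rewrite expZ_cons mulrAC mulrC.
Qed.

End intensity.

(** * Gaussian exponential moments and joint moments of the intensities *)

Section gaussian_field.
Context {dT : measure_display} {T : measurableType dT} {R : realType}.
Variables (P : probability T R) (H c : R) (B : R -> T -> R).
Hypotheses (H0 : 0 < H) (c0 : 0 < c) (fBm : is_fBm P H B).

Let Z := Zproc c B.

(** The autocovariance of Z at lag [r]. *)
Definition gam (r : R) : R := sdiff (2 * H) (c * r) / 2.

Lemma gamN r : gam (- r) = gam r.
Proof. by rewrite /gam mulrN sdiffN. Qed.

Lemma measurable_Zproc u : measurable_fun setT (Z u).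
Proof. by have [mB _] := fBm; exact: measurable_funB. Qed.

Lemma continuous_Zproc w : continuous (Z ^~ w).
Proof.
have [_ [cB _]] := fBm; move=> u; rewrite /Z /Zproc.
apply: (@cvgB _ R^o).
  apply: (continuous_comp (f := fun u : R => c * u) (g := fun t => B t w)); last exact: cB.
  exact: mulrl_continuous.
apply: (continuous_comp (f := fun u : R => c * u - 1) (g := fun t => B t w)); last exact: cB.
apply: (@cvgB _ R^o); [exact: mulrl_continuous|exact: cvg_cst].
Qed.

Lemma fBm_seq (s : seq (R * R)) :
  centered_gaussian P (fun w => \sum_(x <- s) x.1 * B x.2 w)
    (\sum_(x <- s) \sum_(y <- s) x.1 * y.1 * fbm_cov H x.2 y.2).
Proof.
have [_ [_ /(_ (size s) (fun i => (tnth (in_tuple s) i).2) (fun i => (tnth (in_tuple s) i).1))]] := fBm.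
have -> : (fun w => \sum_(x <- s) x.1 * B x.2 w) =
    (fun w => \sum_(i < size s) (tnth (in_tuple s) i).1 * B (tnth (in_tuple s) i).2 w).
  by apply/funext => w; rewrite big_tnth.
rewrite [X in _ -> centered_gaussian _ _ X]big_tnth.
by under [X in _ -> centered_gaussian _ _ X]eq_bigr do rewrite big_tnth.
Qed.

(** The pairs (coefficient, time) that write a sum of values of Z as a linear combination of values
    of [B]. *)
Definition incr_pairs (ts : seq R) : seq (R * R) :=
  flatten [seq [:: (1, c * t); (-1, c * t - 1)] | t <- ts].

Lemma sum_incr_pairs (ts : seq R) (f : R * R -> R) :
  \sum_(x <- incr_pairs ts) f x = \sum_(t <- ts) (f (1, c * t) + f (-1, c * t - 1)).
Proof.
elim: ts => [|t ts IHts]; first by rewrite !big_nil.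
by rewrite /incr_pairs/= !big_cons -/(incr_pairs ts) IHts addrA.
Qed.

(** The coefficients 1 and -1 of an increment cancel the terms of [fbm_cov] that depend on a single
    time; the lag terms left over form a second difference. *)
Lemma incr_pairs_cov (ts us : seq R) :
  \sum_(x <- incr_pairs ts) \sum_(y <- incr_pairs us) x.1 * y.1 * fbm_cov H x.2 y.2 =
  \sum_(t <- ts) \sum_(u <- us) gam (u - t).
Proof.
rewrite sum_incr_pairs; apply: eq_bigr => t _.
rewrite !sum_incr_pairs -big_split/=; apply: eq_bigr => u _.
rewrite /fbm_cov /gam /sdiff.
have -> : c * u - (c * t - 1) = c * (u - t) + 1 by ring.
have -> : c * u - 1 - (c * t - 1) = c * (u - t) by ring.
have -> : c * u - 1 - c * t = c * (u - t) - 1 by ring.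
have -> : c * u - c * t = c * (u - t) by ring.
by field.
Qed.

Lemma expZ_mgf (ts : seq R) :
  (\int[P]_w (expR (\sum_(t <- ts) Z t w))%:E =
   (expR ((\sum_(t <- ts) \sum_(u <- ts) gam (u - t)) / 2))%:E)%E.
Proof.
rewrite -incr_pairs_cov.
have ZE w : \sum_(t <- ts) Z t w = \sum_(x <- incr_pairs ts) x.1 * B x.2 w.
  rewrite sum_incr_pairs; apply: eq_bigr => t _.
  by rewrite /Z /Zproc/= mul1r mulN1r.
under eq_integral do rewrite ZE.
have [mB _] := fBm.
apply: gaussian_mgf; last 2 first.
- exact: fBm_seq.
(* Changing the sign of all coefficients changes the sign of the variable but not its variance. *)
- have := fBm_seq [seq (- x.1, x.2) | x <- incr_pairs ts].
  rewrite big_map; under eq_bigr => x _.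
    rewrite big_map; under eq_bigr do rewrite /= mulrNN.
    over.
  have -> // : (fun w => \sum_(x <- [seq (- x.1, x.2) | x <- incr_pairs ts]) x.1 * B x.2 w) =
    (fun w => - \sum_(x <- incr_pairs ts) x.1 * B x.2 w).
  by apply/funext => w; rewrite big_map -sumrN; apply: eq_bigr => x _; rewrite /= mulNr.
apply: measurable_sum => x; apply: measurable_funM; first exact: measurable_cst.
exact: mB.
Qed.

(** Half the variance of the sum of Z over the instants [vs]; by stationarity the day does not
    matter. *)
Definition qvar (vs : seq R) : R := (\sum_(v <- vs) \sum_(u <- vs) gam (u - v)) / 2.

Lemma expZ_moment vs t : (\int[P]_w (expZ Z vs t w)%:E = (expR (qvar vs))%:E)%E.
Proof.
rewrite /expZ; have E w : \sum_(v <- vs) Z (v + t) w = \sum_(x <- [seq v + t | v <- vs]) Z x w.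
  by rewrite big_map.
under eq_integral do rewrite E.
rewrite expZ_mgf /qvar !big_map; congr (expR (_ / 2))%:E.
apply: eq_bigr => v _; rewrite big_map; apply: eq_bigr => u _.
by congr gam; ring.
Qed.

(** The variance of the joint sum splits into the two variances and twice the cross covariance. Only
    this last part depends on the lag between the days. *)
Lemma expZ_cross vs us t s :
  (\int[P]_w (expZ Z vs t w * expZ Z us s w)%:E =
   (expR (qvar vs) * expR (qvar us) *
    expR (\sum_(v <- vs) \sum_(u <- us) gam (s - t + u - v)))%:E)%E.
Proof.
have E w : expZ Z vs t w * expZ Z us s w =
    expR (\sum_(x <- [seq v + t | v <- vs] ++ [seq u + s | u <- us]) Z x w).
  by rewrite /expZ -expRD big_cat/= !big_map.
under eq_integral do rewrite E.
rewrite expZ_mgf -!expRD; congr (expR _)%:E.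
rewrite big_cat/= !big_map.
have split4 x : \sum_(u <- [seq v + t | v <- vs] ++ [seq u + s | u <- us]) gam (u - x) =
  \sum_(v <- vs) gam (v + t - x) + \sum_(u <- us) gam (u + s - x).
  by rewrite big_cat/= !big_map.
under eq_bigr do rewrite split4; under [X in _ + X]eq_bigr do rewrite split4.
rewrite !big_split/= /qvar.
have -> : \sum_(v <- vs) \sum_(v0 <- vs) gam (v0 + t - (v + t)) = \sum_(v <- vs) \sum_(u <- vs) gam (u - v).
  by apply: eq_bigr => v _; apply: eq_bigr => u _; congr gam; ring.
have -> : \sum_(v <- us) \sum_(v0 <- us) gam (v0 + s - (v + s)) = \sum_(v <- us) \sum_(u <- us) gam (u - v).
  by apply: eq_bigr => v _; apply: eq_bigr => u _; congr gam; ring.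
have -> : \sum_(v <- vs) \sum_(u <- us) gam (u + s - (v + t)) = \sum_(v <- vs) \sum_(u <- us) gam (s - t + u - v).
  by apply: eq_bigr => v _; apply: eq_bigr => u _; congr gam; ring.
have -> : \sum_(u <- us) \sum_(v <- vs) gam (v + t - (u + s)) = \sum_(v <- vs) \sum_(u <- us) gam (s - t + u - v).
  rewrite exchange_big/=.
  by apply: eq_bigr => v _; apply: eq_bigr => u _; rewrite -gamN; congr gam; ring.
by field.
Qed.

Lemma gam_bound r : `|r| <= 1 -> `|gam r| <= 2 * (c + 1) `^ (2 * H).
Proof.
move=> r1; rewrite /gam /sdiff.
have a0 : 0 <= 2 * H by rewrite mulr_ge0// ltW.
have cr : `|c * r| <= c by rewrite normrM (gtr0_norm c0) ler_piMr// ltW.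
have bd (x : R) : `|x| <= c + 1 -> 0 <= `|x| `^ (2 * H) <= (c + 1) `^ (2 * H).
  by move=> xc; rewrite powR_ge0/= ge0_ler_powR// nnegrE// addr_ge0 ?ltW.
have /andP[p1 q1] := bd (c * r + 1) ltac:(apply: le_trans (ler_normD _ _) _; rewrite normr1 lerD2r//).
have /andP[p2 q2] := bd (c * r - 1) ltac:(apply: le_trans (ler_normB _ _) _; rewrite normr1 lerD2r//).
have /andP[p3 q3] := bd (c * r) ltac:(apply: le_trans cr _; rewrite lerDl//).
rewrite ler_norml; apply/andP; split; lra.
Qed.

Lemma sum_bound (vs us : seq R) (f : R -> R -> R) (g : R) :
  (forall v u, v \in vs -> u \in us -> f v u <= g) ->
  \sum_(v <- vs) \sum_(u <- us) f v u <= (size vs)%:R * (size us)%:R * g.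
Proof.
move=> fg.
have C (ws : seq R) (h : R -> R) (k : R) : (forall w, w \in ws -> h w <= k) -> \sum_(w <- ws) h w <= (size ws)%:R * k.
  move=> hk; apply: (@le_trans _ _ (\sum_(w <- ws) k)).
    by rewrite big_seq [leRHS]big_seq; apply: ler_sum.
  by rewrite big_const_seq count_predT iter_addr_0 mulr_natl.
by rewrite -mulrA; apply: (C vs) => v vv; apply: (C us) => u uu; exact: fg.
Qed.

Lemma qvar_bound p vs : size vs = p -> all in_day vs ->
  qvar vs <= p%:R ^+ 2 * (c + 1) `^ (2 * H).
Proof.
move=> sz /allP dvs; rewrite /qvar.
have := @sum_bound vs vs (fun v u => gam (u - v)) (2 * (c + 1) `^ (2 * H)).
rewrite sz => S.
suff : \sum_(v <- vs) \sum_(u <- vs) gam (u - v) <= p%:R * p%:R * (2 * (c + 1) `^ (2 * H)) by rewrite expr2; lra.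
apply: S => v u /dvs/andP[v1 v2] /dvs/andP[u1 u2].
by apply: le_trans (ler_norm _) (gam_bound _); rewrite ler_norml; apply/andP; split; lra.
Qed.

Variable lam : R.
Hypothesis lam0 : 0 < lam.

Let L := dayL lam Z.

Let mL t p : measurable_fun setT (fun w => L t w ^+ p).
Proof.
apply: measurable_funX; apply: (measurable_Lam P lam0).
  exact: measurable_Zproc.
exact: continuous_Zproc.
Qed.

Let L0 t p w : 0 <= L t w ^+ p.
Proof. by rewrite exprn_ge0// ltW// dayL_gt0//; exact: continuous_Zproc. Qed.

Let pow_le := @dayL_pow_le _ _ _ P lam Z lam0 measurable_Zproc continuous_Zproc.

Let m1 : measurable_fun setT (fun _ : T => 1 : R). Proof. exact: measurable_cst. Qed.

Let mul1E (V : T -> R) : (\int[P]_w (V w * 1)%:E = \int[P]_w (V w)%:E)%E.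
Proof. by apply: eq_integral => w _; rewrite mulr1. Qed.

Let mulCE (V W : T -> R) : (\int[P]_w (V w * W w)%:E = \int[P]_w (W w * V w)%:E)%E.
Proof. by apply: eq_integral => w _; rewrite mulrC. Qed.

Lemma rintegrable_dayL_pow t p : rintegrable P (fun w => L t w ^+ p).
Proof.
apply/integrableP; split; first exact/measurable_EFinP.
under eq_integral do rewrite /= ger0_norm//.
rewrite -mul1E.
have K0 : 0 <= expR (p%:R ^+ 2 * (c + 1) `^ (2 * H)) by exact: expR_ge0.
apply: le_lt_trans (dayL_pow_bound lam0 measurable_Zproc continuous_Zproc K0 m1 (fun=> ler01) _) _.
  move=> vs sz dvs; rewrite mul1E expZ_moment lee_fin ler_expR.
  exact: qvar_bound.
by rewrite ltry.
Qed.

Definition ell p : R := Ex P (fun w => L 0 w ^+ p).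

(** Equal exponential moments on the two days give both inequalities of [dayL_pow_le]. *)
Lemma dayL_moment t p : Ex P (fun w => L t w ^+ p) = ell p.
Proof.
have le t1 t2 : Ex P (fun w => L t1 w ^+ p) <= Ex P (fun w => L t2 w ^+ p).
  suff : (\int[P]_w (L t1 w ^+ p)%:E <= \int[P]_w (L t2 w ^+ p)%:E)%E.
    by rewrite (Ex_EFin (rintegrable_dayL_pow t1 p)) (Ex_EFin (rintegrable_dayL_pow t2 p)) lee_fin.
  rewrite -[leLHS]mul1e -[leRHS]mul1e -(mul1E (fun w => L t1 w ^+ p)) -(mul1E (fun w => L t2 w ^+ p)).
  apply: (pow_le ler01 ler01 m1 (fun=> ler01) m1 (fun=> ler01)) => vs _ _.
  by rewrite !mul1e !mul1E !expZ_moment.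
by apply: le_anti; apply/andP; split; [exact: (le t 0)|exact: (le 0 t)].
Qed.

Let EL t k : (\int[P]_w (L t w ^+ k)%:E = (ell k)%:E)%E.
Proof. by rewrite -(dayL_moment t) -Ex_EFin//; exact: rintegrable_dayL_pow. Qed.

(** Comparison with the weight 1, whose exponential moment is [expR (qvar vs)]: the constant [K] is
    the excess due to the weight [V]. *)
Lemma dayL_pow_ub p (K t : R) (V : T -> R) : 0 <= K ->
  measurable_fun setT V -> (forall w, 0 <= V w) ->
  (forall vs, size vs = p -> all in_day vs ->
     \int[P]_w (expZ Z vs t w * V w)%:E <= (K * expR (qvar vs))%:E)%E ->
  (\int[P]_w (L t w ^+ p * V w)%:E <= (K * ell p)%:E)%E.
Proof.
move=> K0 mV V0 h; rewrite EFinM -(EL t p) -[leLHS]mul1e -(mul1E (fun w => L t w ^+ p)).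
apply: (pow_le ler01 K0 mV V0 m1 (fun=> ler01)) => vs sz dvs.
by rewrite mul1e mul1E expZ_moment -EFinM; exact: h.
Qed.

Lemma dayL_pow_lb p (K t : R) (V : T -> R) : 0 <= K ->
  measurable_fun setT V -> (forall w, 0 <= V w) ->
  (forall vs, size vs = p -> all in_day vs ->
     (K * expR (qvar vs))%:E <= \int[P]_w (expZ Z vs t w * V w)%:E)%E ->
  ((K * ell p)%:E <= \int[P]_w (L t w ^+ p * V w)%:E)%E.
Proof.
move=> K0 mV V0 h; rewrite EFinM -(EL t p) -[leRHS]mul1e -(mul1E (fun w => L t w ^+ p)).
apply: (pow_le K0 ler01 m1 (fun=> ler01) mV V0) => vs sz dvs.
by rewrite mul1e mul1E expZ_moment -EFinM; exact: h.
Qed.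

Let mexpZ vs t := measurable_expZ measurable_Zproc vs t.

(* Integrating the joint Gaussian moment day by day turns bounds of [gam] into
   bounds of the joint moments of the intensities. *)
Lemma dayL_cross_moments t s p q (gm gp : R) :
  (forall v u, in_day v -> in_day u -> gm <= gam (s - t + u - v) <= gp) ->
  [/\ rintegrable P (fun w => L t w ^+ p * L s w ^+ q),
      expR (p%:R * q%:R * gm) * (ell p * ell q) <= Ex P (fun w => L t w ^+ p * L s w ^+ q) &
      Ex P (fun w => L t w ^+ p * L s w ^+ q) <= expR (p%:R * q%:R * gp) * (ell p * ell q)].
Proof.
move=> gmp.
have cross_le vs us : size vs = p -> size us = q -> all in_day vs -> all in_day us ->
    expR (p%:R * q%:R * gm) <= expR (\sum_(v <- vs) \sum_(u <- us) gam (s - t + u - v)) <= expR (p%:R * q%:R * gp).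
  move=> <- <- /allP dvs /allP dus; rewrite !ler_expR; apply/andP; split.
    rewrite -lerN2 -sumrN; under eq_bigr do rewrite -sumrN.
    rewrite -mulrN; apply: sum_bound => v u /dvs dv /dus du.
    by rewrite lerN2; have /andP[] := gmp v u dv du.
  by apply: sum_bound => v u /dvs dv /dus du; have /andP[] := gmp v u dv du.
have e0 x : 0 <= expR x :> R by exact: expR_ge0.
have ell0 k : 0 <= ell k by apply: Ex_ge0.
(* Day [s] is integrated first, with the instants [vs] of day [t] held fixed. The result is again a
   constant times [expR (qvar vs)], the form required for integrating day [t]. *)
have inner vs : size vs = p -> all in_day vs ->
    ((expR (p%:R * q%:R * gm) * ell q * expR (qvar vs))%:E <= \int[P]_w (expZ Z vs t w * L s w ^+ q)%:E)%E /\
    (\int[P]_w (expZ Z vs t w * L s w ^+ q)%:E <= (expR (p%:R * q%:R * gp) * ell q * expR (qvar vs))%:E)%E.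
  move=> sz dvs; rewrite mulCE; split.
    rewrite mulrAC; apply: dayL_pow_lb; [exact: mulr_ge0|exact: mexpZ|exact: expZ_ge0|].
    move=> us szu dus; rewrite mulCE expZ_cross lee_fin.
    have /andP[h _] := cross_le vs us sz szu dvs dus.
    have -> : expR (p%:R * q%:R * gm) * expR (qvar vs) * expR (qvar us) =
      expR (qvar vs) * expR (qvar us) * expR (p%:R * q%:R * gm) by ring.
    by rewrite ler_wpM2l// mulr_ge0.
  rewrite mulrAC; apply: dayL_pow_ub; [exact: mulr_ge0|exact: mexpZ|exact: expZ_ge0|].
  move=> us szu dus; rewrite mulCE expZ_cross lee_fin.
  have /andP[_ h] := cross_le vs us sz szu dvs dus.
  have -> : expR (p%:R * q%:R * gp) * expR (qvar vs) * expR (qvar us) =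
    expR (qvar vs) * expR (qvar us) * expR (p%:R * q%:R * gp) by ring.
  by rewrite ler_wpM2l// mulr_ge0.
have up : (\int[P]_w (L t w ^+ p * L s w ^+ q)%:E <= (expR (p%:R * q%:R * gp) * (ell p * ell q))%:E)%E.
  rewrite (mulrC (ell p)) mulrA; apply: dayL_pow_ub; [exact: mulr_ge0|exact: mL|exact: L0|].
  by move=> vs sz dvs; have [] := inner vs sz dvs.
have lo : ((expR (p%:R * q%:R * gm) * (ell p * ell q))%:E <= \int[P]_w (L t w ^+ p * L s w ^+ q)%:E)%E.
  rewrite (mulrC (ell p)) mulrA; apply: dayL_pow_lb; [exact: mulr_ge0|exact: mL|exact: L0|].
  by move=> vs sz dvs; have [] := inner vs sz dvs.
have iX : rintegrable P (fun w => L t w ^+ p * L s w ^+ q).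
  apply/integrableP; split; first by apply/measurable_EFinP; exact: measurable_funM.
  under eq_integral do rewrite /= ger0_norm ?mulr_ge0//.
  by apply: le_lt_trans up _; rewrite ltry.
by move: lo up; rewrite (Ex_EFin iX) !lee_fin.
Qed.

End gaussian_field.

(** The coefficients 1, 6, 7, 1 are Stirling numbers of the second kind. *)
Lemma natr_fourth_power (R : nzRingType) (n : nat) :
  n%:R ^+ 4 = (n ^_ 4)%:R + 6 * (n ^_ 3)%:R + 7 * (n ^_ 2)%:R + (n ^_ 1)%:R :> R.
Proof.
rewrite -natrX -!natrM -!natrD; congr _%:R.
by case: n => [|[|[|[|n]]]] //; rewrite !ffactnS /= !ffactn0; lia.
Qed.

(** From [expR (- x) >= 1 - x] one gets [expR x <= 1 / (1 - x)], and [(1 - x) * (1 + x + 2 x^2) = 1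
    + x^2 - 2 x^3] is at least 1 for [x <= 1 / 2]. *)
Lemma expR_quadratic_ub (R : realType) (x : R) : 0 <= x <= 1 / 2 -> expR x <= 1 + x + 2 * x ^+ 2.
Proof.
move=> /andP[x0 x1]; have h := expR_ge1Dx (- x); rewrite expRN in h.
have e0 := expR_gt0 x; have {}h : (1 - x) * expR x <= 1.
  by rewrite -[leRHS](mulVf (lt0r_neq0 e0)) ler_wpM2r// ltW.
have : (1 - x) * expR x <= (1 - x) * (1 + x + 2 * x ^+ 2) by nra.
by rewrite ler_pM2l//; lra.
Qed.

(** * Asymptotic covariances of the factorial moments of the counts *)

Section factorial_moments.
Context {dT : measure_display} {T : measurableType dT} {R : realType}.
Variables (P : probability T R) (H c lam : R) (B : R -> T -> R) (C : R -> T -> int).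
Hypotheses (H12 : 1 < 2 * H < 2) (c0 : 0 < c) (lam0 : 0 < lam) (fBm : is_fBm P H B).
Hypotheses (Ccount : @is_counting _ T R C) (cox : is_Cox P lam (Zproc c B) C).

Let H0 : 0 < H. Proof. by case/andP: H12; lra. Qed.

Let Z := Zproc c B.

Let Lgt0 : forall (a b : R) w, a < b -> 0 < Lam lam Z a b w.
Proof. by move=> a b w; apply: Lam_gt0 => //; exact: (continuous_Zproc fBm). Qed.

Let mLam : forall a b, measurable_fun setT (Lam lam Z a b).
Proof.
move=> a b; apply: (measurable_Lam P lam0); first by move=> u; exact: (@measurable_Zproc _ _ _ _ _ _ _ fBm u).
exact: (continuous_Zproc fBm).
Qed.

(** An empty family of conditions on Z turns the conditional law into the unconditional mixed
    Poisson law. *)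
Let cox0 (n : nat) (a b : 'I_n -> R) (k : 'I_n -> nat) :
  (forall i, a i < b i) ->
  (forall i j, i != j -> b i <= a j \/ b j <= a i) ->
  P [set w | forall i, C (b i) w - C (a i) w = (k i)%:Z] =
  (\int[P]_w (\prod_(i < n) poisson_pmf (Lam lam Z (a i) (b i) w) (k i))%:E)%E.
Proof.
move=> ab dis; have nA : forall j : 'I_0, measurable (set0 : set R) by case.
have := cox k ab dis (fun=> 0) nA.
have -> : [set w | forall j : 'I_0, (set0 : set R) (Zproc c B 0 w)] = setT.
  by apply/seteqP; split => // w _ [].
by rewrite setTI.
Qed.

Lemma count_mono_ae (s t : R) : s < t -> P [set w | C t w < C s w] = 0%E.
Proof. exact: (incr_negative_null Ccount Lgt0 mLam cox0). Qed.

Let L := dayL lam Z.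

Let LL_integrable t s p q : rintegrable P (fun w => L t w ^+ p * L s w ^+ q).
Proof.
have L0 t' k w : 0 <= L t' w ^+ k by rewrite exprn_ge0// ltW// Lgt0// ltrBlDr ltrDl.
have mL t' k : measurable_fun setT (fun w => L t' w ^+ k) by apply: measurable_funX; exact: mLam.
apply: (@rintegrable_le _ _ _ _ _ (fun w => L t w ^+ (2 * p) + L s w ^+ (2 * q))).
- exact: measurable_funM.
- move=> w; rewrite ger0_norm ?mulr_ge0// !(mulnC 2) !exprM.
  by have := L0 t p w; have := L0 s q w; nra.
by apply: rintegrableD; exact: (rintegrable_dayL_pow H0 c0 fBm lam0).
Qed.

Let n_ t w := day_count C t w.

Lemma ffact_pair (t s : int) p q : t != s ->
  rintegrable P (fun w => (n_ t w ^_ p)%:R * (n_ s w ^_ q)%:R) /\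
  Ex P (fun w => (n_ t w ^_ p)%:R * (n_ s w ^_ q)%:R) =
  Ex P (fun w => L t%:~R w ^+ p * L s%:~R w ^+ q).
Proof.
move=> ts.
have dis : (t%:~R : R) <= s%:~R - 1 \/ (s%:~R : R) <= t%:~R - 1.
  have [ts'|st] := ltP t s; [left|right].
    by rewrite lerBrDr -(intrD _ t 1) ler_int; lia.
  by rewrite lerBrDr -(intrD _ s 1) ler_int; lia.
have d1 (z : int) : (z%:~R - 1 : R) < z%:~R by rewrite ltrBlDr ltrDl.
have E := cox_factorial_moments Ccount Lgt0 mLam cox0 p q (d1 t) (d1 s) dis.
have mn : measurable_fun setT (fun w => (n_ t w ^_ p)%:R * (n_ s w ^_ q)%:R : R).
  apply: measurable_funM.
    exact: (measurable_incr_abs Ccount (fun n => (n ^_ p)%:R)).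
  exact: (measurable_incr_abs Ccount (fun n => (n ^_ q)%:R)).
have iL := LL_integrable t%:~R s%:~R p q.
have i_n : rintegrable P (fun w => (n_ t w ^_ p)%:R * (n_ s w ^_ q)%:R).
  apply/integrableP; split; first exact/measurable_EFinP.
  under eq_integral do rewrite /= ger0_norm ?mulr_ge0//.
  by rewrite [X in (X < _)%E]E (Ex_EFin iL) ltry.
split=> //; apply: EFin_inj; rewrite -(Ex_EFin i_n) -(Ex_EFin iL); exact: E.
Qed.

(** The pair formula with exponent 0 on the following day. *)
Lemma ffact_single (t : int) p : rintegrable P (fun w => (n_ t w ^_ p)%:R) /\
  Ex P (fun w => (n_ t w ^_ p)%:R) = ell P c B lam p.
Proof.
have ts : t != t + 1 by lia.
have [i E] := ffact_pair p 0 ts.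
have e1 : (fun w => (n_ t w ^_ p)%:R * (n_ (t + 1) w ^_ 0)%:R) = (fun w => (n_ t w ^_ p)%:R : R).
  by apply/funext => w; rewrite ffactn0 mulr1.
have e2 : (fun w => L t%:~R w ^+ p * L (t + 1)%:~R w ^+ 0) = (fun w => L t%:~R w ^+ p).
  by apply/funext => w; rewrite expr0 mulr1.
by move: i E; rewrite e1 e2 (dayL_moment H0 c0 fBm lam0).
Qed.

Lemma ell_gt0 p : 0 < ell P c B lam p.
Proof.
rewrite lt0r; apply/andP; split; last first.
  by apply: Ex_ge0 => w; rewrite exprn_ge0// ltW// Lgt0// ltrBlDr ltrDl.
apply/eqP => E0.
have i := rintegrable_dayL_pow H0 c0 fBm lam0 0 p.
have := Ex_EFin i; rewrite -/(ell P c B lam p) E0.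
have mLp : measurable_fun setT (fun w => (L 0 w ^+ p)%:E).
  by apply/measurable_EFinP; apply: measurable_funX; exact: mLam.
move=> I0; have : (\int[P]_w `|(L 0 w ^+ p)%:E| = 0)%E.
  rewrite -[RHS]I0; apply: eq_integral => w _.
  by rewrite /= ger0_norm// exprn_ge0// ltW// Lgt0// ltrBlDr ltrDl.
move/(@ae_eq_integral_abs _ _ _ P setT measurableT _ mLp) => [N [mN PN sub]].
have : P setT = 0%E.
  apply/eqP; rewrite eq_le measure_ge0 andbT -PN.
  apply: le_measure; rewrite ?inE//.
  move=> w _; apply: sub => /= /(_ I)[]; apply/eqP.
  by rewrite gt_eqF// exprn_gt0// Lgt0// ltrBlDr ltrDl.
by rewrite probability_setT => /eqP; rewrite eqe oner_eq0.
Qed.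

Let a := 2 * H.

(** The ratio of [gam r] to [sdiff a r] for large [r]: the power of [c] from [sdiff_ratio], the half
    from [gam]. *)
Definition kap : R := c `^ (a - 2) / 2.

Let kap0 : 0 < kap. Proof. by rewrite divr_gt0// powR_gt0. Qed.

Lemma gam_window eps : 0 < eps -> exists K : nat, forall (t s : int) v u,
  (K <= `|t - s|)%N -> in_day v -> in_day u ->
  (1 - eps) * (kap * sdiff a (t - s)%:~R) <= gam H c (s%:~R - t%:~R + u - v)
    <= (1 + eps) * (kap * sdiff a (t - s)%:~R).
Proof.
move=> e0; have [K HK] := sdiff_ratio H12 c0 e0.
exists K => t s v u Kts /andP[v1 v2] /andP[u1 u2].
have uv : `|u - v| <= 1 by rewrite ler_norml; apply/andP; split; lra.
have E : `|(t - s)%:~R| = (`|t - s|%N)%:R :> R by rewrite natr_absz intr_norm.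
(* By evenness the lag may be taken positive; [y] is [u - v] or its opposite. *)
have : exists2 y : R, `|y| <= 1 &
    sdiff a (c * (s%:~R - t%:~R + u - v)) = sdiff a (c * ((`|t - s|%N)%:R + y)).
  rewrite -E intrB; have [ts|ts] := ger0P (t%:~R - s%:~R : R).
    exists (v - u); first by rewrite distrC.
    by rewrite -sdiffN; congr sdiff; ring.
  by exists (u - v) => //; congr sdiff; ring.
move=> [y y1 Ey]; rewrite /gam -/a Ey; have := HK _ y Kts y1.
rewrite -/a -E sdiff_norm /kap => /andP[h1 h2]; apply/andP; split; lra.
Qed.

Let m_ p q (t s : int) := Ex P (fun w => (n_ t w ^_ p)%:R * (n_ s w ^_ q)%:R).
Let l_ := ell P c B lam.

(** Distant lags make [gam] small, and the bounds [expR (p * q * g)] of the moment ratio are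
    linearised. This is where the factor [p * q] comes from. *)
Lemma ffact_cov_asymp p q eps : 0 < eps -> exists K : nat, forall t s : int,
  (K <= `|t - s|)%N ->
  `|m_ p q t s - l_ p * l_ q - kap * p%:R * q%:R * l_ p * l_ q * sdiff a (t - s)%:~R|
     <= eps * sdiff a (t - s)%:~R.
Proof.
move=> e0; have ll : 0 < l_ p * l_ q by rewrite mulr_gt0 ?ell_gt0.
set D := l_ p * l_ q in ll *.
pose M := p%:R * q%:R * kap.
have M0 : 0 <= M by apply: mulr_ge0; [exact: mulr_ge0|exact: ltW].
(* With [x = M * h] the upper bound has relative error [3 * dl * x]: one [dl] from [gam_window], two
   from the quadratic term, since [2 * (2 x)^2 <= 2 * dl * x] once [4 * x <= dl]. Adding 1 keeps the
   denominators positive when [M = 0]. *)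
pose dl := Num.min 1 (eps / (3 * M * D + 1)).
have MD : 0 <= M * D by rewrite mulr_ge0// ltW.
have dl0 : 0 < dl by rewrite lt_min ltr01 divr_gt0//; lra.
have dl1 : dl <= 1 by rewrite ge_min lexx.
have dlM : 3 * M * D * dl <= eps.
  have : dl * (3 * M * D + 1) <= eps by rewrite -ler_pdivlMr ?ge_min ?lexx ?orbT//; lra.
  by nra.
have [K1 HK1] := gam_window dl0.
have M1 : 0 < dl / (4 * M + 1) by rewrite divr_gt0//; lra.
have [K2 HK2] := sdiff_small H12 M1.
(* The additional 1 forces distinct days, as [ffact_pair] requires. *)
exists (K1 + K2 + 1)%N => t s Kts.
have [k1 k2 ts] : [/\ (K1 <= `|(t - s)%R|)%N, (K2 <= `|(t - s)%R|)%N & t != s].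
  by move: Kts; clear; split; lia.
rewrite /m_; have [_ ->] := ffact_pair p q ts.
have /andP[_] := HK2 `|t - s|%N k2.
rewrite -/a natr_absz intr_norm sdiff_norm.
have /andP[h0 _] := sdiff_int_bounds (t - s) H12.
rewrite -/a in h0; set h := sdiff a _ in h0 * => hs.
have Mh : 4 * (M * h) <= dl.
  have : h * (4 * M + 1) <= dl by rewrite -ler_pdivlMr//; lra.
  by nra.
have [] := dayL_cross_moments H0 c0 fBm lam0 (t := t%:~R) (s := s%:~R) p q
  (gm := (1 - dl) * (kap * h)) (gp := (1 + dl) * (kap * h)).
  by move=> v u dv du; exact: HK1.
move=> _; rewrite -/l_ -/D -/L.
set E := Ex P _ => lo up.
have Mh0 : 0 <= M * h by rewrite mulr_ge0.
have x1 : p%:R * q%:R * ((1 - dl) * (kap * h)) = (1 - dl) * (M * h) by rewrite /M; ring.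
have x2 : p%:R * q%:R * ((1 + dl) * (kap * h)) = (1 + dl) * (M * h) by rewrite /M; ring.
have -> : kap * p%:R * q%:R * l_ p * l_ q * h = M * h * D by rewrite /M /D; ring.
rewrite x1 in lo; rewrite x2 in up.
set x := M * h in Mh Mh0 lo up *.
have {}lo : (1 + (1 - dl) * x) * D <= E.
  by apply: le_trans lo; rewrite ler_pM2r//; exact: expR_ge1Dx.
have {}up : E <= (1 + x + 3 * dl * x) * D.
  apply: le_trans up _; rewrite ler_pM2r//.
  have h12 : 0 <= (1 + dl) * x <= 1 / 2 by apply/andP; split; nra.
  apply: le_trans (expR_quadratic_ub h12) _.
  have : (1 + dl) * x <= 2 * x by nra.
  nra.
have b3 : 3 * dl * x * D <= eps * h.
  have -> : 3 * dl * x * D = 3 * M * D * dl * h by rewrite /x; ring.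
  by rewrite ler_wpM2r.
rewrite ler_norml; apply/andP; split; nra.
Qed.

End factorial_moments.

(** * Covariance of two sums *)

Section sum_covariance.
Context {dT : measure_display} {T : measurableType dT} {R : realType}.
Variable P : probability T R.

Lemma covariance_Ex (X Y : T -> R) : rintegrable P X -> rintegrable P Y ->
  rintegrable P (fun w => X w * Y w) ->
  fine (covariance P X Y) = Ex P (fun w => X w * Y w) - Ex P X * Ex P Y.
Proof.
move=> iX iY iXY; rewrite covarianceE; try exact/Lfun1_integrable.
rewrite unlock.
rewrite (_ : (\int[P]_w (X w)%:E)%E = (Ex P X)%:E); last exact: Ex_EFin.
rewrite (_ : (\int[P]_w (Y w)%:E)%E = (Ex P Y)%:E); last exact: Ex_EFin.
by rewrite (_ : (\int[P]_w ((X * Y)%R w)%:E)%E = (Ex P (fun w => X w * Y w))%:E); last exact: Ex_EFin.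
Qed.

Lemma covariance_sum (n : nat) (f g : nat -> T -> R) :
  (forall i, rintegrable P (f i)) -> (forall j, rintegrable P (g j)) ->
  (forall i j, rintegrable P (fun w => f i w * g j w)) ->
  fine (covariance P (fun w => \sum_(i < n) f i w) (fun w => \sum_(j < n) g j w)) =
  \sum_(i < n) \sum_(j < n) (Ex P (fun w => f i w * g j w) - Ex P (f i) * Ex P (g j)).
Proof.
move=> fi gi fgi.
have E : (fun w => (\sum_(i < n) f i w) * (\sum_(j < n) g j w)) =
    (fun w => \sum_(i < n) \sum_(j < n) f i w * g j w).
  by apply/funext => w; rewrite big_distrlr.
have i1 (i : 'I_n) : rintegrable P (fun w => \sum_(j < n) f i w * g j w).
  by apply: rintegrable_sum => j; exact: fgi.
rewrite covariance_Ex.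
- rewrite E !Ex_sum//.
  under eq_bigr do rewrite Ex_sum//.
  rewrite big_distrlr -sumrB; apply: eq_bigr => i _ /=.
  by rewrite -sumrB.
- exact: rintegrable_sum.
- exact: rintegrable_sum.
by rewrite E; exact: rintegrable_sum.
Qed.

End sum_covariance.

(** * Asymptotic covariances of powers of returns and of their sums *)

Section return_covariances.
Context {dT : measure_display} {T : measurableType dT} {R : realType}.
Variables (P : probability T R) (e : int -> T -> R) (C : R -> T -> int) (mu : R).
Hypotheses (mu0 : 0 < mu) (eiid : iid_shocks P e) (Ccount : @is_counting _ T R C).
Hypothesis eC : indep_shocks_counts P e C.
Hypothesis Cmono : forall s t : R, s < t -> P [set w | C t w < C s w] = 0%E.

Let n_ t w := day_count C t w.

Variables (l_ : nat -> R) (k_ a : R).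
Hypotheses (a12 : 1 < a < 2) (l_gt0 : forall p, 0 < l_ p).
Hypothesis n_pair_integrable : forall (t s : int) p q, t != s ->
  rintegrable P (fun w => (n_ t w ^_ p)%:R * (n_ s w ^_ q)%:R).
Hypothesis n_single : forall (t : int) p, rintegrable P (fun w => (n_ t w ^_ p)%:R) /\
  Ex P (fun w => (n_ t w ^_ p)%:R) = l_ p.
Hypothesis n_cov_asymp : forall p q eps, 0 < eps -> exists K : nat, forall t s : int,
  (K <= `|t - s|)%N ->
  `|Ex P (fun w => (n_ t w ^_ p)%:R * (n_ s w ^_ q)%:R) - l_ p * l_ q
    - k_ * p%:R * q%:R * l_ p * l_ q * sdiff a (t - s)%:~R| <= eps * sdiff a (t - s)%:~R.

Let r_ := ret mu C e.

Definition ret_bound : R := 8 * (mu ^+ 4 + Ex P (fun w => e 0 w ^+ 4)) *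
  (l_ 4 + 6 * l_ 3 + 7 * l_ 2 + l_ 1).

Lemma ret_fourth t : rintegrable P (fun w => r_ t w ^+ 4) /\ Ex P (fun w => r_ t w ^+ 4) <= ret_bound.
Proof.
have E : (fun w => (n_ t w)%:R ^+ 4) = (fun w => (n_ t w ^_ 4)%:R + 6 * (n_ t w ^_ 3)%:R +
    7 * (n_ t w ^_ 2)%:R + (n_ t w ^_ 1)%:R : R).
  by apply/funext => w; exact: natr_fourth_power.
have [i1 E1] := n_single t 1; have [i2 E2] := n_single t 2.
have [i3 E3] := n_single t 3; have [i4 E4] := n_single t 4.
have j3 := rintegrableZ 6 i3; have j2 := rintegrableZ 7 i2.
have k3 := rintegrableD i4 j3; have k2 := rintegrableD k3 j2; have k1 := rintegrableD k2 i1.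
have i : rintegrable P (fun w => (n_ t w)%:R ^+ 4) by rewrite E.
have [ir le] := ret_fourth_moment mu eiid Ccount eC i.
split=> //; apply: le_trans le _; rewrite -/(n_ t) E /ret_bound.
by rewrite !ExD// !ExZ// E1 E2 E3 E4.
Qed.

Lemma sqr_pow_le (x : R) p : (p <= 2)%N -> (x ^+ p) ^+ 2 <= 1 + x ^+ 4.
Proof.
by rewrite -exprM; case: p => [|[|[|]]]//= _; rewrite ?expr0 ?mul1n; nra.
Qed.

Lemma ret_prod_integrable t s p q : (p <= 2)%N -> (q <= 2)%N ->
  rintegrable P (fun w => r_ t w ^+ p * r_ s w ^+ q) /\
  `|Ex P (fun w => r_ t w ^+ p * r_ s w ^+ q)| <= 1 + 2 * ret_bound.
Proof.
move=> p2 q2; have [it lt] := ret_fourth t; have [is_ ls] := ret_fourth s.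
have bd w : `|r_ t w ^+ p * r_ s w ^+ q| <= 1 + r_ t w ^+ 4 + r_ s w ^+ 4.
  have h1 := sqr_pow_le (r_ t w) p2; have h2 := sqr_pow_le (r_ s w) q2.
  by rewrite ler_norml; apply/andP; split; nra.
have mr k z : measurable_fun setT (fun w => r_ z w ^+ k).
  by apply: measurable_funX; exact: (measurable_ret mu eiid Ccount eC).
have i1 : rintegrable P (fun w => 1 + r_ t w ^+ 4).
  by apply: rintegrableD => //; exact: rintegrable_cst.
have i : rintegrable P (fun w => 1 + r_ t w ^+ 4 + r_ s w ^+ 4) by exact: rintegrableD.
have iX : rintegrable P (fun w => r_ t w ^+ p * r_ s w ^+ q).
  by apply: (rintegrable_le _ bd i); exact: measurable_funM.
split=> //; apply: le_trans (normr_Ex_le iX i bd) _.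
rewrite !ExD//; last exact: rintegrable_cst.
by rewrite Ex_cst; lra.
Qed.

Lemma ret_pow_integrable t p : (p <= 2)%N -> rintegrable P (fun w => r_ t w ^+ p) /\
  `|Ex P (fun w => r_ t w ^+ p)| <= 1 + 2 * ret_bound.
Proof.
move=> p2; have := ret_prod_integrable t t p2 (leq0n 2).
have -> : (fun w => r_ t w ^+ p * r_ t w ^+ 0) = (fun w => r_ t w ^+ p) => //.
by apply/funext => w; rewrite expr0 mulr1.
Qed.

Definition ret_cov p q (t s : int) : R := Ex P (fun w => r_ t w ^+ p * r_ s w ^+ q) -
  Ex P (fun w => r_ t w ^+ p) * Ex P (fun w => r_ s w ^+ q).

Lemma ret_covC p q t s : ret_cov p q t s = ret_cov q p s t.
Proof.
rewrite /ret_cov (mulrC (Ex P (fun w => r_ t w ^+ p))); congr (Ex P _ - _).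
by apply/funext => w; rewrite mulrC.
Qed.

Lemma ret_cov_bound p q t s : (p <= 2)%N -> (q <= 2)%N ->
  `|ret_cov p q t s| <= 1 + 2 * ret_bound + (1 + 2 * ret_bound) ^+ 2.
Proof.
move=> p2 q2; rewrite /ret_cov; apply: le_trans (ler_normB _ _) _.
have [_ h1] := ret_prod_integrable t s p2 q2.
have [_ h2] := ret_pow_integrable t p2; have [_ h3] := ret_pow_integrable s q2.
by apply: lerD => //; rewrite normrM expr2; apply: ler_pM.
Qed.

Let s2 := Ex P (fun w => e 0 w ^+ 2).

(** With [quad_coef], the coordinates of [cond_moment p] in the falling factorials of orders 1 and
    2; for [p = 2] they come from [mu^2 n^2 + s2 n] with [n^2 = n + n (n - 1)]. *)
Definition lin_coef (p : nat) : R := if p == 1 then mu else mu ^+ 2 + s2.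
Definition quad_coef (p : nat) : R := if p == 1 then 0 else mu ^+ 2.

Let s2_ge0 : 0 <= s2. Proof. by apply: Ex_ge0 => w; exact: sqr_ge0. Qed.

Lemma lin_coef_gt0 p : 0 < lin_coef p.
Proof. by rewrite /lin_coef; case: ifP => _ //; rewrite ltr_wpDr// exprn_gt0. Qed.

Lemma quad_coef_ge0 p : 0 <= quad_coef p.
Proof. by rewrite /quad_coef; case: ifP => _ //; exact: sqr_ge0. Qed.

Lemma cond_moment_ffact p n : (0 < p <= 2)%N ->
  cond_moment P e mu p n = lin_coef p * (n ^_ 1)%:R + quad_coef p * (n ^_ 2)%:R.
Proof.
rewrite /cond_moment /shock_moment -/s2 /lin_coef /quad_coef ffactn1.
case: p => [|[|[|]]]//= _; first by rewrite mul0r mul0r.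
have -> : (n ^_ 2)%:R = n%:R * (n%:R - 1) :> R.
  by case: n => [|n]; rewrite ?mul0r// ffactnS ffactn1 natrM -natr1 addrK.
by rewrite mul1r; ring.
Qed.

(** The mean of the [p]-th power of a return is the same expression without the factor 2. Here each
    factorial moment is weighted by its order, because covariances of orders [j] and [k] carry the
    factor [j * k]. *)
Definition amp (p : nat) : R := lin_coef p * l_ 1 + 2 * quad_coef p * l_ 2.

Lemma amp_gt0 p : 0 < amp p.
Proof.
rewrite /amp; have := mulr_gt0 (lin_coef_gt0 p) (l_gt0 1).
by have := mulr_ge0 (quad_coef_ge0 p) (ltW (l_gt0 2)); lra.
Qed.

Let N p q t s := Ex P (fun w => (n_ t w ^_ p)%:R * (n_ s w ^_ q)%:R).

Lemma ret_pow_mean (t : int) p : (0 < p <= 2)%N ->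
  Ex P (fun w => r_ t w ^+ p) = lin_coef p * l_ 1 + quad_coef p * l_ 2.
Proof.
move=> p2; have [|ir _] := @ret_pow_integrable t p; first by case/andP: p2.
have [i1 E1] := n_single t 1; have [i2 E2] := n_single t 2.
have E : (fun w => cond_moment P e mu p (day_count C t w)) =
  (fun w => lin_coef p * (n_ t w ^_ 1)%:R + quad_coef p * (n_ t w ^_ 2)%:R).
  by apply/funext => w; exact: cond_moment_ffact.
have j1 := rintegrableZ (lin_coef p) i1; have j2 := rintegrableZ (quad_coef p) i2.
rewrite (ret_moment eiid Ccount eC Cmono p2 ir); last by rewrite E; exact: rintegrableD.
by rewrite E ExD// !ExZ// E1 E2.
Qed.

Lemma ret_pow_pair_mean (t s : int) p q : s < t -> (0 < p <= 2)%N -> (0 < q <= 2)%N ->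
  Ex P (fun w => r_ t w ^+ p * r_ s w ^+ q) =
  lin_coef p * lin_coef q * N 1 1 t s + lin_coef p * quad_coef q * N 1 2 t s +
  quad_coef p * lin_coef q * N 2 1 t s + quad_coef p * quad_coef q * N 2 2 t s.
Proof.
move=> st p2 q2.
have [||ir _] := @ret_prod_integrable t s p q; [by case/andP: p2|by case/andP: q2|].
have ts : t != s by rewrite gt_eqF.
have i11 := n_pair_integrable 1 1 ts; have i12 := n_pair_integrable 1 2 ts.
have i21 := n_pair_integrable 2 1 ts; have i22 := n_pair_integrable 2 2 ts.
have j11 := rintegrableZ (lin_coef p * lin_coef q) i11.
have j12 := rintegrableZ (lin_coef p * quad_coef q) i12.
have j21 := rintegrableZ (quad_coef p * lin_coef q) i21.
have j22 := rintegrableZ (quad_coef p * quad_coef q) i22.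
have k1 := rintegrableD j11 j12; have k2 := rintegrableD k1 j21; have k3 := rintegrableD k2 j22.
have E : (fun w => cond_moment P e mu p (day_count C t w) * cond_moment P e mu q (day_count C s w)) =
  (fun w => lin_coef p * lin_coef q * ((n_ t w ^_ 1)%:R * (n_ s w ^_ 1)%:R) +
    lin_coef p * quad_coef q * ((n_ t w ^_ 1)%:R * (n_ s w ^_ 2)%:R) +
    quad_coef p * lin_coef q * ((n_ t w ^_ 2)%:R * (n_ s w ^_ 1)%:R) +
    quad_coef p * quad_coef q * ((n_ t w ^_ 2)%:R * (n_ s w ^_ 2)%:R)).
  by apply/funext => w; rewrite !cond_moment_ffact// /n_; ring.
rewrite (ret_pair_moment eiid Ccount eC Cmono st p2 q2 ir); last by rewrite E.
by rewrite E !ExD// !ExZ.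
Qed.

Lemma ret_cov_asymp p q eps : (0 < p <= 2)%N -> (0 < q <= 2)%N -> 0 < eps ->
  exists K : nat, forall t s : int, (K <= `|t - s|)%N ->
  `|ret_cov p q t s - k_ * amp p * amp q * sdiff a (t - s)%:~R| <= eps * sdiff a (t - s)%:~R.
Proof.
(* The pair formula is available for [s < t] only; the other order follows from [ret_covC] and the
   evenness of [sdiff]. *)
have half p' q' eps' : (0 < p' <= 2)%N -> (0 < q' <= 2)%N -> 0 < eps' ->
    exists K : nat, forall t s : int, s < t -> (K <= `|t - s|)%N ->
    `|ret_cov p' q' t s - k_ * amp p' * amp q' * sdiff a (t - s)%:~R| <= eps' * sdiff a (t - s)%:~R.
  move=> p2 q2 e0.
  have := lin_coef_gt0 p'; have := lin_coef_gt0 q'; have := quad_coef_ge0 p'; have := quad_coef_ge0 q'.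
  set b1 := lin_coef p'; set b2 := quad_coef p'; set c1 := lin_coef q'; set c2 := quad_coef q'.
  move=> c2_0 b2_0 c1_0 b1_0.
  (* The total weight of the four count covariances, among which the error is shared. *)
  pose S := (b1 + b2) * (c1 + c2).
  have S0 : 0 < S by apply: mulr_gt0; lra.
  have e1 : 0 < eps' / S by rewrite divr_gt0.
  have [K11 H11] := n_cov_asymp 1 1 e1; have [K12 H12] := n_cov_asymp 1 2 e1.
  have [K21 H21] := n_cov_asymp 2 1 e1; have [K22 H22] := n_cov_asymp 2 2 e1.
  exists (K11 + K12 + K21 + K22)%N => t s st Kts.
  have [k11 k12 k21 k22] : [/\ (K11 <= `|(t - s)%R|)%N, (K12 <= `|(t - s)%R|)%N,
    (K21 <= `|(t - s)%R|)%N & (K22 <= `|(t - s)%R|)%N] by move: Kts; clear; split; lia.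
  have {}H11 := H11 t s k11; have {}H12 := H12 t s k12.
  have {}H21 := H21 t s k21; have {}H22 := H22 t s k22.
  rewrite /ret_cov (ret_pow_pair_mean st p2 q2) !ret_pow_mean// /amp.
  rewrite -/b1 -/b2 -/c1 -/c2; rewrite -!/(N _ _ t s) in H11 H12 H21 H22.
  have -> : eps' = eps' / S * S by rewrite divfK// gt_eqF.
  move: H11 H12 H21 H22; set h := sdiff a _; set ee := eps' / S => H11 H12 H21 H22.
  set D11 := _ - _ * h in H11; set D12 := _ - _ * h in H12.
  set D21 := _ - _ * h in H21; set D22 := _ - _ * h in H22.
  have bnd (b D : R) : 0 <= b -> `|D| <= ee * h -> `|b * D| <= b * (ee * h).
    by move=> b0 HD; rewrite normrM ger0_norm// ler_wpM2l.
  have bc x y : 0 <= x -> 0 <= y -> 0 <= x * y :> R by exact: mulr_ge0.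
  have h11 := bnd (b1 * c1) _ ltac:(apply: bc; exact: ltW) H11.
  have h12 := bnd (b1 * c2) _ ltac:(apply: bc => //; exact: ltW) H12.
  have h21 := bnd (b2 * c1) _ ltac:(apply: bc => //; exact: ltW) H21.
  have h22 := bnd (b2 * c2) _ ltac:(exact: bc) H22.
  have -> : b1 * c1 * N 1 1 t s + b1 * c2 * N 1 2 t s + b2 * c1 * N 2 1 t s + b2 * c2 * N 2 2 t s -
    (b1 * l_ 1 + b2 * l_ 2) * (c1 * l_ 1 + c2 * l_ 2) -
    k_ * (b1 * l_ 1 + 2 * b2 * l_ 2) * (c1 * l_ 1 + 2 * c2 * l_ 2) * h =
    b1 * c1 * D11 + b1 * c2 * D12 + b2 * c1 * D21 + b2 * c2 * D22.
    by rewrite /D11 /D12 /D21 /D22; ring.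
  have -> : ee * S * h = b1 * c1 * (ee * h) + b1 * c2 * (ee * h) + b2 * c1 * (ee * h) + b2 * c2 * (ee * h).
    by rewrite /S; ring.
  apply: le_trans (ler_normD _ _) _; apply: lerD => //.
  apply: le_trans (ler_normD _ _) _; apply: lerD => //.
  by apply: le_trans (ler_normD _ _) _; exact: lerD.
move=> p2 q2 e0.
have [K1 H1] := half p q eps p2 q2 e0; have [K2 H2] := half q p eps q2 p2 e0.
(* The additional 1 excludes [t = s]. *)
exists (K1 + K2 + 1)%N => t s Kts.
have [k1 k2 ts] : [/\ (K1 <= `|(t - s)%R|)%N, (K2 <= `|(s - t)%R|)%N & t != s].
  by move: Kts; clear; split; lia.
have [st|ts'|ts'] := ltgtP s t; [exact: H1| |by rewrite ts' eqxx in ts].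
have := H2 s t ts' k2; rewrite ret_covC -sdiffN -intrN opprB.
by have -> : k_ * amp q * amp p = k_ * amp p * amp q by ring.
Qed.

(** One statement for both variances and the covariance: [y n] is the distance between the starting
    days of the two blocks, 0 for a block with itself and [n] for adjacent blocks. *)
Lemma covariance_sums_cvg p q (u v : nat -> int) (y : nat -> nat) (h : R) :
  (0 < p <= 2)%N -> (0 < q <= 2)%N -> (forall n, u n - v n = (y n)%:Z) ->
  (forall n : nat, `|(y n)%:R + n%:R| `^ a - 2 * `|(y n)%:R| `^ a + `|(y n)%:R - n%:R| `^ a
     = h * n%:R `^ a) ->
  (fun n : nat => fine (covariance P (fun w => \sum_(i < n) r_ (u n + i%:Z) w ^+ p)
     (fun w => \sum_(j < n) r_ (v n + j%:Z) w ^+ q)) / n%:R `^ a) @ \oo -->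
  k_ * amp p * amp q * h.
Proof.
move=> p2 q2 uv yh; have /andP[_ p2'] := p2; have /andP[_ q2'] := q2.
have lag n i j : u n + i%:Z - (v n + j%:Z) = (y n + i)%:Z - j%:Z.
  by rewrite PoszD -uv; ring.
have lagR n i j : (u n + i%:Z - (v n + j%:Z))%:~R = (y n)%:R + i%:R - j%:R :> R.
  by rewrite lag intrB -!pmulrn natrD.
have -> : (fun n : nat => fine (covariance P (fun w => \sum_(i < n) r_ (u n + i%:Z) w ^+ p)
     (fun w => \sum_(j < n) r_ (v n + j%:Z) w ^+ q)) / n%:R `^ a) =
  (fun n : nat => (\sum_(i < n) \sum_(j < n) ret_cov p q (u n + i%:Z) (v n + j%:Z)) / n%:R `^ a).
  apply/funext => n; congr (_ / _).
  rewrite (@covariance_sum _ _ _ P n (fun i w => r_ (u n + i%:Z) w ^+ p)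
    (fun j w => r_ (v n + j%:Z) w ^+ q)) //.
  - by move=> i; have [] := ret_pow_integrable (u n + i%:Z) p2'.
  - by move=> j; have [] := ret_pow_integrable (v n + j%:Z) q2'.
  - by move=> i j; have [] := ret_prod_integrable (u n + i%:Z) (v n + j%:Z) p2' q2'.
apply: (@kernel_sum_cvg R (fun n i j => ret_cov p q (u n + i%:Z) (v n + j%:Z)) y
  _ (1 + 2 * ret_bound + (1 + 2 * ret_bound) ^+ 2) a h a12).
- by move=> n i j; exact: ret_cov_bound.
- move=> eps e0; have [K HK] := ret_cov_asymp p2 q2 e0; exists K => n i j.
  by rewrite -lag -lagR; exact: HK.
by move=> n; rewrite sdiff_sum.
Qed.

End return_covariances.

(** * Normalisation and the limit of the correlation *)

Lemma div_sqrt_scale (R : realType) (x y z N : R) : 0 < N ->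
  z / Num.sqrt (x * y) = z / N / Num.sqrt (x / N * (y / N)).
Proof.
move=> N0; have N2 : 0 <= (N ^+ 2)^-1 by rewrite invr_ge0 exprn_ge0// ltW.
have -> : x / N * (y / N) = (N ^+ 2)^-1 * (x * y) by rewrite mulrACA -invfM -expr2 mulrC.
rewrite [in RHS]sqrtrM// sqrtrV ?exprn_ge0 ?ltW// sqrtr_sqr gtr0_norm//.
by rewrite invfM invrK mulrA divfK ?gt_eqF.
Qed.

Unset Implicit Arguments.
Set Strict Implicit.

Theorem mainTheorem11 (dT : measure_display) (T : measurableType dT)
  (R : realType) (P : probability T R)
  (d c lam mu : R) (m : nat)
  (B : R -> T -> R) (C : R -> T -> int) (e : int -> T -> R) :
  0 < d -> d < 1 / 2 -> 0 < c -> 0 < lam -> 0 < mu -> (1 <= m)%N ->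
  is_fBm P (1 / 2 + d) B ->
  is_counting C ->
  is_Cox P lam (Zproc c B) C ->
  iid_shocks P e ->
  indep_shocks_counts P e C ->
  forall tt : int,
    (fun HH : nat =>
       corr P (Ragg (ret mu C e) m tt HH) (RVagg (ret mu C e) m tt HH))
      @ \oo --> (2 `^ (2 * d) - 1).
Proof.
move=> d0 d1 c0 lam0 mu0 m1 fBm Ccount cox eiid eC tt.
set H := 1 / 2 + d in fBm; pose a := 2 * H.
have a12 : 1 < a < 2 by rewrite /a /H; apply/andP; split; lra.
have a0 : a != 0 by rewrite gt_eqF//; case/andP: a12 => + _; lra.
have Cmono := count_mono_ae lam0 fBm Ccount cox.
pose l_ := ell P c B lam; pose k_ := kap H c.
have k0 : 0 < k_ by rewrite divr_gt0// powR_gt0.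
have l0 : forall p, 0 < l_ p by exact: (ell_gt0 a12 c0 lam0 fBm).
have pair : forall (t s : int) p q, t != s ->
    rintegrable P (fun w => (day_count C t w ^_ p)%:R * (day_count C s w ^_ q)%:R).
  by move=> t s p q ts; have [] := ffact_pair a12 c0 lam0 fBm Ccount cox p q ts.
have single := ffact_single a12 c0 lam0 fBm Ccount cox.
have asymp := ffact_cov_asymp a12 c0 lam0 fBm Ccount cox.
pose A := amp P e mu l_.
have A0 p : 0 < A p by exact: amp_gt0.
have sums := covariance_sums_cvg mu0 eiid Ccount eC Cmono a12 pair single asymp.
(* For blocks of [n] days, the past one ends on day [tt * m] and the future one starts on the next
   day, so the starting days are exactly [n] apart. *)
pose u (n : nat) : int := tt * m%:Z + 1; pose v (n : nat) : int := tt * m%:Z - n%:Z + 1.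
(* The exponent 1 makes both aggregates instances of [covariance_sums_cvg]. *)
pose X n w := \sum_(i < n) ret mu C e (u n + i%:Z) w ^+ 1.
pose Y n w := \sum_(i < n) ret mu C e (v n + i%:Z) w ^+ 2.
have self (n : nat) : `|0%:R + n%:R| `^ a - 2 * `|0%:R| `^ a + `|0%:R - n%:R| `^ a = 2 * n%:R `^ a :> R.
  by rewrite add0r sub0r normrN normr0 powR0// normr_nat; ring.
have cross (n : nat) : `|n%:R + n%:R| `^ a - 2 * `|n%:R| `^ a + `|n%:R - n%:R| `^ a =
    (2 `^ a - 2) * n%:R `^ a :> R.
  by rewrite subrr normr0 powR0// -natrD !normr_nat addnn -mul2n natrM powRM//; ring.
have cXX : (fun n => fine (covariance P (X n) (X n)) / n%:R `^ a) @ \oo --> k_ * A 1 * A 1 * 2.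
  by apply: (sums 1 1 u u (fun=> 0%N)) => // n; rewrite subrr.
have cYY : (fun n => fine (covariance P (Y n) (Y n)) / n%:R `^ a) @ \oo --> k_ * A 2 * A 2 * 2.
  by apply: (sums 2 2 v v (fun=> 0%N)) => // n; rewrite subrr.
have cXY : (fun n => fine (covariance P (X n) (Y n)) / n%:R `^ a) @ \oo --> k_ * A 1 * A 2 * (2 `^ a - 2).
  by apply: (sums 1 2 u v id) => // n; rewrite /u /v; ring.
have XE HH : Ragg (ret mu C e) m tt HH = X (HH * m)%N.
  by apply/funext => w; apply: eq_bigr => i _; rewrite expr1.
have YE HH : RVagg (ret mu C e) m tt HH = Y (HH * m)%N.
  apply/funext => w; apply: eq_bigr => i _; congr (ret _ _ _ _ _ ^+ 2).
  by rewrite /v PoszM; ring.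
have corrE n : (0 < n)%N -> corr P (X n) (Y n) = fine (covariance P (X n) (Y n)) / n%:R `^ a /
    Num.sqrt (fine (covariance P (X n) (X n)) / n%:R `^ a * (fine (covariance P (Y n) (Y n)) / n%:R `^ a)).
  move=> n0; have na : 0 < n%:R `^ a :> R by rewrite powR_gt0 ?ltr0n.
  exact: div_sqrt_scale.
have lim : (fun n => corr P (X n) (Y n)) @ \oo --> 2 `^ (2 * d) - 1.
  have kA0 : 0 < 2 * k_ * A 1 * A 2.
    by apply: mulr_gt0; [apply: mulr_gt0; [exact: mulr_gt0|]|].
  have sq : Num.sqrt (k_ * A 1 * A 1 * 2 * (k_ * A 2 * A 2 * 2)) = 2 * k_ * A 1 * A 2.
    rewrite (_ : _ * _ = (2 * k_ * A 1 * A 2) ^+ 2); last by ring.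
    by rewrite sqrtr_sqr gtr0_norm.
  (* The amplitudes cancel, leaving [(2^a - 2) / 2], and [a = 1 + 2 * d]. *)
  have -> : 2 `^ (2 * d) - 1 = k_ * A 1 * A 2 * (2 `^ a - 2) / Num.sqrt (k_ * A 1 * A 1 * 2 * (k_ * A 2 * A 2 * 2)) :> R.
    rewrite sq; have -> : a = 1 + 2 * d by rewrite /a /H; field.
    rewrite powRD; last by apply/implyP => _; rewrite gt_eqF.
    by rewrite powRr1//; field; rewrite !gt_eqF.
  have : (fun n => fine (covariance P (X n) (Y n)) / n%:R `^ a /
    Num.sqrt (fine (covariance P (X n) (X n)) / n%:R `^ a * (fine (covariance P (Y n) (Y n)) / n%:R `^ a))) @ \oo
    --> k_ * A 1 * A 2 * (2 `^ a - 2) / Num.sqrt (k_ * A 1 * A 1 * 2 * (k_ * A 2 * A 2 * 2)).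
    apply: cvgM => //; apply: cvgV; first by rewrite sq gt_eqF.
    by apply: continuous_cvg; [exact: sqrt_continuous|exact: cvgM].
  apply: cvg_trans; apply: near_eq_cvg; near=> n; rewrite corrE//.
  by near: n; exact: nbhs_infty_gt.
have -> : (fun HH => corr P (Ragg (ret mu C e) m tt HH) (RVagg (ret mu C e) m tt HH)) =
    (fun n => corr P (X n) (Y n)) \o (fun HH => HH * m)%N.
  by apply/funext => HH; rewrite /= XE YE.
(* Since [m >= 1], the number of days [HH * m] is at least [HH] and tends to infinity with it. *)
apply: cvg_comp lim.
move=> S [N _ SN]; exists N => // n /= Nn; apply: SN => /=.
by apply: leq_trans Nn _; rewrite leq_pmulr.
Unshelve. all: by end_near.
Qed.
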